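(* Let $\$(\nu)=O(e^{\sigma\nu})$ for some $\sigma\in(0,\infty)$. Let $\gamma$ be weights with $\mathrm{decay}_\gamma>1$. Suppose the quadrature assumption (Q) of the context is satisfied with constants $c,C,\tau>0$, $\alpha_1\ge0$, $\alpha_2\in[0,1]$, and suppose in addition that (with the quantities defined in the context) $$r_{u,u,a}^2=O(\gamma_u),\qquad d(\varepsilon)=o(\ln(1/\varepsilon)),\qquad \mathcal B(\varepsilon)=\varepsilon^{-o(1)},$$ where the first estimate is uniform in $u\in\mathcal U$ and the other two are for $\varepsilon\to0$. Then for all $\delta>0$ $$e(N,B(K))^2=O\left(N^{-\min\{\tau,\ \mathrm{decay}_\gamma-1\}+\delta}\right),$$ or, equivalently, $$p^{\rm res}\le\max\left\{\frac2\tau,\ \frac{2}{\mathrm{decay}_\gamma-1}\right\}.$$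
   Context: Notation: $\mathbb N=\{1,2,\dots\}$, $\mathcal U$ is the set of all finite subsets of $\mathbb N$. For a reproducing kernel $L$, $H(L)$ is the reproducing kernel Hilbert space with norm $\|\cdot\|_L$, and $B(L)$ its norm unit ball. Setting: $D\subseteq\mathbb R$, $\rho$ is a probability measure on $D$, $\mu=\otimes_{n\in\mathbb N}\rho$ on $D^{\mathbb N}$. $k\ne0$ is a measurable reproducing kernel on $D\times D$ such that $H(k)$ contains no nonzero constant function, $M:=\int_D k(x,x)\,\rho(dx)<\infty$, $\int_D k(x,y)\,\rho(dx)=0$ for all $y\in D$, and $k(a,a)>0$ for all $a\in D$. The weights $\gamma=(\gamma_u)_{u\in\mathcal U}$ are non-negative with $\gamma_\emptyset=1$, $\sum_{u}\gamma_uM^{|u|}<\infty$, and $\gamma_v>0$ implies $\gamma_u>0$ for all $u\subseteq v$. Put $k_u(x,y)=\prod_{j\in u}k(x_j,y_j)$ ($k_\emptyset=1$), $H_u=H(k_u)$ (functions depending only on $x_u=(x_j)_{j\in u}$, identified with functions on $D^u$), $\mathfrak X=\{x\in D^{\mathbb N}:\sum_{u\in\mathcal U}\gamma_uk_u(x,x)<\infty\}$ (one has $\mu(\mathfrak X)=1$), $K(x,y)=\sum_{u\in\mathcal U}\gamma_uk_u(x,y)$ for $x,y\in\mathfrak X$, and $I(f)=\int_{\mathfrak X}f\,d\mu$ for $f\in H(K)$. Anchor: $a=(a,a,\dots)$ where $a\in D$ satisfies $\sum_{u\in\mathcal U}\gamma_uk(a,a)^{|u|}<\infty$. Cost and algorithms: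 $\$:\mathbb N_0\to[1,\infty]$ is monotone increasing. For $v\in\mathcal U$ let $\mathfrak X_{v,a}=\{x\in D^{\mathbb N}: x_j=a\ \forall j\notin v\}$. Evaluating $f$ at $x$ costs $c_a(x)=\inf\{\$(|u|): x\in\mathfrak X_{u,a},\,u\in\mathcal U\}$. A randomized algorithm $Q$ yields for each $f\in H(K)$ a square-integrable random variable $Q(f)$, computed from (possibly adaptively and randomly chosen) function values of $f$; its cost $\mathrm{cost}_{c_a}(Q,f)$ is the sum of the costs of all function evaluations. $\mathcal A^{\rm res}$ is the class of all randomized algorithms for which there exist $n\in\mathbb N_0$ and $v_1,\dots,v_n\in\mathcal U$ such that for every $f\in H(K)$ exactly $n$ function evaluations are performed, the $i$th sample point is taken from $\mathfrak X_{v_i,a}$, and $\mathbb E(\mathrm{cost}_{c_a}(Q,f))=\sum_{i=1}^n\$(|v_i|)$. For $F\subseteq H(K)$: $\mathrm{cost}(Q,F)=\sup_{f\in F}\mathbb E(\mathrm{cost}_{c_a}(Q,f))$, $e(Q,F)=(\sup_{f\in F}\mathbb E((I(f)-Q(f))^2))^{1/2}$, $e(N,F)=\inf\{e(Q,F): Q\in\mathcal A^{\rm res},\ \mathrm{cost}(Q,F)\le N\}$. Further, $\mathrm{comp}(\varepsilon,B(K))=\inf\{\mathrm{cost}(Q,B(K)): Q\in\mathcal A^{\rm res},\ e(Q,B(K))\le\varepsilon\}$, and $p^{\rm res}$ is the infimum of all $p\ge0$ for which there is $C\ge0$ with $\mathrm{comp}(\varepsilon,B(K))\le C\varepsilon^{-p}$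 for all $\varepsilon>0$. Decay: with $\widehat\gamma_u=\gamma_uk_u(a,a)$, $\mathrm{decay}_\gamma=\sup\{p\in\mathbb R:\sum_{u\in\mathcal U}\widehat\gamma_u^{1/p}<\infty\}$. Quadrature assumption (Q): there are $c,C,\tau>0$, $\alpha_1\ge0$, $\alpha_2\in[0,1]$ such that for every nonempty $u\in\mathcal U$ with $\gamma_u>0$ and every $n\in\mathbb N$ there is an unbiased randomized quadrature $Q_{u,n}(\omega,f)=\sum_{i=1}^nt_if(x^{(i)}(\omega))$, $f\in L^2(D^u,\rho^u)$, with deterministic real $t_i$ satisfying $\sum_it_i=1$, with $\omega=(\omega_j)_{j\in u}$ in a product probability space $(\Omega^u,\mathbb P^u)$, and random points $x^{(i)}=(x^{(i)}_j)_{j\in u}\in D^u$ such that $x^{(i)}_j$ depends on $\omega$ only through $\omega_j$ and has distribution $\rho$, and such that for all $w\subseteq u$ with $\gamma_w>0$ and all $f_w\in H_w$ $$\mathrm{Var}(Q_{u,n}(f_w))\le c\,C^{|u|}(n+1)^{-\tau}F_w(n)\|f_w\|_{k_w}^2,$$ where $F_w(n)=1$ if $|w|\le1$ and $F_w(n)=\left(1+\frac{\ln(n+1)}{(|w|-1)^{\alpha_2}}\right)^{\alpha_1(|w|-1)^{\alpha_2}}$ if $|w|\ge2$. Quantities in the three estimates: $r_{u,u,a}^2=\sum_{u'\subset\mathbb N\setminus u,\,u'\in\mathcal U}\gamma_{u\cup u'}k_{u'}(a,a)$. Put $\tau'=\tau$ if $\tau<\mathrm{decay}_\gamma-1$; otherwise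 $\tau$ is replaced by $\tau'=\mathrm{decay}_\gamma-1-\delta_0$ with small $\delta_0>0$ (and the estimates are required for all sufficiently small $\delta_0>0$). Choose $\alpha_0$ with $\frac{\tau'}{\mathrm{decay}_\gamma}<\alpha_0<1-\frac1{\mathrm{decay}_\gamma}$, put $L_{1-\alpha_0}=\sum_{\emptyset\ne u\in\mathcal U}\gamma_u^{1-\alpha_0}$ (presupposed finite) and $\widehat C=\max\{C(1+k(a,a)),4k(a,a)\}$. For $\varepsilon>0$, $u\in\mathcal U$ let $n_u'=0$ if $cL_{1-\alpha_0}\widehat C^{|u|}\gamma_u^{\alpha_0}<\varepsilon^2$ and $n_u'=\lfloor(cL_{1-\alpha_0}\widehat C^{|u|}\gamma_u^{\alpha_0}\varepsilon^{-2})^{1/\tau'}\rfloor$ otherwise; let $n_u=\max\{1,n_u'\}$ if there is $v\in\mathcal U$ with $u\subseteq v$ and $n_v'\ge1$, and $n_u=0$ otherwise. Then $\mathcal Q=\mathcal Q(\varepsilon)=\{u\in\mathcal U:n_u>0\}$, $d(\varepsilon)=\max\{|u|:u\in\mathcal Q\}$, and $\mathcal B(\varepsilon)=\max_{u\in\mathcal Q}\max_{w\subseteq u}F_w(n_u)$. *)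

(* Defs.v *)
From HB Require Import structures.
From mathcomp Require Import all_boot all_order all_algebra finmap.
From mathcomp Require Import all_classical all_reals all_analysis measurable_realfun.

Set Implicit Arguments.
Unset Strict Implicit.
Unset Printing Implicit Defensive.

Import Order.TTheory GRing.Theory Num.Theory.
Import numFieldTopology.Exports numFieldNormedType.Exports.

Local Open Scope classical_set_scope.
Local Open Scope ring_scope.

(* The set D of reals with its trace Borel sigma-algebra.  Measurable types of
   the library carry a distinguished point; the anchor a serves as that point
   and plays no other role in the structure. *)
Definition pt_dom (R : realType) (D : set R) (a : D) : Type := D.
HB.instance Definition _ (R : realType) (D : set R) (a : D) :=
  Choice.copy (pt_dom a) (set_type D).
HB.instance Definition _ (R : realType) (D : set R) (a : D) :=
  isPointed.Build (pt_dom a) a.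

Definition dom (R : realType) (D : set R) (a : D) :=
  g_sigma_algebra_preimageType
    ((fun x : D => val x) : pt_dom a -> measurableTypeR R).

(* T^I with the product sigma-algebra.  The coordinate set {1, 2, ...} is
   encoded by nat (coordinate j+1 has index j); labels of coordinates are never
   used as numbers. *)
Definition coord_sets (I : Type) d (T : measurableType d) : set (set (I -> T)) :=
  [set C | exists j A, measurable A /\ C = [set x | A (x j)]].

Definition prodspace (I : Type) d (T : measurableType d) :=
  g_sigma_algebraType (@coord_sets I d T).

Definition is_prod_measure (R : realType) (I : choiceType) d
    (T : measurableType d) (P : probability T R)
    (PI : probability (prodspace I T) R) : Prop :=
  forall (J : {fset I}) (A : I -> set T), (forall j, measurable (A j)) ->
    PI [set x | forall j, j \in J -> A j (x j)] =
    (\prod_(j <- J) fine (P (A j)))%:E.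

Definition restr (T : Type) (u : {fset nat}) (x : nat -> T) : u -> T :=
  fun j => x (val j).
Arguments restr {T} u x.

(* The reproducing kernel Hilbert space of L: a Hilbert space of functions on X
   that contains the functions L(., x) and has the reproducing property.  It is
   unique, and exists for every symmetric positive semidefinite L. *)
Record rkhs (R : realType) (X : Type) (L : X -> X -> R) := Rkhs {
  rk_space : set (X -> R);
  rk_dot : (X -> R) -> (X -> R) -> R;
  rk_0 : rk_space (fun=> 0);
  rk_lin : forall (b : R) f g, rk_space f -> rk_space g ->
    rk_space (fun x => b * f x + g x);
  rk_dotC : forall f g, rk_space f -> rk_space g -> rk_dot f g = rk_dot g f;
  rk_dotl : forall (b : R) f g h, rk_space f -> rk_space g -> rk_space h ->
    rk_dot (fun x => b * f x + g x) h = b * rk_dot f h + rk_dot g h;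
  rk_dot_ge0 : forall f, rk_space f -> 0 <= rk_dot f f;
  rk_dot_eq0 : forall f, rk_space f -> rk_dot f f = 0 -> f = (fun=> 0);
  rk_complete : forall F : nat -> X -> R, (forall n, rk_space (F n)) ->
    (forall e, 0 < e -> exists N, forall m n, (N <= m)%N -> (N <= n)%N ->
       rk_dot (fun x => F m x - F n x) (fun x => F m x - F n x) < e) ->
    exists2 f, rk_space f &
      forall e, 0 < e -> exists N, forall n, (N <= n)%N ->
       rk_dot (fun x => F n x - f x) (fun x => F n x - f x) < e;
  rk_ker : forall x, rk_space (fun y => L y x);
  rk_repr : forall f x, rk_space f -> f x = rk_dot f (fun y => L y x)
}.

Definition rk_norm (R : realType) (X : Type) (L : X -> X -> R) (H : rkhs L)
  (f : X -> R) : R := Num.sqrt (rk_dot H f f).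

Definition rk_ball (R : realType) (X : Type) (L : X -> X -> R) (H : rkhs L) :
  set (X -> R) := [set f | rk_space H f /\ rk_norm H f <= 1].

(* Randomized algorithms performing ra_n evaluations of an input f : X -> R:
   the next evaluation point depends on the random element and on the list of
   the function values observed so far, the output on all values. *)
Record rand_alg (R : realType) (X : Type) := RandAlg {
  ra_disp : measure_display;
  ra_Omega : measurableType ra_disp;
  ra_P : probability ra_Omega R;
  ra_n : nat;
  ra_node : ra_Omega -> seq R -> X;
  ra_out : ra_Omega -> seq R -> R
}.

Section algorithms.
Variables (R : realType) (X : Type) (Q : rand_alg R X) (f : X -> R).
Variable w : ra_Omega Q.

Fixpoint ra_values (i : nat) : seq R :=
  if i is j.+1 then rcons (ra_values j) (f (ra_node w (ra_values j)))
  else [::].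

Definition ra_point (i : nat) : X := ra_node w (ra_values i).

Definition ra_value : R := ra_out w (ra_values (ra_n Q)).

Definition ra_cost (c : X -> \bar R) : \bar R :=
  (\sum_(i < ra_n Q) c (ra_point i))%E.

End algorithms.

Arguments ra_point {R X} Q f w i.
Arguments ra_value {R X} Q f w.
Arguments ra_cost {R X} Q f w c.

Section setting.
Variables (R : realType) (D : set R) (a : D).
Local Notation T := (dom a).
Variable k : T -> T -> R.

(* k_u on D^u; for x in D^nat use it at restr u x *)
Definition kprod (u : {fset nat}) (x y : u -> T) : R :=
  \prod_(j : u) k (x j) (y j).

Variable gamma : {fset nat} -> R.

Definition Xdom : set (nat -> T) :=
  [set x | \esum_(u in [set: {fset nat}])
    (gamma u * kprod (restr u x) (restr u x))%:E < +oo]%E.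

(* the series converges absolutely on Xdom *)
Definition Kker (x y : Xdom) : R :=
  let g (u : {fset nat}) : \bar R :=
    (gamma u * kprod (restr u (val x)) (restr u (val y)))%:E in
  fine (\esum_(u in setT) (g^\+)%E u) - fine (\esum_(u in setT) (g^\-)%E u).

Variable mu : probability (prodspace nat T) R.

Definition Int (f : Xdom -> R) : R :=
  Rintegral mu Xdom (fun x => oapp f 0 (insub x)).

Definition anchored (v : {fset nat}) : set (nat -> T) :=
  [set x | forall j, j \notin v -> x j = a].

Variable dollar : nat -> \bar R.

Definition c_a (x : Xdom) : \bar R :=
  ereal_inf [set dollar #|` u|%fset | u in [set u | anchored u (val x)]].

Variable HK : rkhs Kker.

Definition A_res (Q : rand_alg R Xdom) : Prop :=
  exists v : 'I_(ra_n Q) -> {fset nat}, forall f, rk_space HK f ->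
  [/\ measurable_fun [set: ra_Omega Q] (ra_value Q f),
      (\int[ra_P Q]_w ((ra_value Q f w) ^+ 2)%:E < +oo)%E,
      forall w (i : 'I_(ra_n Q)), anchored (v i) (val (ra_point Q f w i)),
      measurable_fun [set: ra_Omega Q] (fun w => ra_cost Q f w c_a)
    & (\int[ra_P Q]_w ra_cost Q f w c_a =
       \sum_(i < ra_n Q) dollar #|` v i|%fset)%E].

Definition cost (Q : rand_alg R Xdom) (F : set (Xdom -> R)) : \bar R :=
  ereal_sup [set (\int[ra_P Q]_w ra_cost Q f w c_a)%E | f in F].

Definition error (Q : rand_alg R Xdom) (F : set (Xdom -> R)) : \bar R :=
  sqrte (ereal_sup
    [set (\int[ra_P Q]_w ((Int f - ra_value Q f w) ^+ 2)%:E)%E | f in F]).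

Definition min_error (N : R) (F : set (Xdom -> R)) : \bar R :=
  ereal_inf [set e | exists Q : rand_alg R Xdom,
    [/\ A_res Q, (cost Q F <= N%:E)%E & e = error Q F]].

Definition comp (eps : R) : \bar R :=
  ereal_inf [set b | exists Q : rand_alg R Xdom,
    [/\ A_res Q, (error Q (rk_ball HK) <= eps%:E)%E
      & b = cost Q (rk_ball HK)]].

Definition p_res : \bar R :=
  ereal_inf [set p%:E | p in [set p : R | 0 <= p /\
    exists2 C : R, 0 <= C &
      forall eps, 0 < eps -> (comp eps <= (C * eps `^ (- p))%:E)%E]].

(* k_u(a, a) = k(a, a)^|u| at the anchor (a, a, ...) *)
Definition gamma_hat (u : {fset nat}) : R := gamma u * k a a ^+ #|` u|%fset.

Definition decay : \bar R :=
  ereal_sup [set p%:E | p in [set p : R |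
    (\esum_(u in [set: {fset nat}]) ((gamma_hat u) `^ p^-1)%:E < +oo)%E]].

Definition rsq (u : {fset nat}) : \bar R :=
  \esum_(u' in [set u' : {fset nat} | [disjoint u & u']%fset])
    (gamma (u `|` u')%fset * k a a ^+ #|` u'|%fset)%:E.

(* F_w(n) for |w| = m *)
Definition Fw (alpha1 alpha2 : R) (m n : nat) : R :=
  if (m <= 1)%N then 1
  else (1 + ln n.+1%:R / m.-1%:R `^ alpha2) `^ (alpha1 * m.-1%:R `^ alpha2).

Variables (rho : probability T R) (Hu : forall u, rkhs (@kprod u)).

(* The integral over D^u with respect to rho^u is written as the integral of
   f (restr u x) with respect to mu(dx), rho^u being the image of the product
   measure mu under restr u.  The product structure of (Omega^u, P^u) enters
   through the points: component j of the i-th point is xi i j (omega_j). *)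
Definition quad_assumption (c C tau alpha1 alpha2 : R) : Prop :=
  forall u : {fset nat}, u != fset0 -> 0 < gamma u ->
  forall n, (0 < n)%N ->
  exists d (Omega : measurableType d) (P : probability Omega R)
         (Pu : probability (prodspace u Omega) R)
         (t : 'I_n -> R) (xi : 'I_n -> u -> Omega -> T),
  [/\ is_prod_measure P Pu /\ \sum_i t i = 1,
      forall i j, measurable_fun setT (xi i j),
      forall i j (B : set T), measurable B -> P (xi i j @^-1` B) = rho B,
      forall f : prodspace u T -> R, measurable_fun setT f ->
        (\int[mu]_x ((f (restr u x)) ^+ 2)%:E < +oo)%E ->
        ('E_Pu[(fun om => \sum_i t i * f (fun j => xi i j (om j)))%R] =
         \int[mu]_x (f (restr u x))%:E)%E
    & forall (w : {fset nat}) (wu : (w `<=` u)%fset), 0 < gamma w ->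
      forall f, rk_space (Hu w) f ->
        (variance Pu (fun om => \sum_i t i *
            f (fun j => xi i (fincl wu j) (om (fincl wu j))))%R
         <= (c * C ^+ #|` u|%fset * n.+1%:R `^ (- tau) *
             Fw alpha1 alpha2 #|` w|%fset n * rk_norm (Hu w) f ^+ 2)%:E)%E].

Section parameters.
Variables (c C alpha1 alpha2 tau' alpha0 : R).

Definition Lsum : \bar R :=
  \esum_(u in [set u : {fset nat} | u != fset0]) ((gamma u) `^ (1 - alpha0))%:E.

Definition C_hat : R := Num.max (C * (1 + k a a)) (4 * k a a).

Definition n_prime (eps : R) (u : {fset nat}) : nat :=
  let b := c * fine Lsum * C_hat ^+ #|` u|%fset * gamma u `^ alpha0 in
  if b < eps ^+ 2 then 0%N else Num.truncn ((b / eps ^+ 2) `^ tau'^-1).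

Definition n_of (eps : R) (u : {fset nat}) : nat :=
  if `[< exists v : {fset nat}, (u `<=` v)%fset /\ (1 <= n_prime eps v)%N >]
  then maxn 1 (n_prime eps u) else 0%N.

Definition Qset (eps : R) : set {fset nat} := [set u | (0 < n_of eps u)%N].

(* d(eps) and B(eps); the suprema are maxima unless they are +oo, and -oo if
   Qset eps is empty *)
Definition d_eps (eps : R) : \bar R :=
  ereal_sup [set (#|` u|%fset%:R)%:E | u in Qset eps].

Definition B_eps (eps : R) : \bar R :=
  ereal_sup [set b | exists u w : {fset nat}, [/\ Qset eps u, (w `<=` u)%fset
    & b = (Fw alpha1 alpha2 #|` w|%fset (n_of eps u))%:E]].

(* d(eps) = o(ln(1/eps)) and B(eps) = eps^(-o(1)) as eps -> 0; since d >= 0 and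
   B >= 1, only upper bounds matter *)
Definition estimates : Prop :=
  (forall eta, 0 < eta ->
    \forall eps \near 0^'+, (d_eps eps <= (eta * ln eps^-1)%:E)%E) /\
  (forall eta, 0 < eta ->
    \forall eps \near 0^'+, (B_eps eps <= (eps `^ (- eta))%:E)%E).

End parameters.

Definition estimates_for (c C alpha1 alpha2 tau' : R) : Prop :=
  exists alpha0 : R,
  [/\ (tau'%:E / decay < alpha0%:E)%E, (alpha0%:E < 1 - decay^-1)%E,
      (Lsum alpha0 < +oo)%E & estimates c C alpha1 alpha2 tau' alpha0].

Definition asymptotic_estimates (c C tau alpha1 alpha2 : R) : Prop :=
  if (tau%:E < decay - 1)%E then estimates_for c C alpha1 alpha2 tau
  else \forall delta0 \near 0^'+,
         estimates_for c C alpha1 alpha2 (fine decay - 1 - delta0).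

End setting.

(* Main.v *)
(* The witness is the changing dimension algorithm: f is split into its components
   f_{u,a} anchored at a, and for u in Q(eps) the mean of f_{u,a} is estimated by
   Q_{u,n_u}, one value of f_{u,a} costing 2^|u| values of f.
   Bias: on kernel sections, the functional I(f) - sum_{u in Q(eps)} I(f_{u,a}) is a
   series over the w outside of Q(eps), so its squared norm is at most the sum over
   these w of 4^|w| gamma_w k(a,a)^|w|, which is O(eps^2) because n_w' = 0 there.
   Variance: f_{u,a} is an alternating sum of restrictions of a single function of
   H_u whose norm is at most r_{u,u,a} |f|, so the u-th variance is at most
   const^|u| (n_u + 1)^-tau gamma_u, and the choice of n_u makes the sum over u
   eps^(2 - o(1)); the cross terms are bounded crudely, since const^|u| is
   eps^(-o(1)) by d(eps) = o(ln(1/eps)).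
   Cost: alpha0 / tau' > 1 / decay makes the n_u sum to eps^(-2/tau' - o(1)). *)

Require Import Defs.
From mathcomp Require Import all_boot all_order all_algebra finmap.
From mathcomp Require Import all_classical all_reals all_analysis measurable_realfun.
From mathcomp Require Import ring lra.

Set Implicit Arguments.
Unset Strict Implicit.
Unset Printing Implicit Defensive.

Import Order.TTheory GRing.Theory Num.Theory.
Import numFieldTopology.Exports numFieldNormedType.Exports.

Local Open Scope classical_set_scope.
Local Open Scope ring_scope.

(** * Reproducing kernel Hilbert spaces *)

(** H(K) is accessible only through the axioms of [rkhs] and the series of K, so no decomposition of
    H(K) into the spaces H_u is set up. Every estimate on H(K) is an inequality between Gram
    matrices of kernel sections, which is carried to all functions by density ([rk_dense]) or turned
    into an element of a space by the variational Riesz argument [riesz_span]. Since k has mean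
    zero, integrating the coordinates in V kills k_w(., y) for every w that meets V. By
    inclusion-exclusion the multiplier of k_w in the bias becomes a signed count of the subsets of w
    lying in Q(eps). It vanishes on Q(eps), which is closed under subsets; elsewhere it is at most
    2^|w| in modulus, whose square is the factor 4^|w|. f_{u,a} itself need not lie in H_u, because
    H(k) has no nonzero constants. This is why (Q) is applied to the restrictions, which lie in the
    H_v with v contained in u. Two clauses of the definitions shape the end of the proof: the cost
    has to equal $(|v|) and not only be bounded by it, and p^res asks for a bound at every eps > 0,
    so that large eps need an algorithm of cost zero. *)

(** The choice t = x / p gives x <= p q / x without a square root. When p = 0, a large t contradicts
    0 < x. *)
Lemma sqr_le_of_young (R : realType) (x p q : R) : 0 <= p -> 0 <= q ->
  (forall t : R, 0 < t -> 2 * x <= t * p + t^-1 * q) -> x ^+ 2 <= p * q \/ x <= 0.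
Proof.
move=> p0 q0 h; case: (lerP x 0) => [|x0]; [by right|left].
have [p_eq0|pn0] := eqVneq p 0.
  have xq : (2 * x) * x <= q.
    have [q_eq0|qn0] := eqVneq q 0.
      by have := h 1 ltr01; rewrite p_eq0 q_eq0; nra.
    have qp : 0 < q by rewrite lt_def qn0.
    have := h (q / x) (divr_gt0 qp x0); rewrite p_eq0 mulr0 add0r invf_div.
    by rewrite divfK//; lra.
  have := h ((q + 1) / x); rewrite p_eq0 mulr0 add0r invf_div => H.
  have q1 : 0 < q + 1 by lra.
  have := H (divr_gt0 q1 x0); rewrite mulrAC ler_pdivlMr//.
  nra.
have pp : 0 < p by rewrite lt_def pn0.
have := h (x / p) (divr_gt0 x0 pp).
rewrite divfK// invf_div -mulrA => H.
have : x * (2 * x) <= x * (x + p / x * q).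
  by rewrite ler_pM2l//; lra.
have -> : x * (x + p / x * q) = x ^+ 2 + p * q.
  by field; rewrite gt_eqF.
nra.
Qed.

(** Cauchy-Schwarz from its linear form. Bounds of the linear form can be added over the terms of a
    series, and only the total is turned back into a product. *)
Lemma young_sqr_le (R : realType) (x p q : R) : 0 <= p -> 0 <= q ->
  (forall t : R, 0 < t -> 2 * `|x| <= t * p + t^-1 * q) -> x ^+ 2 <= p * q.
Proof.
move=> p0 q0 /(sqr_le_of_young p0 q0)[|]; first by rewrite real_normK ?num_real.
by rewrite normr_le0 => /eqP ->; rewrite expr0n/= mulr_ge0.
Qed.

Lemma young_of_sqr (R : realType) (x p q r : R) : 0 < r -> 0 <= p -> 0 <= q ->
  x ^+ 2 <= p * q -> 2 * `|x| <= r * p + r^-1 * q.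
Proof.
move=> r0 p0 q0 xpq; have s0 : 0 <= r^-1 * q by rewrite mulr_ge0// invr_ge0 ltW.
have t0 : 0 <= r * p by rewrite mulr_ge0// ltW.
have E : (r * p) * (r^-1 * q) = p * q by field; rewrite gt_eqF.
rewrite -(@ler_pXn2r _ 2) ?nnegrE ?mulr_ge0 ?addr_ge0//.
rewrite exprMn real_normK ?num_real//.
by have := sqr_ge0 (r * p - r^-1 * q); move: E; set u := r * p; set v := r^-1 * q; nra.
Qed.

Section rkhs_theory.
Variables (R : realType) (X : Type) (L : X -> X -> R) (H : rkhs L).
Local Notation V := (rk_space H).
Local Notation dot := (rk_dot H).

Lemma rk_scale b f : V f -> V (fun x => b * f x).
Proof.
move=> Vf; have := rk_lin b Vf (rk_0 H).
by congr V; apply/funext => x; rewrite addr0.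
Qed.

Lemma rk_sub f g : V f -> V g -> V (fun x => f x - g x).
Proof.
move=> Vf Vg; have := rk_lin (-1) Vg Vf.
by congr V; apply/funext => x; rewrite mulN1r addrC.
Qed.

Lemma rk_dot0l h : V h -> dot (fun=> 0) h = 0.
Proof.
move=> Vh; have := rk_dotl 1 (rk_0 H) (rk_0 H) Vh; rewrite [1 * dot _ _]mul1r.
have -> : (fun x : X => 1 * (0 : R) + 0) = (fun=> 0).
  by apply/funext => x; rewrite mulr0 addr0.
by move=> /eqP; rewrite -subr_eq0 opprD addrA subrr sub0r oppr_eq0 => /eqP.
Qed.

Lemma rk_dotZl b f h : V f -> V h -> dot (fun x => b * f x) h = b * dot f h.
Proof.
move=> Vf Vh; have := rk_dotl b Vf (rk_0 H) Vh; rewrite rk_dot0l// addr0 => <-.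
by congr rk_dot; apply/funext => x; rewrite addr0.
Qed.

Lemma rk_dotBl f g h : V f -> V g -> V h ->
  dot (fun x => f x - g x) h = dot f h - dot g h.
Proof.
move=> Vf Vg Vh; have := rk_dotl (-1) Vg Vf Vh; rewrite mulN1r addrC => <-.
by congr rk_dot; apply/funext => x; rewrite mulN1r addrC.
Qed.

Lemma rk_dotBr f g h : V f -> V g -> V h ->
  dot h (fun x => f x - g x) = dot h f - dot h g.
Proof.
move=> Vf Vg Vh; rewrite rk_dotC ?rk_dotBl// 1?rk_dotC// 1?(rk_dotC Vg)//.
exact: rk_sub.
Qed.

Lemma rk_dotBB f g : V f -> V g ->
  dot (fun x => f x - g x) (fun x => f x - g x) =
  dot f f - 2 * dot f g + dot g g.
Proof.
move=> Vf Vg; have Vfg := rk_sub Vf Vg.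
rewrite rk_dotBl// !rk_dotBr// (rk_dotC Vg Vf); ring.
Qed.

Lemma rk_CS f g : V f -> V g -> dot f g ^+ 2 <= dot f f * dot g g.
Proof.
move=> Vf Vg; apply: young_sqr_le; rewrite ?rk_dot_ge0// => t t0.
have key (b : R) : 2 * b * dot f g <= dot f f + b ^+ 2 * dot g g.
  have Vbg := rk_scale b Vg.
  have := rk_dot_ge0 (rk_sub Vf Vbg).
  rewrite rk_dotBB// rk_dotZl// (rk_dotC Vf Vbg) rk_dotZl// (rk_dotC Vg Vbg).
  by rewrite rk_dotZl// (rk_dotC Vg Vf); lra.
have tn0 : t != 0 by rewrite gt_eqF.
have E (x : R) : t * (t^-1 ^+ 2 * x) = t^-1 * x by field.
have [s0|s0] := lerP 0 (dot f g).
  have := key t^-1; move=> /(ler_wpM2l (ltW t0)); rewrite mulrDr E ger0_norm//.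
  by congr (_ <= _); field.
have := key (- t^-1); move=> /(ler_wpM2l (ltW t0)); rewrite mulrDr sqrrN E ltr0_norm//.
by congr (_ <= _); field.
Qed.

Lemma rk_norm_sqr f : V f -> rk_norm H f ^+ 2 = dot f f.
Proof. by move=> Vf; rewrite sqr_sqrtr// rk_dot_ge0. Qed.

Lemma rk_CS_norm f g : V f -> V g -> `|dot f g| <= rk_norm H f * rk_norm H g.
Proof.
move=> Vf Vg; rewrite -sqrtrM ?rk_dot_ge0//.
by rewrite -sqrtr_sqr ler_wsqrtr// rk_CS.
Qed.

Lemma rk_norm_le_add f g : V f -> V g ->
  rk_norm H g <= rk_norm H f + rk_norm H (fun x => g x - f x).
Proof.
move=> Vf Vg; have Vgf := rk_sub Vg Vf.
have n0 h : 0 <= rk_norm H h by exact: sqrtr_ge0.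
rewrite -(@ler_pXn2r _ 2) ?nnegrE ?addr_ge0// rk_norm_sqr//.
have gE : g = (fun x => f x + (g x - f x)) by apply/funext => x; rewrite addrC subrK.
have : dot g g = dot f f + 2 * dot f (fun x => g x - f x) +
    dot (fun x => g x - f x) (fun x => g x - f x).
  by rewrite rk_dotBB// rk_dotBr// (rk_dotC Vg Vf); ring.
rewrite sqrrD !rk_norm_sqr// => ->.
have := rk_CS_norm Vf Vgf; have := ler_norm (dot f (fun x => g x - f x)).
rewrite mulr2n; lra.
Qed.

Lemma rk_diag f x : V f -> f x ^+ 2 <= dot f f * L x x.
Proof.
move=> Vf; rewrite (rk_repr x Vf) (le_trans (rk_CS Vf (rk_ker H x)))//.
by rewrite -(rk_repr x (rk_ker H x)).
Qed.

Lemma rk_cauchy_cvg (F : nat -> X -> R) : (forall n, V (F n)) ->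
  (forall e : R, 0 < e -> exists N, forall m n, (N <= m)%N -> (N <= n)%N ->
     dot (fun x => F m x - F n x) (fun x => F m x - F n x) < e :> R) ->
  exists2 f, V f & forall e : R, 0 < e -> exists N, forall n, (N <= n)%N ->
     dot (fun x => F n x - f x) (fun x => F n x - f x) < e :> R.
Proof. exact: rk_complete. Qed.

Definition lincomb (Y : Type) (Phi : Y -> X -> R) (s : seq (R * Y)) : X -> R :=
  fun x => \sum_(p <- s) p.1 * Phi p.2 x.

Section lincomb.
Variables (Y : Type) (Phi : Y -> X -> R).
Hypothesis VPhi : forall y, V (Phi y).

Lemma lincomb_cons p s :
  lincomb Phi (p :: s) = (fun x => p.1 * Phi p.2 x + lincomb Phi s x).
Proof. by apply/funext => x; rewrite /lincomb big_cons. Qed.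

Lemma lincomb_rk s : V (lincomb Phi s).
Proof.
elim: s => [|p s IH].
  have -> : lincomb Phi [::] = fun=> 0 by apply/funext => x; rewrite /lincomb big_nil.
  exact: rk_0.
by rewrite lincomb_cons; apply: rk_lin.
Qed.

Lemma dot_lincombl s h : V h ->
  dot (lincomb Phi s) h = \sum_(p <- s) p.1 * dot (Phi p.2) h.
Proof.
move=> Vh; elim: s => [|p s IH].
  rewrite big_nil; have -> : lincomb Phi [::] = fun=> 0.
    by apply/funext => x; rewrite /lincomb big_nil.
  exact: rk_dot0l.
by rewrite lincomb_cons rk_dotl ?IH ?big_cons//; exact: lincomb_rk.
Qed.

Lemma dot_lincombr s h : V h ->
  dot h (lincomb Phi s) = \sum_(p <- s) p.1 * dot h (Phi p.2).
Proof.
move=> Vh; rewrite (rk_dotC Vh (lincomb_rk s)) dot_lincombl//.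
by apply: eq_bigr => p _; rewrite (rk_dotC Vh).
Qed.

Lemma dot_lincomb2 s : dot (lincomb Phi s) (lincomb Phi s) =
  \sum_(p <- s) \sum_(q <- s) p.1 * q.1 * dot (Phi p.2) (Phi q.2).
Proof.
rewrite dot_lincombl; last exact: lincomb_rk.
apply: eq_bigr => p _; rewrite dot_lincombr// mulr_sumr.
by apply: eq_bigr => q _; rewrite mulrA.
Qed.

Variables (g : Y -> R) (A : R).
Local Notation l s := (\sum_(p <- s) p.1 * g p.2).
Hypothesis A_ge0 : 0 <= A.
Hypothesis gA : forall s, l s ^+ 2 <= A * dot (lincomb Phi s) (lincomb Phi s).

(** If F in the closure of the span represents the functional l, this is |F|^2 - |h - F|^2 with h =
    [lincomb Phi s]; its supremum is |F|^2, approached as h tends to F. *)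
Let J s := 2 * l s - dot (lincomb Phi s) (lincomb Phi s).

Let J_le s : J s <= A.
Proof.
rewrite /J; move: (gA s) (rk_dot_ge0 (lincomb_rk s)).
set x := l s; set y := dot _ _ => xy y0.
rewrite leNgt; apply/negP => h; move: A_ge0 => A0.
have : 0 < (2 * x - (A + y)) * (2 * x + (A + y)) by apply: mulr_gt0; lra.
by have := sqr_ge0 (A - y); nra.
Qed.

Let lin (b : R) (s t : seq (R * Y)) := [seq (b * p.1, p.2) | p <- s] ++ t.

Lemma lincomb_lin b s t :
  lincomb Phi (lin b s t) = (fun x => b * lincomb Phi s x + lincomb Phi t x).
Proof.
apply/funext => x; rewrite /lincomb /lin big_cat big_map/= mulr_sumr.
by congr (_ + _); apply: eq_bigr => p _; rewrite mulrA.
Qed.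

Let l_lin b s t : l (lin b s t) = b * l s + l t.
Proof.
rewrite /lin big_cat big_map/= mulr_sumr.
by congr (_ + _); apply: eq_bigr => p _; rewrite mulrA.
Qed.

Let dot_lin b f h : V f -> V h ->
  dot (fun x => b * f x + h x) (fun x => b * f x + h x) =
  b ^+ 2 * dot f f + 2 * b * dot f h + dot h h.
Proof.
move=> Vf Vh; have Vfh := rk_lin b Vf Vh.
rewrite rk_dotl// (rk_dotC Vf Vfh) (rk_dotC Vh Vfh) !rk_dotl// (rk_dotC Vh Vf); ring.
Qed.

(* Maximising 2 l(h) - |h|^2 over the span of the Phi y: by the parallelogram
   identity every maximising sequence is Cauchy. *)
Lemma riesz_span : exists F, [/\ V F, dot F F <= A,
  forall y, dot F (Phi y) = g y &
  forall e : R, 0 < e -> exists s, dot (fun x => lincomb Phi s x - F x)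
                                   (fun x => lincomb Phi s x - F x) < e].
Proof.
pose S := sup (range J).
have hS : has_sup (range J).
  by split; [exists (J [::]); exists [::]|exists A => _ [s _ <-]].
have J_S s : J s <= S by apply: ub_le_sup; [case: hS|exists s].
have ex_s n : exists s, S - n.+1%:R^-1 < J s.
  have n0 : 0 < n.+1%:R^-1 :> R by rewrite invr_gt0.
  by have [_ [s _ <-] ?] := sup_adherent n0 hS; exists s.
have [s sP] := choice ex_s.
pose F n := lincomb Phi (s n).
have VF n : V (F n) by exact: lincomb_rk.
have Vlc := lincomb_rk.
(* J at the midpoint of F n and F m is the average of both values plus |F n - F m|^2 / 4, and it is
   at most S. *)
have dist n m : dot (fun x => F n x - F m x) (fun x => F n x - F m x) <=
    2 * (n.+1%:R^-1 + m.+1%:R^-1).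
  have := J_S (lin 2^-1 (s n) (lin 2^-1 (s m) [::])).
  have lcE : lincomb Phi (lin 2^-1 (s n) (lin 2^-1 (s m) [::])) =
      (fun x => 2^-1 * F n x + 2^-1 * F m x).
    rewrite lincomb_lin; apply/funext => x; congr (_ + _).
    by rewrite lincomb_lin [X in _ + X]/lincomb big_nil addr0.
  have Vm := rk_scale 2^-1 (VF m).
  rewrite /J lcE !l_lin big_nil addr0 dot_lin// rk_dotZl//.
  rewrite (rk_dotC (VF n) Vm) rk_dotZl// (rk_dotC (VF m) Vm) rk_dotZl//.
  rewrite rk_dotBB// (rk_dotC (VF m) (VF n)).
  have := sP n; have := sP m; rewrite /J -/(F n) -/(F m).
  move: (n.+1%:R^-1) (m.+1%:R^-1) (dot (F n) (F n)) (dot (F n) (F m)) => i j p q.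
  move: (dot (F m) (F m)) (l (s n)) (l (s m)) (S) => r t u v ? ?.
  rewrite expr2; lra.
have inv_lt (e : R) : 0 < e -> exists N, forall n, (N <= n)%N -> n.+1%:R^-1 < e :> R.
  move=> e0; have [N _ NP] := near_infty_natSinv_lt (PosNum e0).
  by exists N.
have [|G VG GP] := rk_cauchy_cvg VF.
  move=> e e0; have [|N NP] := inv_lt (e / 4); first by rewrite divr_gt0.
  exists N => m n Nm Nn; rewrite (le_lt_trans (dist m n))//.
  have := NP _ Nm; have := NP _ Nn. move: (m.+1%:R^-1) (n.+1%:R^-1) => i j; lra.
have cvgdot h : V h -> forall e : R, 0 < e -> exists N, forall n, (N <= n)%N ->
    `|dot (F n) h - dot G h| < e.
  move=> Vh e e0.
  pose c := dot h h + 1; have c0 : 0 < c by rewrite ltr_wpDl ?rk_dot_ge0.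
  have [|N NP] := GP (e ^+ 2 / c); first by rewrite divr_gt0 ?exprn_gt0.
  exists N => n /NP nN; rewrite -rk_dotBl//.
  rewrite -(@ltr_pXn2r _ 2) ?nnegrE ?(ltW e0)// real_normK ?num_real//.
  have VFG := rk_sub (VF n) VG.
  apply: le_lt_trans (rk_CS VFG Vh) _.
  move: nN; rewrite ltr_pdivlMr//; apply: le_lt_trans.
  by rewrite ler_wpM2l ?rk_dot_ge0// lerDl.
(* First-order optimality: moving F n by t Phi y raises J by at most 1 / (n + 1), for every t. In
   the limit the part linear in t has to vanish. *)
have Gphi y : dot G (Phi y) = g y.
  have key n (t : R) : 2 * t * (g y - dot (F n) (Phi y)) <=
      t ^+ 2 * dot (Phi y) (Phi y) + n.+1%:R^-1.
    have := J_S (lin t [:: (1, y)] (s n)).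
    have lc1 : lincomb Phi [:: (1, y)] = Phi y.
      by apply/funext => x; rewrite /lincomb big_seq1 mul1r.
    rewrite /J lincomb_lin lc1 dot_lin// l_lin big_seq1 mul1r.
    rewrite (rk_dotC (VPhi y) (VF n)); have := sP n; rewrite /J -/(F n).
    move: (n.+1%:R^-1) (S) => i v; lra.
  have key2 (t : R) : 2 * t * (g y - dot G (Phi y)) <= t ^+ 2 * dot (Phi y) (Phi y).
    apply/ler_addgt0Pr => e e0.
    have [|N1 N1P] := cvgdot _ (VPhi y) (e / 2 / (2 * `|t| + 1)).
      by rewrite !divr_gt0// ltr_wpDl// mulr_ge0.
    have [|N2 N2P] := inv_lt (e / 2); first by rewrite divr_gt0.
    have := key (maxn N1 N2) t; set n := maxn N1 N2 => h3.
    have h1 := N1P n (leq_maxl _ _); have h2 := N2P n (leq_maxr _ _).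
    rewrite ltr_pdivlMr ?ltr_wpDl ?mulr_ge0// in h1.
    have : 2 * t * (dot (F n) (Phi y) - dot G (Phi y)) <= e / 2.
      apply: le_trans (ler_norm _) _; rewrite !normrM normr_nat.
      apply: le_trans (ltW h1); rewrite mulrC ler_wpM2l// lerDl ler01//.
    by move: h2 h3; move: (n.+1%:R^-1) => i; lra.
  apply/eqP; rewrite eq_sym -subr_eq0; apply/eqP.
  set z := g y - _; set w := dot (Phi y) (Phi y).
  have w0 : 0 <= w by exact: rk_dot_ge0.
  have : z ^+ 2 <= 0.
    (* The optimal t would be z / w; the added 1 keeps the denominator positive. *)
    have := key2 (z / (w + 1)); rewrite -/z -/w => h.
    have w1 : 0 < w + 1 by lra.
    have : 2 * z ^+ 2 * (w + 1) <= z ^+ 2 * w.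
      have -> : 2 * z ^+ 2 * (w + 1) = (2 * (z / (w + 1)) * z) * (w + 1) ^+ 2.
        by field; rewrite gt_eqF.
      have -> : z ^+ 2 * w = ((z / (w + 1)) ^+ 2 * w) * (w + 1) ^+ 2.
        by field; rewrite gt_eqF.
      by rewrite ler_wpM2r// sqr_ge0.
    have := sqr_ge0 z; nra.
  by move=> z0; apply/eqP; rewrite -sqrf_eq0 eq_le z0 sqr_ge0.
exists G; split => //.
- have GF n : dot G (F n) ^+ 2 <= A * dot (F n) (F n).
    rewrite dot_lincombr//; under eq_bigr do rewrite Gphi.
    exact: gA.
  rewrite leNgt; apply/negP; set x := dot G G => Ax; move: A_ge0 => A0.
  (* Suppose x = |G|^2 > A. For F n close to G within e, dot (F n) G >= x - e and |F n|^2 <= x + 3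
     e, so [GF] yields (x - e)^2 <= A (x + 3 e). The e with e (2 x + 3 A + 1) = x (x - A) refutes
     this. *)
  have c0 : 0 < 2 * x + 3 * A + 1 by lra.
  have e0 : 0 < x * (x - A) / (2 * x + 3 * A + 1).
    by rewrite divr_gt0 ?mulr_gt0//; lra.
  have [N1 N1P] := cvgdot _ VG _ e0; have [N2 N2P] := GP _ e0.
  set n := maxn N1 N2.
  have := N1P n (leq_maxl _ _); have := N2P n (leq_maxr _ _); have := GF n.
  have eM : x * (x - A) / (2 * x + 3 * A + 1) * (2 * x + 3 * A + 1) = x * (x - A).
    by rewrite divfK// gt_eqF.
  move: e0 eM; set e := _ / _ => e0 eM.
  rewrite rk_dotBB// (rk_dotC VG (VF n)) ltr_norml -/x => h1 h2 /andP[h3 h4].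
  have ex : e < x by nra.
  have : (x - e) ^+ 2 <= dot (F n) G ^+ 2.
    by rewrite lerXn2r ?nnegrE; lra.
  have : A * dot (F n) (F n) <= A * (x + 3 * e) by rewrite ler_wpM2l//; lra.
  by have := sqr_ge0 e; nra.
- by move=> e /GP[N /(_ _ (leqnn N))]; exists (s N).
Qed.

End lincomb.

(** [riesz_span] for the values of f yields an F in the closure of the span of the kernel sections
    with these values, and the reproducing property identifies F with f. *)
Lemma rk_dense f : V f -> forall e : R, 0 < e -> exists s : seq (R * X),
  dot (fun x => lincomb (fun y z => L z y) s x - f x)
      (fun x => lincomb (fun y z => L z y) s x - f x) < e.
Proof.
move=> Vf; have [||F [VF _ FE dense]] :=
    @riesz_span X (fun y z => L z y) (rk_ker H) f (dot f f).
- exact: rk_dot_ge0.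
- move=> s; have -> : \sum_(p <- s) p.1 * f p.2 =
      dot f (lincomb (fun y z => L z y) s).
    rewrite dot_lincombr//; last exact: rk_ker.
    by apply: eq_bigr => p _; rewrite -rk_repr.
  by apply: rk_CS => //; apply: lincomb_rk; exact: rk_ker.
suff -> : f = F by [].
by apply/funext => y; rewrite (rk_repr y VF) FE.
Qed.

(** The Gram matrix criterion: a function g lies in the space of L with squared norm at most A when
    A L(x, y) - g(x) g(y) is positive semidefinite. *)
Lemma rk_mem_of_bound (g : X -> R) (A : R) : 0 <= A ->
  (forall s : seq (R * X), (\sum_(p <- s) p.1 * g p.2) ^+ 2 <=
     A * \sum_(p <- s) \sum_(q <- s) p.1 * q.1 * L q.2 p.2) ->
  V g /\ dot g g <= A.
Proof.
move=> A0 gA; have [||F [VF FA FE _]] :=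
    @riesz_span X (fun y z => L z y) (rk_ker H) g A.
- exact: A0.
- move=> s; rewrite dot_lincomb2; last exact: rk_ker.
  under [X in _ <= _ * X]eq_bigr do
    under eq_bigr do rewrite -(rk_repr _ (rk_ker H _)).
  exact: gA.
by have -> : g = F by apply/funext => y; rewrite (rk_repr y VF) FE.
Qed.

Lemma rk_sym x y : L x y = L y x.
Proof.
by rewrite (rk_repr x (rk_ker H y)) (rk_repr y (rk_ker H x)) rk_dotC//; exact: rk_ker.
Qed.

Lemma rk_dot_ker x y : dot (fun z => L z x) (fun z => L z y) = L x y.
Proof. by rewrite -(rk_repr y (rk_ker H x)) rk_sym. Qed.

Lemma rk_diag_ge0 x : 0 <= L x x.
Proof. by rewrite -rk_dot_ker; apply: rk_dot_ge0; exact: rk_ker. Qed.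

Lemma rk_ker_le x y : 2 * `|L x y| <= L x x + L y y.
Proof.
have := rk_CS (rk_ker H x) (rk_ker H y); rewrite !rk_dot_ker => h.
have := rk_diag_ge0 x; have := rk_diag_ge0 y => y0 x0.
rewrite leNgt; apply/negP => hh.
have : (2 * `|L x y|) ^+ 2 <= (L x x + L y y) ^+ 2.
  rewrite exprMn real_normK ?num_real//; have := sqr_ge0 (L x x - L y y); nra.
rewrite ler_pXn2r ?nnegrE ?mulr_ge0 ?addr_ge0//; lra.
Qed.

Lemma gram_ge0 (s : seq (R * X)) :
  0 <= \sum_(p <- s) \sum_(q <- s) p.1 * q.1 * L p.2 q.2.
Proof.
have := rk_dot_ge0 (lincomb_rk (rk_ker H) s).
rewrite dot_lincomb2; last exact: rk_ker.
by under eq_bigr do under eq_bigr do rewrite rk_dot_ker.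
Qed.

Lemma gram_CS (s : seq (R * X)) x : (\sum_(p <- s) p.1 * L x p.2) ^+ 2 <=
  L x x * \sum_(p <- s) \sum_(q <- s) p.1 * q.1 * L p.2 q.2.
Proof.
have -> : \sum_(p <- s) p.1 * L x p.2 = lincomb (fun y z => L z y) s x by [].
have Vs := lincomb_rk (rk_ker H) s.
apply: le_trans (rk_diag x Vs) _; rewrite mulrC dot_lincomb2; last exact: rk_ker.
by under [X in _ * X <= _]eq_bigr do under eq_bigr do rewrite rk_dot_ker.
Qed.

End rkhs_theory.

(** By [rk_dense], f is a limit in norm, hence pointwise, of combinations of kernel sections. The
    map [ins] lets X be a part of the ambient space Z, functions being extended by 0. *)
Lemma rk_measurable (R : realType) (X : Type) (L : X -> X -> R) (H : rkhs L) d
    (Z : measurableType d) (ins : Z -> option X) :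
  (forall y, measurable_fun setT (fun z => oapp (fun x => L x y) 0 (ins z))) ->
  forall f, rk_space H f -> measurable_fun setT (fun z => oapp f 0 (ins z)).
Proof.
move=> mL f Vf.
pose K y z := L z y.
have ex_s (n : nat) : exists s : seq (R * X),
    rk_dot H (fun x => lincomb K s x - f x)
             (fun x => lincomb K s x - f x) < n.+1%:R^-1.
  exact: rk_dense.
have [s sP] := choice ex_s.
pose h n z := oapp (lincomb K (s n)) 0 (ins z).
apply: (@measurable_fun_cvg _ _ _ _ h).
- move=> n; have -> : h n = fun z => \sum_(p <- s n) p.1 * oapp (K p.2) 0 (ins z).
    apply/funext => z; rewrite /h /lincomb; case: (ins z) => //=.
    by rewrite big1// => p _; rewrite mulr0.
  by apply: measurable_sum => p; apply: measurable_funM => //; exact: mL.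
- move=> z _; rewrite /h; case: (ins z) => [x|]/=; last exact: cvg_cst.
  apply/cvgrPdist_lt => e e0; have Lx := rk_diag_ge0 H x.
  have c0 : 0 < e ^+ 2 / (L x x + 1) by rewrite divr_gt0 ?exprn_gt0// ltr_wpDl.
  near=> n.
  have Vn : rk_space H (fun x => lincomb K (s n) x - f x).
    by apply: rk_sub => //; apply: lincomb_rk; exact: rk_ker.
  rewrite distrC -(@ltr_pXn2r _ 2) ?nnegrE ?(ltW e0)// real_normK ?num_real//.
  apply: le_lt_trans (rk_diag x Vn) _.
  apply: (@le_lt_trans _ _ (n.+1%:R^-1 * L x x)).
    by rewrite ler_wpM2r// ltW.
  have : n.+1%:R^-1 < e ^+ 2 / (L x x + 1).
    by near: n; exact: (near_infty_natSinv_lt (PosNum c0)).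
  rewrite ltr_pdivlMr ?ltr_wpDl//; apply: le_lt_trans.
  by rewrite ler_wpM2l ?invr_ge0// lerDl.
Unshelve. all: by end_near. Qed.

(** * Unconditional sums *)

Section esum_extra.
Local Open Scope ereal_scope.
Variables (R : realType) (I : countType).
Implicit Types a b : I -> \bar R.

Lemma fsum_le_esum a (s : seq I) : (forall i, 0 <= a i) -> uniq s ->
  \sum_(i <- s) a i <= \esum_(i in setT) a i.
Proof.
move=> a0 us; apply: esum_ge; exists [set` s]; first by split => //; exact: finite_seq.
by rewrite fsbig_seq.
Qed.

(** Passes to a series over codes, with the value 0 at numbers that code nothing, so that monotone
    convergence for series of functions becomes applicable. *)
Lemma esum_countT a : (forall i, 0 <= a i) ->
  \esum_(i in setT) a i = \sum_(n <oo) oapp a 0 (@choice.pickle_inv I n).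
Proof.
move=> a0; have b0 n : 0 <= oapp a 0 (@choice.pickle_inv I n).
  by case: choice.pickle_inv => /=.
rewrite nneseries_esumT//.
have -> : \esum_(n in [set: nat]) oapp a 0 (@choice.pickle_inv I n) =
    \esum_(n in range (@choice.pickle I)) oapp a 0 (@choice.pickle_inv I n).
  rewrite [RHS]esum_mkcond; apply: eq_esum => n _; case: ifPn => // nr.
  case En : (choice.pickle_inv n) => [i|//]/=; exfalso.
  have := @choice.pickle_invK I n; rewrite En/= => pin.
  by move: nr; rewrite notin_setE; apply; exists i.
rewrite (@reindex_esum _ _ _ setT _ (@choice.pickle I)); last first.
  split; [by move=> i _; exists i| |by move=> _ [i _ <-]; exists i].
  by move=> i j _ _ /(pcan_inj (@choice.pickleK I)).
by apply: eq_esum => i _; rewrite choice.pickleK_inv.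
Qed.

Section integral_esum.
Variables (d : measure_display) (T : measurableType d) (f : I -> T -> \bar R).
Hypothesis f0 : forall i x, 0 <= f i x.
Hypothesis mf : forall i, measurable_fun setT (f i).

Let g n x := oapp (f ^~ x) 0 (@choice.pickle_inv I n).
Let g0 n x : 0 <= g n x. Proof. by rewrite /g; case: choice.pickle_inv => /=. Qed.
Let mg n : measurable_fun setT (g n).
Proof.
rewrite /g; case: (choice.pickle_inv n) => [i|]; first exact: mf.
exact: measurable_cst.
Qed.

Lemma measurable_esum : measurable_fun setT (fun x => \esum_(i in setT) f i x).
Proof.
have -> : (fun x => \esum_(i in setT) f i x) = fun x => \sum_(n <oo | n \in predT) g n x.
  by apply/funext => x; rewrite esum_countT//; apply: eq_eseriesl.
exact: ge0_emeasurable_sum.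
Qed.

Lemma integral_esum (mu : {measure set T -> \bar R}) :
  \int[mu]_x (\esum_(i in setT) f i x) = \esum_(i in setT) (\int[mu]_x f i x).
Proof.
transitivity (\int[mu]_x (\sum_(n <oo) g n x)).
  by apply: eq_integral => x _; exact: esum_countT.
rewrite integral_nneseries//; apply/esym.
have h i : 0 <= \int[mu]_x f i x by exact: integral_ge0.
rewrite (esum_countT h).
apply: eq_eseriesr => n _; rewrite /g; case: (choice.pickle_inv n) => //=.
by rewrite integral0.
Qed.

End integral_esum.

Lemma esumZl (c : R) a : (0 <= c)%R -> (forall i, 0 <= a i) ->
  \esum_(i in setT) (c%:E * a i) = c%:E * \esum_(i in setT) a i.
Proof.
move=> c0 a0; rewrite !esum_countT//; last by move=> i; rewrite mule_ge0.
rewrite -nneseriesZl//; last by move=> n _; case: choice.pickle_inv.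
by apply: eq_eseriesr => n _; case: choice.pickle_inv => //=; rewrite mule0.
Qed.

End esum_extra.

(** Shaped like the body of [Kker], so that [KkerE] holds by conversion. The usual rules hold for
    [rsummable] families. *)
Definition asum (R : realType) (I : choiceType) (g : I -> R) : R :=
  let e (i : I) : \bar R := (g i)%:E in
  fine (\esum_(i in setT) (e^\+)%E i) - fine (\esum_(i in setT) (e^\-)%E i).

Definition rsummable (R : realType) (I : choiceType) (g : I -> R) :=
  (\esum_(i in setT) `|g i|%:E < +oo)%E.

Section asum.
Variables (R : realType) (I : countType).
Implicit Types f g p q : I -> R.

Lemma rsummable_le f g : (forall i, `|f i| <= g i) -> rsummable g -> rsummable f.
Proof.
move=> fg; apply: le_lt_trans; apply: le_esum => i _; rewrite lee_fin.
by rewrite (le_trans (fg i))// ler_norm.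
Qed.

Lemma rsummableD f g : rsummable f -> rsummable g -> rsummable (fun i => f i + g i).
Proof.
move=> sf sg; apply: le_lt_trans (lte_add_pinfty sf sg).
rewrite -esumD; try by move=> *; rewrite lee_fin.
by apply: le_esum => i _; rewrite -EFinD lee_fin ler_normD.
Qed.

Lemma rsummableZ c f : rsummable f -> rsummable (fun i => c * f i).
Proof.
move=> sf; rewrite /rsummable.
under eq_esum do rewrite normrM EFinM.
rewrite esumZl//; apply: lte_mul_pinfty => //.
Qed.

Lemma rsummable0 : rsummable (fun _ : I => 0 : R).
Proof. by rewrite /rsummable esum1// => i _; rewrite normr0. Qed.

Lemma rsummable_sum (J : Type) (s : seq J) (F : J -> I -> R) :
  (forall j, rsummable (F j)) -> rsummable (fun i => \sum_(j <- s) F j i).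
Proof.
move=> sF; elim: s => [|j s IH].
  by under eq_fun do rewrite big_nil; exact: rsummable0.
by under eq_fun do rewrite big_cons; exact: rsummableD.
Qed.

Lemma rsummableN f : rsummable f -> rsummable (fun i => - f i).
Proof. by move=> /(rsummableZ (-1)); under eq_fun do rewrite mulN1r. Qed.

Lemma rsummableB f g : rsummable f -> rsummable g -> rsummable (fun i => f i - g i).
Proof. by move=> sf sg; apply: rsummableD => //; exact: rsummableN. Qed.

Lemma ge0_rsummable f : (forall i, 0 <= f i) ->
  rsummable f <-> (\esum_(i in setT) (f i)%:E < +oo)%E.
Proof. by move=> f0; rewrite /rsummable; under eq_esum do rewrite ger0_norm//. Qed.

Lemma esum_fin_num f : (forall i, 0 <= f i) -> rsummable f ->
  (\esum_(i in setT) (f i)%:E)%E \is a fin_num.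
Proof.
move=> f0 /(ge0_rsummable f0) sf; rewrite ge0_fin_numE// esum_ge0// => i _.
by rewrite lee_fin.
Qed.

(** The value does not depend on the splitting into non-negative summable parts; additivity, sign
    change and scaling reduce to [esum] through this. *)
Let asumB_ge0 p q : (forall i, 0 <= p i) -> (forall i, 0 <= q i) ->
  rsummable p -> rsummable q ->
  asum (fun i => p i - q i) =
  fine (\esum_(i in setT) (p i)%:E)%E - fine (\esum_(i in setT) (q i)%:E)%E.
Proof.
move=> p0 q0 sp sq; have := @esumB R I setT (EFin \o p) (EFin \o q) sp sq
  (fun i _ => (p0 i : (0 <= (p i)%:E)%E)) (fun i _ => (q0 i : (0 <= (q i)%:E)%E)).
have spq : summable setT ((EFin \o p) \- (EFin \o q))%E by exact: summableB.
have fin1 : (\esum_(i in setT) (((EFin \o p) \- (EFin \o q))%E^\+)%E i)%E \is a fin_num.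
  have := summable_funepos spq; rewrite summableE.
  by under eq_esum do rewrite gee0_abs//.
have fin2 : (\esum_(i in setT) (((EFin \o p) \- (EFin \o q))%E^\-)%E i)%E \is a fin_num.
  have := summable_funeneg spq; rewrite summableE.
  by under eq_esum do rewrite gee0_abs//.
move=> /(congr1 fine); rewrite !fineB//; exact: esum_fin_num.
Qed.

Let pos f i : R := Num.max (f i) 0.
Let neg f i : R := Num.max (- f i) 0.
Let pos0 f i : 0 <= pos f i. Proof. by rewrite le_max lexx orbT. Qed.
Let neg0 f i : 0 <= neg f i. Proof. by rewrite le_max lexx orbT. Qed.
Let posneg f : f = fun i => pos f i - neg f i.
Proof.
apply/funext => i; rewrite /pos /neg.
by case: (lerP (f i) 0) => h; case: (lerP (- f i) 0) => h2; lra.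
Qed.
Let spos f : rsummable f -> rsummable (pos f).
Proof.
rewrite /rsummable; apply: le_lt_trans; apply: le_esum => i _; rewrite lee_fin.
by rewrite ger0_norm// ge_max normr_ge0 ler_norm.
Qed.
Let sneg f : rsummable f -> rsummable (neg f).
Proof.
rewrite /rsummable; apply: le_lt_trans; apply: le_esum => i _; rewrite lee_fin.
by rewrite ger0_norm// ge_max normr_ge0 -normrN ler_norm.
Qed.

Let P f := (\esum_(i in setT) (pos f i)%:E)%E.
Let N f := (\esum_(i in setT) (neg f i)%:E)%E.
Let Pfin f : rsummable f -> P f \is a fin_num.
Proof. by move=> sf; apply: esum_fin_num => //; exact: spos. Qed.
Let Nfin f : rsummable f -> N f \is a fin_num.
Proof. by move=> sf; apply: esum_fin_num => //; exact: sneg. Qed.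

Let asumE f : rsummable f -> asum f = fine (P f) - fine (N f).
Proof.
move=> sf; rewrite {1}(posneg f).
exact: (asumB_ge0 (pos0 f) (neg0 f) (spos sf) (sneg sf)).
Qed.

Lemma asumD f g : rsummable f -> rsummable g ->
  asum (fun i => f i + g i) = asum f + asum g.
Proof.
move=> sf sg; rewrite (asumE sf) (asumE sg).
have -> : (fun i => f i + g i) =
    fun i => (pos f i + pos g i) - (neg f i + neg g i).
  by apply/funext => i; rewrite {1}(posneg f) {1}(posneg g); ring.
rewrite (asumB_ge0 (fun i => addr_ge0 (pos0 f i) (pos0 g i))
  (fun i => addr_ge0 (neg0 f i) (neg0 g i)) (rsummableD (spos sf) (spos sg))
  (rsummableD (sneg sf) (sneg sg))).
have -> : (\esum_(i in setT) (pos f i + pos g i)%:E = P f + P g)%E.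
  by rewrite -esumD => [|i _|i _]; rewrite ?lee_fin.
have -> : (\esum_(i in setT) (neg f i + neg g i)%:E = N f + N g)%E.
  by rewrite -esumD => [|i _|i _]; rewrite ?lee_fin.
by rewrite (fineD (Pfin sf) (Pfin sg)) (fineD (Nfin sf) (Nfin sg)) opprD addrACA.
Qed.

Lemma asumN f : rsummable f -> asum (fun i => - f i) = - asum f.
Proof.
move=> sf; rewrite (asumE sf).
have -> : (fun i => - f i) = fun i => neg f i - pos f i.
  by apply/funext => i; rewrite {1}(posneg f) opprB.
by rewrite (asumB_ge0 (neg0 f) (pos0 f) (sneg sf) (spos sf)) opprB.
Qed.

Lemma ge0_asum f : (forall i, 0 <= f i) -> rsummable f ->
  asum f = fine (\esum_(i in setT) (f i)%:E)%E.
Proof.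
move=> f0 sf; have := asumB_ge0 f0 (fun _ => lexx 0) sf rsummable0.
have -> : (\esum_(i in [set: I]) (0 : R)%:E = 0)%E by rewrite esum1.
rewrite subr0 => <-.
by congr asum; apply/funext => i; rewrite subr0.
Qed.

Lemma EFin_asum f : (forall i, 0 <= f i) -> rsummable f ->
  ((asum f)%:E = \esum_(i in setT) (f i)%:E)%E.
Proof. by move=> f0 sf; rewrite ge0_asum// fineK// esum_fin_num. Qed.

Lemma asum_ge0 f : (forall i, 0 <= f i) -> rsummable f -> 0 <= asum f.
Proof. by move=> f0 sf; rewrite -lee_fin EFin_asum//; apply: esum_ge0 => i _; rewrite lee_fin. Qed.

Lemma asumB f g : rsummable f -> rsummable g ->
  asum (fun i => f i - g i) = asum f - asum g.
Proof. by move=> sf sg; rewrite asumD ?asumN//; exact: rsummableN. Qed.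

Lemma le_asum f g : rsummable f -> rsummable g -> (forall i, f i <= g i) ->
  asum f <= asum g.
Proof.
move=> sf sg fg; rewrite -subr_ge0 -asumB//; apply: asum_ge0.
  by move=> i; rewrite subr_ge0.
exact: rsummableB.
Qed.

Lemma asumZ c f : rsummable f -> asum (fun i => c * f i) = c * asum f.
Proof.
wlog c0 : c / 0 <= c => [hw sf|sf].
  case: (lerP 0 c) => [|c0]; first by move/hw; exact.
  have := hw (- c); rewrite oppr_ge0 => /(_ (ltW c0) sf).
  under eq_fun do rewrite mulNr; rewrite asumN; last exact: rsummableZ.
  by rewrite mulNr => /oppr_inj.
rewrite (asumE sf).
have -> : (fun i => c * f i) = fun i => c * pos f i - c * neg f i.
  by apply/funext => i; rewrite {1}(posneg f) mulrBr.
rewrite (asumB_ge0 (fun i => mulr_ge0 c0 (pos0 f i))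
  (fun i => mulr_ge0 c0 (neg0 f i)) (rsummableZ c (spos sf)) (rsummableZ c (sneg sf))).
have -> : (\esum_(i in setT) (c * pos f i)%:E = c%:E * P f)%E.
  by rewrite -esumZl// => i; rewrite lee_fin.
have -> : (\esum_(i in setT) (c * neg f i)%:E = c%:E * N f)%E.
  by rewrite -esumZl// => i; rewrite lee_fin.
have cfin : (c%:E : \bar R) \is a fin_num by [].
by rewrite (fineM cfin (Pfin sf)) (fineM cfin (Nfin sf)) mulrBr.
Qed.

Lemma asum0 : asum (fun _ : I => 0 : R) = 0.
Proof.
rewrite -[RHS](mul0r (asum (fun _ : I => 0 : R))) -(asumZ 0 rsummable0).
by congr asum; apply/funext => i; rewrite mul0r.
Qed.

Lemma asum_sum (J : Type) (s : seq J) (F : J -> I -> R) :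
  (forall j, rsummable (F j)) ->
  asum (fun i => \sum_(j <- s) F j i) = \sum_(j <- s) asum (F j).
Proof.
move=> sF; elim: s => [|j s IH].
  by under eq_fun do rewrite big_nil; rewrite asum0 big_nil.
under eq_fun do rewrite big_cons; rewrite asumD// ?IH ?big_cons//.
exact: rsummable_sum.
Qed.

Lemma rsummable_norm f : rsummable f -> rsummable (fun i => `|f i|).
Proof. by move=> sf; rewrite /rsummable; under eq_esum do rewrite normr_id. Qed.

Lemma ler_norm_asum f : rsummable f -> `|asum f| <= asum (fun i => `|f i|).
Proof.
move=> sf; have sn := rsummable_norm sf.
rewrite ler_norml -asumN// !le_asum//; try exact: rsummableN.
  by move=> i; exact: ler_norm.
by move=> i; have := ler_norm (- f i); rewrite normrN lerNl.
Qed.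

End asum.

(** * Alternating sums and anchored products *)

Section alternating_sums.
Variable R : realType.
Implicit Types u v w : {fset nat}.

Definition toggle (j : nat) v : {fset nat} :=
  if j \in v then (v `\ j)%fset else (j |` v)%fset.

Lemma toggleK j : involutive (toggle j).
Proof.
move=> v; rewrite {2}/toggle; case: ifPn => jv.
  by rewrite /toggle !inE eqxx/= fsetD1K.
by rewrite /toggle !inE eqxx/= fsetU1K.
Qed.

Lemma toggle_sub j u v : j \in u -> (toggle j v `<=` u)%fset = (v `<=` u)%fset.
Proof.
move=> ju; have H w : (w `<=` u)%fset -> (toggle j w `<=` u)%fset.
  move=> wu; rewrite /toggle; case: ifPn => _.
    exact: fsubset_trans (fsubD1set _ _) wu.
  by rewrite fsubUset wu fsub1set ju.
by apply/idP/idP => /H//; rewrite toggleK.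
Qed.

Lemma sum_toggle j u (F : {fset nat} -> R) : j \in u ->
  \sum_(v <- fpowerset u) F v = \sum_(v <- fpowerset u) F (toggle j v).
Proof.
move=> ju; have E : [fset toggle j v | v in fpowerset u]%fset = fpowerset u.
  apply/fsetP => v; apply/imfsetP/idP => /= [[w]|].
    by rewrite !fpowersetE => wu ->; rewrite toggle_sub.
  rewrite fpowersetE => vu; exists (toggle j v); last by rewrite toggleK.
  by rewrite fpowersetE toggle_sub.
by rewrite -{1}E big_imfset//= => v w _ _ /(can_inj (toggleK j)).
Qed.

Definition sgn u v : R := (-1) ^+ #|` u `\` v|%fset.

Lemma sgn_toggle j u v : j \in u -> sgn u (toggle j v) = - sgn u v.
Proof.
move=> ju; have key w : j \notin w -> sgn u (j |` w)%fset = - sgn u w.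
  move=> jw; rewrite /sgn.
  have -> : (u `\` w = j |` (u `\` (j |` w)))%fset.
    apply/fsetP => i; rewrite !inE; case: (eqVneq i j) => [->|//].
    by rewrite jw ju.
  by rewrite cardfsU1 !inE eqxx/= exprD expr1 mulN1r opprK.
rewrite /toggle; case: ifPn => jv; last exact: key.
have := key (v `\ j)%fset; rewrite !inE eqxx/= fsetD1K// => -> //.
by rewrite opprK.
Qed.

(** A sign-reversing involution: toggling j flips [sgn] and preserves G, so the sum equals its own
    negative. *)
Lemma alt_sum0 j u (G : {fset nat} -> R) : j \in u ->
  (forall v, G (toggle j v) = G v) -> \sum_(v <- fpowerset u) sgn u v * G v = 0.
Proof.
move=> ju Gj; have := sum_toggle (fun v => sgn u v * G v) ju.
under [X in _ = X -> _]eq_bigr do rewrite sgn_toggle// Gj mulNr.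
rewrite sumrN; set S := \sum_(_ <- _) _ => h; lra.
Qed.

Lemma mem_toggle j u i : i != j -> (i \in toggle j u) = (i \in u).
Proof.
by rewrite /toggle; case: ifPn => _ ij; rewrite !inE (negbTE ij).
Qed.

Lemma sgn_norm u v : `|sgn u v| = 1.
Proof. by rewrite normrX normrN1 expr1n. Qed.

(** On subsets of u, (-1)^|v| differs from [sgn u v] only by the fixed sign (-1)^|u|, so [alt_sum0]
    applies with G = 1. *)
Lemma sum_sgn_card u : \sum_(v <- fpowerset u) (-1) ^+ #|` v|%fset =
  (u == fset0)%:R :> R.
Proof.
case: (eqVneq u fset0) => [->|/fset0Pn[j ju]].
  by rewrite fpowerset0 big_seq_fset1 cardfs0 expr0.
have sgnE v : (v `<=` u)%fset -> (-1) ^+ #|` v|%fset = (-1) ^+ #|` u|%fset * sgn u v.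
  move=> vu; rewrite /sgn cardfsDS// -exprD.
  have := fsubset_leq_card vu; move: #|`u|%fset #|`v|%fset => n m mn.
  have -> : (n + (n - m) = m + 2 * (n - m))%N by rewrite mul2n -addnn addnA subnKC.
  by rewrite exprD exprM sqrrN expr1n expr1n mulr1.
rewrite big_seq; under eq_bigr => v do rewrite fpowersetE => /sgnE ->.
rewrite -big_seq -mulr_sumr; under eq_bigr do rewrite -[sgn _ _]mulr1.
by rewrite (alt_sum0 ju)// mulr0.
Qed.

(** An element of u outside of w can be toggled without affecting disjointness from w. If there is
    none, fset0 is the only subset of u disjoint from w. *)
Lemma sum_sgn_disjoint u w : \sum_(v <- fpowerset u) sgn u v * [disjoint w & v]%fset%:R
  = (-1) ^+ #|` u|%fset * (u `<=` w)%fset%:R.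
Proof.
case: (boolP (u `<=` w)%fset) => [uw|/fsubsetPn[j ju jw]]; last first.
  rewrite mulr0 (alt_sum0 ju)// => v; congr (_%:R); congr nat_of_bool.
  apply/fdisjointP/fdisjointP => h i iw; move: (h i iw); rewrite mem_toggle//;
    by apply: contraNneq jw => <-.
rewrite mulr1 (big_fsetD1 fset0)/=; last by rewrite fpowersetE fsub0set.
rewrite /sgn fsetD0 fdisjointX0 mulr1 big_seq big1 ?addr0// => v.
rewrite !inE fpowersetE => /andP[/fset0Pn[j jv] vu].
have -> : [disjoint w & v]%fset = false; last by rewrite mulr0.
apply/negbTE/fdisjointP => /(_ j); rewrite jv => H.
by have := H (fsubsetP uw _ (fsubsetP vu _ jv)).
Qed.

End alternating_sums.

Section kernel_products.
Variables (R : realType) (D : set R) (a : D).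
Local Notation T := (dom a).
Variable k : T -> T -> R.
Implicit Types (u v w : {fset nat}) (x y z : nat -> T).

Definition kp w x y : R := \prod_(j <- w) k (x j) (y j).

Lemma kprod_restr w x y : kprod k (restr w x) (restr w y) = kp w x y.
Proof. by rewrite /kp big_seq_fsetE. Qed.

(** V is a predicate and not a finite set: [predT] leaves x unchanged, so I and the integrals over
    anchored points are instances of one functional [mixE]. *)
Definition mixp (V : pred nat) x : nat -> T := fun j => if V j then x j else a.

Definition anchor : nat -> T := fun=> a.

Definition ext u (y : u -> T) : nat -> T :=
  fun j => if insub j is Some j' then y j' else a.

Lemma restr_ext u (y : u -> T) : restr u (ext y) = y.
Proof. by apply/funext => j; rewrite /restr /ext valK. Qed.

Lemma eq_kp w x y x' y' : (forall j, j \in w -> x j = x' j) ->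
  (forall j, j \in w -> y j = y' j) -> kp w x y = kp w x' y'.
Proof.
move=> xx' yy'; rewrite /kp big_seq [RHS]big_seq.
by apply: eq_bigr => j jw; rewrite xx'// yy'.
Qed.

Lemma kp_anchor w : kp w anchor anchor = k a a ^+ #|` w|%fset.
Proof. by rewrite /kp /anchor big_const_seq count_predT iter_mulr_1. Qed.

Lemma kp_sub u w x y : (u `<=` w)%fset ->
  kp w x y = kp u x y * kp (w `\` u)%fset x y.
Proof.
move=> uw; rewrite /kp (big_fsetID _ (mem u)) /=; congr (_ * _).
  apply: eq_fbigl => j; rewrite !inE andb_idl// => ju.
  exact: (fsubsetP uw).
by apply: eq_fbigl => j; rewrite !inE andbC.
Qed.

Lemma mixp_toggle j v x i : i != j ->
  mixp (mem (toggle j v)) x i = mixp (mem v) x i.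
Proof. by move=> ij; rewrite /mixp/= mem_toggle. Qed.

Definition altkp u w x y : R := \sum_(v <- fpowerset u) \sum_(v' <- fpowerset u)
  sgn R u v * sgn R u v' * kp w (mixp (mem v) x) (mixp (mem v') y).

(** If some j in u is missing from w, toggling j in v leaves the coordinates read by k_w alone, and
    the signs cancel. Otherwise every factor of k_w outside of u equals k(a, a) and can be pulled
    out. *)
Lemma altkpE u w x y :
  altkp u w x y = (u `<=` w)%fset%:R * k a a ^+ #|` w `\` u|%fset * altkp u u x y.
Proof.
case: (boolP (u `<=` w)%fset) => [uw|/fsubsetPn[j ju jw]].
  rewrite mul1r /altkp mulr_sumr big_seq [RHS]big_seq; apply: eq_bigr => v.
  rewrite fpowersetE => vu; rewrite mulr_sumr big_seq [RHS]big_seq.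
  apply: eq_bigr => v'; rewrite fpowersetE => v'u.
  rewrite (kp_sub _ _ uw).
  suff -> : kp (w `\` u)%fset (mixp (mem v) x) (mixp (mem v') y) =
    k a a ^+ #|` w `\` u|%fset by ring.
  rewrite -kp_anchor; apply: eq_kp => i; rewrite inE => /andP[iu _];
    rewrite /mixp/= ifN//; apply: contra iu; exact: fsubsetP.
rewrite !mul0r /altkp.
under eq_bigr do (under eq_bigr do rewrite -mulrA; rewrite -mulr_sumr).
rewrite (alt_sum0 ju)// => v; apply: eq_bigr => v' _; congr (_ * _).
apply: eq_kp => // i iw; rewrite mixp_toggle//.
by apply: contraNneq jw => <-.
Qed.

(** Each of the finitely many exceptional factors is at most max(1, b_j / kappa) kappa. In this way
    summability at the anchor passes to all points that differ from it in finitely many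
    coordinates. *)
Lemma prod_le_card (b : nat -> R) (kappa : R) v w : 0 < kappa ->
  (forall j, 0 <= b j) -> (forall j, j \notin v -> b j = kappa) ->
  \prod_(j <- w) b j <=
  (\prod_(j <- v) Num.max 1 (b j / kappa)) * kappa ^+ #|` w|%fset.
Proof.
move=> k0 b0 bk; pose c j := Num.max 1 (b j / kappa).
have c1 j : 1 <= c j by rewrite le_max lexx.
have c0 j : 0 <= c j by exact: le_trans (c1 j).
have step1 : \prod_(j <- w) b j <= \prod_(j <- w) (c j * kappa).
  by apply: ler_prod => j _; rewrite b0/= -ler_pdivrMr// le_max lexx orbT.
apply: (le_trans step1); rewrite big_split/= big_const_seq count_predT iter_mulr_1.
apply: ler_wpM2r; first by rewrite exprn_ge0// ltW.
have wv : (w `<=` w `|` v)%fset by exact: fsubsetUl.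
have vw : (v `<=` w `|` v)%fset by exact: fsubsetUr.
rewrite [leRHS](_ : _ = \prod_(j <- (w `|` v)%fset) c j); last first.
  apply: big_fset_incl => // j _ jv; rewrite /c bk// divff ?gt_eqF// maxxx//.
rewrite [leRHS](big_fsetID _ (mem w))/= [X in X * _](_ : _ = \prod_(j <- w) c j).
  apply: ler_peMr; first by apply: prodr_ge0 => j _; exact: c0.
  rewrite big_seq; elim/big_ind: _ => // x y x1 y1.
  by rewrite -[1]mulr1 ler_pM.
apply: eq_fbigl => j; rewrite !inE andb_idl// => ju.
by rewrite ju.
Qed.

Section positive.
Hypothesis k_diag : forall x : T, 0 < k x x.

Lemma kp_diag_ge0 w x : 0 <= kp w x x.
Proof. by rewrite prodr_ge0// => j _; rewrite ltW. Qed.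

Variable gamma : {fset nat} -> R.
Hypothesis gamma_ge0 : forall u, 0 <= gamma u.
Hypothesis a_anchor :
    (\esum_(u in [set: {fset nat}]) (gamma u * k a a ^+ #|` u|%fset)%:E
      < +oo)%E.

Definition gkp x y w : R := gamma w * kp w x y.

Lemma gkp_ge0 x w : 0 <= gkp x x w.
Proof. by rewrite mulr_ge0// kp_diag_ge0. Qed.

Lemma XdomE x : Xdom k gamma x <-> rsummable (gkp x x).
Proof.
rewrite /Xdom/=; under eq_esum do rewrite kprod_restr.
by rewrite (ge0_rsummable (gkp_ge0 x)).
Qed.

Lemma rsummable_prod (b : nat -> R) v :
  (forall j, 0 <= b j) -> (forall j, j \notin v -> b j = k a a) ->
  rsummable (fun w => gamma w * \prod_(j <- w) b j).
Proof.
move=> b0 bk; have ge0 w : 0 <= gamma w * \prod_(j <- w) b j.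
  by rewrite mulr_ge0// prodr_ge0.
pose c := \prod_(j <- v) Num.max 1 (b j / k a a).
apply: (@rsummable_le _ _ _ (fun w => c * (gamma w * k a a ^+ #|` w|%fset))).
  move=> w; rewrite ger0_norm// mulrCA ler_wpM2l//.
  exact: prod_le_card.
apply: rsummableZ; apply/ge0_rsummable => // w.
by rewrite mulr_ge0// exprn_ge0// ltW.
Qed.

Lemma Xdom_mix v x : Xdom k gamma (mixp (mem v) x).
Proof.
apply/XdomE; apply: (@rsummable_prod _ v) => [j|j jv]; first by rewrite ltW.
by rewrite /mixp/= ifN.
Qed.

Lemma KkerE (x y : Xdom k gamma) : Kker x y = asum (gkp (val x) (val y)).
Proof.
have -> : gkp (val x) (val y) =
    fun w => gamma w * kprod k (restr w (val x)) (restr w (val y)).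
  by apply/funext => w; rewrite kprod_restr.
by [].
Qed.

End positive.
End kernel_products.

Arguments mixp {R D} a V x j.
Arguments anchor {R D} a j.
Arguments ext {R D} a {u} y j.

(** * Integration under the product measure *)

Section independent_pair.
Local Open Scope ereal_scope.
Context d d1 d2 (T : measurableType d) (T1 : measurableType d1)
  (T2 : measurableType d2) (R : realType).
Variables (P : probability T R) (P1 : probability T1 R).
Variables (X : {mfun T >-> T1}) (Y : {mfun T >-> T2}).
Hypothesis indep : forall A B, measurable A -> measurable B ->
  P (X @^-1` A `&` Y @^-1` B) = P1 A * P (Y @^-1` B).

Let mXY : measurable_fun setT (fun x => (X x, Y x)).
Proof. exact: measurable_fun_pair. Qed.

Let XY : {mfun T >-> (T1 * T2)%type} := mfun_Sub (mem_set mXY).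

Let distribution_pair A : measurable A ->
  (P1 \x distribution P Y) A = distribution P XY A.
Proof.
apply: product_measure_unique => B C mB mC.
rewrite /distribution /pushforward/= -indep//.
Qed.

Lemma indep_tonelli (f : T1 * T2 -> \bar R) : measurable_fun setT f ->
  (forall z, 0 <= f z) ->
  \int[P]_x f (X x, Y x) = \int[P]_x \int[P1]_t f (t, Y x).
Proof.
move=> mf f0; rewrite -(ge0_integral_distribution XY mf f0).
rewrite (eq_measure_integral (P1 \x distribution P Y)%E); last first.
  by move=> A mA _; apply/esym; exact: distribution_pair.
rewrite fubini_tonelli2//.
rewrite (ge0_integral_distribution Y)//; first exact: measurable_fun_fubini_tonelli_G.
by move=> y; apply: integral_ge0.
Qed.

Lemma indep_fubini (f : T1 * T2 -> \bar R) : measurable_fun setT f ->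
  P.-integrable setT (fun x => f (X x, Y x)) ->
  \int[P]_x f (X x, Y x) = \int[distribution P Y]_y \int[P1]_t f (t, y).
Proof.
move=> mf fi; rewrite -[LHS](integral_distribution (X := XY) mf fi).
rewrite (eq_measure_integral (P1 \x distribution P Y)%E); last first.
  by move=> A mA _; apply/esym; exact: distribution_pair.
rewrite integral21_prod_meas1//.
apply/integrableP; split => //.
rewrite (eq_measure_integral (distribution P XY)); last first.
  by move=> A mA _; exact: distribution_pair.
rewrite ge0_integral_distribution//; last exact: measurableT_comp.
by move/integrableP : fi => [].
Qed.

End independent_pair.

Section product_space.
Context (I : choiceType) d (T : measurableType d).

Lemma coord_measurable (j : I) :
  measurable_fun setT (fun x : prodspace I T => x j).
Proof.
move=> _ A mA; rewrite setTI; apply: sub_sigma_algebra.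
by exists j, A.
Qed.

Lemma prodspace_measurable d' (Z : measurableType d') (f : Z -> prodspace I T) :
  (forall j, measurable_fun setT (fun z => f z j)) -> measurable_fun setT f.
Proof.
move=> mf; apply: (@measurability _ _ Z (prodspace I T) setT f (@coord_sets I d T)) => //.
move=> _ [_ [j [A [mA ->]]] <-]; have := mf j measurableT A mA.
by rewrite !setTI.
Qed.

Definition cylinder (J : {fset I}) (A : I -> set T) : set (prodspace I T) :=
  [set x | forall j, j \in J -> A j (x j)].

Definition cylinders : set (set (prodspace I T)) :=
  [set C | exists J A, (forall j, measurable (A j)) /\ C = cylinder J A].

Lemma cylinder_measurable J A : (forall j, measurable (A j)) ->
  measurable (cylinder J A).
Proof.
move=> mA; have -> : cylinder J A =
    \big[setI/setT]_(j <- J) [set x : prodspace I T | A j (x j)].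
  rewrite -bigcap_fset; apply/seteqP; split => x /= h j jJ; exact: h.
rewrite big_seq; elim/big_ind: _ => //; first exact: measurableI.
move=> j _; have := coord_measurable j measurableT (mA j); rewrite setTI; exact.
Qed.

Lemma cylinders_setI : setI_closed cylinders.
Proof.
move=> _ _ [J [A [mA ->]]] [K [B [mB ->]]].
exists (J `|` K)%fset, (fun j => (if j \in J then A j else setT) `&`
  (if j \in K then B j else setT)); split.
  by move=> j; apply: measurableI; case: ifP.
apply/seteqP; split => x /=.
  move=> [xA xB] j _; split; case: ifP => //; [exact: xA|exact: xB].
move=> h; split => j jJ.
  by have := h j; rewrite inE jJ => /(_ isT) [].
by have := h j; rewrite inE jJ orbT => /(_ isT) [].
Qed.

Lemma measurable_cylinders : @measurable _ (prodspace I T) = <<s cylinders >>.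
Proof.
apply/seteqP; split.
  apply: smallest_sub; first exact: smallest_sigma_algebra.
  move=> _ [j [A [mA ->]]]; apply: sub_sigma_algebra.
  exists [fset j]%fset, (fun=> A); split => //; apply/seteqP; split => x /=.
    by move=> Ax i; rewrite inE => /eqP ->.
  by apply; rewrite inE.
apply: smallest_sub; first exact: sigma_algebra_measurable.
by move=> _ [J [A [mA ->]]]; exact: cylinder_measurable.
Qed.

Lemma prodspace_measure_unique (R : realType)
    (m1 m2 : {measure set (prodspace I T) -> \bar R}) :
  (m1 setT < +oo)%E ->
  (forall J A, (forall j, measurable (A j)) ->
     m1 (cylinder J A) = m2 (cylinder J A)) ->
  forall B, measurable B -> m1 B = m2 B.
Proof.
move=> m1oo m12 B mB; apply: (measure_unique cylinders (fun=> setT)) => //.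
- exact: measurable_cylinders.
- exact: cylinders_setI.
- move=> _; exists fset0, (fun=> setT); split => //.
  by apply/seteqP; split.
- by rewrite bigcup_const//; exists 0%N.
- by move=> _ [J [A [mA ->]]]; exact: m12.
Qed.

(** Under the product measure, x with its j-th coordinate overwritten is independent of x_j, and a
    function that does not read x_j takes the same value there. This stands in for splitting the
    product space into two factors. *)
Definition upd (t : T) (j : I) (x : prodspace I T) : prodspace I T :=
  fun i => if i == j then t else x i.

Lemma upd_measurable t j : measurable_fun setT (upd t j).
Proof.
apply: prodspace_measurable => i; rewrite /upd; case: eqP => _.
  exact: measurable_cst.
exact: coord_measurable.
Qed.

Section product_measure.
Variables (R : realType) (rho : probability T R).
Variable mu : probability (prodspace I T) R.
Hypothesis mu_prod : is_prod_measure rho mu.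

Let mu_cylinder J (A : I -> set T) : (forall j, measurable (A j)) ->
  mu (cylinder J A) = (\prod_(j <- J) fine (rho (A j)))%:E.
Proof. exact: mu_prod. Qed.

(** For fixed A both sides are finite measures in B, so it suffices to compare them on cylinders.
    There the condition on coordinate j of B only decides whether t lies in C j. *)
Lemma mu_coord_upd t j A B : measurable A -> measurable B ->
  mu ((fun x => x j) @^-1` A `&` upd t j @^-1` B) =
  (rho A * mu (upd t j @^-1` B))%E.
Proof.
move=> mA mB.
have mE : measurable ((fun x : prodspace I T => x j) @^-1` A).
  by have := coord_measurable j measurableT mA; rewrite setTI.
pose U : {mfun prodspace I T >-> prodspace I T} := mfun_Sub (mem_set (upd_measurable t j)).
have rA0 : 0 <= fine (rho A) by rewrite fine_ge0.
have rAE : rho A = (fine (rho A))%:E by rewrite fineK// fin_num_measure.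
pose m1 := pushforward (mrestr mu mE) U.
pose m2 := mscale (NngNum rA0) (distribution mu U).
suff : m1 B = m2 B by rewrite setIC rAE.
apply: prodspace_measure_unique => //.
  rewrite [X in (X < _)%E](_ : _ = mu ((fun x : prodspace I T => x j) @^-1` A)).
    by rewrite ltey_eq fin_num_measure.
  by rewrite /m1 /pushforward /mrestr; congr (mu _); apply/seteqP; split => // x [].
move=> J C mC.
change (mu (upd t j @^-1` cylinder J C `&` (fun x : prodspace I T => x j) @^-1` A) =
  (fine (rho A))%:E * mu (upd t j @^-1` cylinder J C))%E.
rewrite -rAE.
pose J' := (J `\ j)%fset.
have [tC|tC] := pselect (j \in J -> C j t); last first.
  have -> : upd t j @^-1` cylinder J C = set0.
    apply/seteqP; split => // x /= h; apply: tC => jJ.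
    by have := h j jJ; rewrite /upd eqxx.
  by rewrite set0I !measure0 mule0.
have -> : upd t j @^-1` cylinder J C = cylinder J' C.
  apply/seteqP; split => x /= h i.
    by rewrite !inE => /andP[ij iJ]; have := h i iJ; rewrite /upd (negbTE ij).
  move=> iJ; rewrite /upd; case: eqP => [ij|/eqP ij]; first by rewrite ij; apply: tC; rewrite -ij.
  by apply: h; rewrite !inE ij.
pose C' i := if i == j then A else C i.
have -> : cylinder J' C `&` (fun x => x j) @^-1` A = cylinder (j |` J')%fset C'.
  apply/seteqP; split => x /=.
    move=> [h Ax] i; rewrite /C' inE in_fset1; case: eqP => [->//|_ /=]; exact: h.
  move=> h; split => [i iJ|]; last by have := h j; rewrite /C' eqxx inE in_fset1 eqxx => /(_ isT).
  have := h i; rewrite /C' inE iJ orbT => /(_ isT).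
  by move: iJ; rewrite !inE => /andP[/negbTE ->].
have mC' i : measurable (C' i) by rewrite /C'; case: ifP.
rewrite !mu_cylinder// big_fsetU1/=; last by rewrite !inE eqxx.
rewrite /C' eqxx; rewrite [in LHS]EFinM -rAE; congr (_ * _%:E)%E.
by rewrite big_seq [RHS]big_seq; apply: eq_bigr => i; rewrite !inE => /andP[/negbTE ->].
Qed.

End product_measure.
End product_space.

Lemma integral_prob_cst d (Z : measurableType d) (R : realType)
  (P : probability Z R) (c : R) : (\int[P]_x c%:E = c%:E)%E.
Proof. by rewrite integral_cst//= probability_setT mule1. Qed.

Section integrals_of_kernel_products.
Variables (R : realType) (D : set R) (a : D).
Local Notation T := (dom a).
Variable k : T -> T -> R.
Hypothesis k_meas : measurable_fun setT (fun z : T * T => k z.1 z.2).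
Hypothesis k_diag : forall x : T, 0 < k x x.
Local Notation NT := (prodspace nat T).


Lemma kl_measurable y : measurable_fun setT (k^~ y).
Proof.
rewrite (_ : k^~ y = (fun z : T * T => k z.1 z.2) \o (fun x => (x, y)))//.
apply: measurableT_comp => //; exact: measurable_fun_pair.
Qed.

Lemma kd_measurable : measurable_fun setT (fun x => k x x).
Proof.
rewrite (_ : (fun x => k x x) = (fun z : T * T => k z.1 z.2) \o (fun x => (x, x)))//.
apply: measurableT_comp => //; exact: measurable_fun_pair.
Qed.

Lemma mixp_measurable (V : pred nat) :
  measurable_fun setT (mixp a V : NT -> NT).
Proof.
apply: prodspace_measurable => j; rewrite /mixp; case: (V j).
  exact: coord_measurable.
exact: measurable_cst.
Qed.

Lemma ext_measurable (u : {fset nat}) :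
  measurable_fun setT (@ext R D a u : prodspace u T -> NT).
Proof.
apply: prodspace_measurable => j; rewrite /ext; case: (insub j) => [j'|].
  exact: coord_measurable.
exact: measurable_cst.
Qed.

Lemma kpl_measurable w y : measurable_fun setT (fun x : NT => kp k w x y).
Proof.
apply: measurable_prod => j _; apply: (@measurableT_comp _ _ _ _ _ _ (k^~ (y j))).
  exact: kl_measurable.
exact: coord_measurable.
Qed.

Lemma kpd_measurable w : measurable_fun setT (fun x : NT => kp k w x x).
Proof.
apply: measurable_prod => j _; apply: (@measurableT_comp _ _ _ _ _ _ (fun t => k t t)).
  exact: kd_measurable.
exact: coord_measurable.
Qed.

Variables (rho : probability T R) (mu : probability NT R).
Hypothesis mu_prod : is_prod_measure rho mu.
Variable M : R.
Hypothesis M_def : (\int[rho]_x (k x x)%:E = M%:E)%E.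
Hypothesis k_int0 : forall y, (\int[rho]_x (k x y)%:E = 0)%E.
Hypothesis k_rk : rkhs k.
Hypothesis kprod_rk : forall u, rkhs (@kprod R D a k u).

Lemma M_ge0 : 0 <= M.
Proof.
by rewrite -lee_fin -M_def integral_ge0// => x _; rewrite lee_fin ltW.
Qed.

Lemma kp_le_diag w x y : `|kp k w x y| <= 2^-1 * kp k w x x + 2^-1 * kp k w y y.
Proof.
by have := rk_ker_le (kprod_rk w) (restr w x) (restr w y); rewrite !kprod_restr; lra.
Qed.

Definition mixc (V : pred nat) (j : nat) : R := if V j then M else k a a.

Lemma mixc_ge0 V j : 0 <= mixc V j.
Proof. by rewrite /mixc; case: ifP => _; [exact: M_ge0|exact: ltW]. Qed.

(** Induction on the coordinates of w: x_j is split off by independence, and the remaining factors H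
    do not notice that x_j is overwritten, because j does not recur. An integrated coordinate
    contributes M, an anchored one k(a, a). *)
Lemma integral_kp_mix V (w : {fset nat}) :
  (\int[mu]_x (kp k w (mixp a V x) (mixp a V x))%:E = (\prod_(j <- w) mixc V j)%:E)%E.
Proof.
rewrite /kp; have : uniq w by exact: fset_uniq.
elim: {w}(enum_fset w) => [_|j s IH /= /andP[js us]].
  under eq_integral do rewrite big_nil.
  by rewrite big_nil; exact: integral_prob_cst.
rewrite big_cons EFinM -IH//.
pose H y : R := \prod_(i <- s) k (mixp a V y i) (mixp a V y i).
have H0 y : 0 <= H y by apply: prodr_ge0 => i _; exact: ltW.
have mH : measurable_fun setT (H : NT -> R).
  apply: measurable_prod => i _.
  apply: (@measurableT_comp _ _ _ _ _ _ (fun t => k t t) _ (fun x : NT => mixp a V x i)).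
    exact: kd_measurable.
  apply: (measurableT_comp (coord_measurable i)); exact: mixp_measurable.
under eq_integral do rewrite big_cons.
rewrite /mixc; case: (boolP (V j)) => Vj; last first.
  transitivity (\int[mu]_x ((k a a)%:E * (H x)%:E))%E.
    by apply: eq_integral => x _; rewrite {1 2}/mixp (negbTE Vj) EFinM.
  rewrite ge0_integralZl_EFin ?ltW//; first by move=> x _; rewrite lee_fin.
  exact/measurable_EFinP.
pose X : {mfun NT >-> T} := mfun_Sub (mem_set (coord_measurable j)).
pose Y : {mfun NT >-> NT} := mfun_Sub (mem_set (@upd_measurable nat _ T a j)).
pose f (z : T * NT) := ((k z.1 z.1)%:E * (H z.2)%:E)%E.
have HY x : H (Y x) = H x.
  rewrite /H big_seq [RHS]big_seq; apply: eq_bigr => i si.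
  have ij : i != j by apply: contraNneq js => <-.
  by rewrite /mixp /= /upd (negbTE ij).
have mf : measurable_fun setT f.
  apply: emeasurable_funM; apply/measurable_EFinP.
    exact: (measurableT_comp kd_measurable measurable_fst).
  exact: (measurableT_comp mH measurable_snd).
have f0 z : (0 <= f z)%E by rewrite mule_ge0 ?lee_fin// ltW.
transitivity (\int[mu]_x f (X x, Y x))%E.
  by apply: eq_integral => x _; rewrite /f/= HY {1 2}/mixp Vj EFinM.
rewrite (indep_tonelli (P1 := rho))//; last first.
  by move=> A B mA mB; exact: mu_coord_upd.
transitivity (\int[mu]_x (M%:E * (H x)%:E))%E; last first.
  rewrite ge0_integralZl_EFin ?M_ge0//; first by move=> x _; rewrite lee_fin.
  exact/measurable_EFinP.
apply: eq_integral => x _; rewrite -M_def -(HY x) /f [LHS]/=.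
rewrite ge0_integralZr ?lee_fin ?H0//; last by move=> t _; rewrite lee_fin ltW.
by apply/measurable_EFinP; exact: kd_measurable.
Qed.

Lemma integrable_kp_mix V w y :
  mu.-integrable setT (fun x => (kp k w (mixp a V x) y)%:E).
Proof.
pose g (x : NT) := 2^-1 * kp k w (mixp a V x) (mixp a V x) + 2^-1 * kp k w y y.
have mg : measurable_fun setT (fun x : NT => kp k w (mixp a V x) (mixp a V x)).
  exact: (measurableT_comp (kpd_measurable w) (mixp_measurable V)).
apply: (@le_integrable _ _ _ _ _ _ _ (EFin \o g)) => //.
- apply/measurable_EFinP; exact: (measurableT_comp (kpl_measurable w y) (mixp_measurable V)).
- move=> x _; rewrite /= lee_fin; apply: le_trans (kp_le_diag _ _ _) _.
  exact: ler_norm.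
- have c1 : mu.-integrable setT (fun _ : NT => (2^-1 * kp k w y y)%:E).
    exact: finite_measure_integrable_cst.
  have c2 : mu.-integrable setT (fun x : NT => (kp k w (mixp a V x) (mixp a V x))%:E).
    apply/integrableP; split; first exact/measurable_EFinP.
    under eq_integral => x _ do rewrite gee0_abs ?lee_fin ?kp_diag_ge0//.
    by rewrite integral_kp_mix ltry.
  have c3 := integrableD measurableT (integrableZl measurableT 2^-1 c2) c1.
  exact: c3.
Qed.

(** One coordinate j of w in V is enough: k(., y_j) integrates to 0 with the other coordinates held
    fixed. If w misses V, the integrand is constant. *)
Lemma integral_kp_mix_l V w y :
  (\int[mu]_x (kp k w (mixp a V x) y)%:E =
   ((all (predC V) w)%:R * kp k w (anchor a) y)%:E)%E.
Proof.
case: (boolP (all _ _)) => [/allP wV|/allPn[j jw /negPn Vj]].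
  rewrite mul1r -[RHS](integral_prob_cst mu); apply: eq_integral => x _.
  congr (_%:E); apply: eq_kp => // j /wV /= /negbTE Vj.
  by rewrite /mixp Vj.
rewrite mul0r.
pose X : {mfun NT >-> T} := mfun_Sub (mem_set (coord_measurable j)).
pose Y : {mfun NT >-> NT} := mfun_Sub (mem_set (@upd_measurable nat _ T a j)).
pose H z := kp k (w `\ j)%fset (mixp a V z) y.
pose f (z : T * NT) := (k z.1 (y j) * H z.2)%:E.
have fE x : f (X x, Y x) = (kp k w (mixp a V x) y)%:E.
  rewrite /f /kp (big_fsetD1 _ jw)/=; congr (_ * _)%:E; first by rewrite /mixp Vj.
  apply: eq_kp => // i; rewrite !inE => /andP[/negbTE ij _].
  by rewrite /mixp/= /upd ij.
have mH : measurable_fun setT (H : NT -> R).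
  exact: (measurableT_comp (kpl_measurable _ y) (mixp_measurable V)).
transitivity (\int[mu]_x f (X x, Y x))%E; first by apply: eq_integral => x _; rewrite fE.
rewrite (indep_fubini (P1 := rho)).
- rewrite (eq_integral (cst 0)) ?integral0// => z _.
  rewrite /f/=; under eq_integral do rewrite EFinM.
  rewrite integralZr//; first by rewrite k_int0 mul0e.
  apply: (@le_integrable _ _ _ _ _ _ _ (fun t => (2^-1 * k t t + 2^-1 * k (y j) (y j))%:E)) => //.
  + by apply/measurable_EFinP; exact: kl_measurable.
  + move=> t _; rewrite lee_fin; apply: le_trans (ler_norm _).
    by have := rk_ker_le k_rk t (y j); lra.
  + have c2 : rho.-integrable setT (fun t => (k t t)%:E).
      apply/integrableP; split; first by apply/measurable_EFinP; exact: kd_measurable.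
      under eq_integral => x _ do rewrite gee0_abs ?lee_fin ?ltW//.
      by rewrite M_def ltry.
    have c1 : rho.-integrable setT (fun _ : T => (2^-1 * k (y j) (y j))%:E).
      exact: finite_measure_integrable_cst.
    have c3 := integrableD measurableT (integrableZl measurableT 2^-1 c2) c1.
    exact: c3.
- by move=> A B mA mB; exact: mu_coord_upd.
- apply/measurable_EFinP; apply: measurable_funM.
    exact: (measurableT_comp (kl_measurable _) measurable_fst).
  exact: (measurableT_comp mH measurable_snd).
- have -> : (fun x => f (X x, Y x)) = fun x => (kp k w (mixp a V x) y)%:E.
    by apply/funext => x; exact: fE.
  exact: integrable_kp_mix.
Qed.

End integrals_of_kernel_products.

(** * Integrals of functions in H(K) over partly anchored points *)

Lemma ae_imp d (Z : measurableType d) (R : realType)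
    (P : {measure set Z -> \bar R}) (A B : Z -> Prop) :
  (forall x, A x -> B x) -> {ae P, forall x, A x} -> {ae P, forall x, B x}.
Proof. by move=> AB; apply: filterS. Qed.

Section integral_asum.
Context (I : countType) d (Z : measurableType d) (R : realType).
Variable P : {measure set Z -> \bar R}.
Variables (h : I -> Z -> R) (c : I -> R) (G : Z -> R).
Hypothesis mh : forall i, measurable_fun setT (h i).
Hypothesis hc : forall i, (\int[P]_x `|h i x|%:E <= (c i)%:E)%E.
Hypothesis sc : rsummable c.
Hypothesis mG : measurable_fun setT G.
Hypothesis Gh : {ae P, forall x, G x = asum (h ^~ x)}.

Let hp i x := ((EFin \o h i)^\+ x)%E.
Let hn i x := ((EFin \o h i)^\- x)%E.
Let mhp i : measurable_fun setT (hp i).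
Proof. by apply: measurable_funepos; exact/measurable_EFinP. Qed.
Let mhn i : measurable_fun setT (hn i).
Proof. by apply: measurable_funeneg; exact/measurable_EFinP. Qed.
Let hp0 i x : (0 <= hp i x)%E. Proof. exact: funepos_ge0. Qed.
Let hn0 i x : (0 <= hn i x)%E. Proof. exact: funeneg_ge0. Qed.
Let mabs i : measurable_fun setT (fun x => `|h i x|%:E).
Proof. by apply/measurable_EFinP; exact: measurableT_comp. Qed.
Let hp_le i : (\int[P]_x hp i x <= (c i)%:E)%E.
Proof.
apply: le_trans (hc i); apply: ge0_le_integral => // x _.
by rewrite /hp -(abse_EFin (h i x)) -/((abse \o (EFin \o h i)) x) fune_abse leeDl.
Qed.
Let hn_le i : (\int[P]_x hn i x <= (c i)%:E)%E.
Proof.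
apply: le_trans (hc i); apply: ge0_le_integral => // x _.
by rewrite /hn -(abse_EFin (h i x)) -/((abse \o (EFin \o h i)) x) fune_abse leeDr.
Qed.
Let c0 i : 0 <= c i.
Proof. by rewrite -lee_fin; apply: le_trans (hp_le i); exact: integral_ge0. Qed.
Let sum_lty (e : I -> Z -> \bar R) : (forall i, measurable_fun setT (e i)) ->
  (forall i x, 0 <= e i x)%E -> (forall i, \int[P]_x e i x <= (c i)%:E)%E ->
  P.-integrable setT (fun x => \esum_(i in setT) e i x)%E /\
  exists2 r : I -> R, (forall i, 0 <= r i /\ (\int[P]_x e i x = (r i)%:E)%E) &
   rsummable r /\ (\int[P]_x (\esum_(i in setT) e i x) = (asum r)%:E)%E.
Proof.
move=> me e0 ec.
have fin i : (\int[P]_x e i x)%E \is a fin_num.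
  by rewrite ge0_fin_numE ?integral_ge0// (le_lt_trans (ec i))// ltry.
pose r i := fine (\int[P]_x e i x)%E.
have rE i : (\int[P]_x e i x = (r i)%:E)%E by rewrite /r fineK.
have r0 i : 0 <= r i by rewrite fine_ge0// integral_ge0.
have sr : rsummable r.
  apply: (@rsummable_le _ _ _ c) => // i.
  by rewrite ger0_norm// -lee_fin -rE.
have intE : (\int[P]_x (\esum_(i in setT) e i x) = (asum r)%:E)%E.
  by rewrite integral_esum// EFin_asum//; apply: eq_esum => i _; rewrite rE.
split; last by exists r.
apply/integrableP; split; first exact: measurable_esum.
under eq_integral => x _ do rewrite gee0_abs ?esum_ge0//.
by rewrite intE ltry.
Qed.

(** Positive and negative parts are summed and integrated separately by monotone convergence, both
    dominated by c. Agreement of G with the series almost everywhere is the right form, since the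
    kernel series is controlled only on [Xdom]. *)
Lemma integral_asum : P.-integrable setT (EFin \o G) /\
  Rintegral P setT G = asum (fun i => Rintegral P setT (h i)).
Proof.
have [i1 [p pE [sp intp]]] := sum_lty mhp hp0 hp_le.
have [i2 [q qE [sq intq]]] := sum_lty mhn hn0 hn_le.
have GE : {ae P, forall x, (setT x -> (G x)%:E =
    \esum_(i in setT) hp i x - \esum_(i in setT) hn i x)%E}.
  have := integrable_ae measurableT i1; have := integrable_ae measurableT i2.
  move=> F2 F1; apply: filterS3 Gh F1 F2 => x -> /(_ Logic.I) f1 /(_ Logic.I) f2 _.
  have -> : asum (h ^~ x) = fine (\esum_(i in setT) hp i x)%E -
      fine (\esum_(i in setT) hn i x)%E.
    rewrite /asum; congr (fine _ - fine _); apply: eq_esum => i _.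
      by rewrite /hp !funeposE.
    by rewrite /hn !funenegE.
  by rewrite EFinB !fineK.
have mGE : measurable_fun setT (EFin \o G) by exact/measurable_EFinP.
have i12 := integrableB measurableT i1 i2.
have intG : P.-integrable setT (EFin \o G).
  apply/integrableP; split => //.
  have /integrableP[_] := i12; apply: le_lt_trans.
  rewrite (@ae_eq_integral _ _ _ P setT
    (fun x => `|(\esum_(i in setT) hp i x) - (\esum_(i in setT) hn i x)|)%E)//.
  - by apply: measurableT_comp.
  - by apply: measurableT_comp => //; exact: measurable_int i12.
  - by apply: filterS GE => x /(_ Logic.I) GEx _; rewrite -GEx.
split => //.
rewrite /Rintegral; transitivity (fine (\int[P]_x
    ((\esum_(i in setT) hp i x) - (\esum_(i in setT) hn i x)))%E).
  by congr fine; apply: ae_eq_integral => //; exact: measurable_int i12.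
rewrite integralB// intp intq -EFinB [LHS]/= -asumB//.
congr asum; apply/funext => i; rewrite integralE.
by rewrite (pE i).2 (qE i).2.
Qed.

End integral_asum.

Section mixed_integrals.
Variables (R : realType) (D : set R) (a : D).
Local Notation T := (dom a).
Variable k : T -> T -> R.
Hypothesis k_meas : measurable_fun setT (fun z : T * T => k z.1 z.2).
Hypothesis k_diag : forall x : T, 0 < k x x.
Local Notation NT := (prodspace nat T).
Variables (rho : probability T R) (mu : probability NT R).
Hypothesis mu_prod : is_prod_measure rho mu.
Variable M : R.
Hypothesis M_def : (\int[rho]_x (k x x)%:E = M%:E)%E.
Hypothesis k_int0 : forall y, (\int[rho]_x (k x y)%:E = 0)%E.
Hypothesis k_rk : rkhs k.
Hypothesis kprod_rk : forall u, rkhs (@kprod R D a k u).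
Variable gamma : {fset nat} -> R.
Hypothesis gamma_ge0 : forall u, 0 <= gamma u.
Variable HK : rkhs (@Kker R D a k gamma).
Local Notation XX := (Xdom k gamma).
Local Notation g := (gkp k gamma).

Definition ext0 (f : XX -> R) (x : NT) : R := oapp f 0 (insub x : option XX).

Lemma ext0E f (x : XX) : ext0 f (val x) = f x.
Proof. by rewrite /ext0 valK. Qed.

Lemma ext0N f (x : NT) : ~ XX x -> ext0 f x = 0.
Proof. by move=> Xx; rewrite /ext0 insubN//; apply/negP; rewrite inE. Qed.

Definition diagE (x : NT) : \bar R := (\esum_(w in setT) (g x x w)%:E)%E.

Lemma diagE_ge0 x : (0 <= diagE x)%E.
Proof. by apply: esum_ge0 => w _; rewrite lee_fin gkp_ge0. Qed.

Lemma diagE_measurable : measurable_fun setT diagE.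
Proof.
apply: (@measurable_esum R {fset nat} _ NT (fun w x => (g x x w)%:E)) => [w x|w].
  by rewrite lee_fin gkp_ge0.
apply/measurable_EFinP; apply: measurable_funM => //; exact: kpd_measurable.
Qed.

Lemma XdomP x : XX x <-> (diagE x < +oo)%E.
Proof.
by rewrite (XdomE k_diag gamma_ge0) /diagE; apply: ge0_rsummable => w; exact: gkp_ge0.
Qed.

Lemma Xdom_measurable : measurable (XX : set NT).
Proof.
have -> : (XX : set NT) = diagE @^-1` [set y | (y < +oo)%E].
  by apply/seteqP; split => x; [exact: (XdomP x).1|exact: (XdomP x).2].
rewrite -[_ @^-1` _]setTI; apply: diagE_measurable => //.
have -> : [set y : \bar R | (y < +oo)%E] = `]-oo, +oo%E[%classic.
  by apply/seteqP; split => y /=; rewrite in_itv/=.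
exact: emeasurable_itv.
Qed.

Lemma gkp_summable x y : XX x -> XX y -> rsummable (g x y).
Proof.
move=> /(XdomE k_diag gamma_ge0) sx /(XdomE k_diag gamma_ge0) sy.
apply: (@rsummable_le _ _ _ (fun w => 2^-1 * g x x w + 2^-1 * g y y w)).
  move=> w; rewrite /gkp normrM ger0_norm//.
  have := ler_wpM2l (gamma_ge0 w) (kp_le_diag kprod_rk w x y).
  by move/le_trans; apply; lra.
by apply: rsummableD; apply: rsummableZ.
Qed.

Lemma ext0_kerE (y : XX) x : XX x -> ext0 (fun z => Kker z y) x = asum (g x (val y)).
Proof.
move=> Xx; have -> : x = val (SigSub (mem_set Xx) : XX) by [].
by rewrite ext0E KkerE.
Qed.

Lemma asum_measurable (h : {fset nat} -> NT -> R) :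
  (forall w, measurable_fun setT (h w)) ->
  measurable_fun setT (fun x => asum (h ^~ x)).
Proof.
move=> mh; rewrite /asum; apply: measurable_funB.
  apply: measurableT_comp => //.
  apply: (@measurable_esum R {fset nat} _ NT (fun w x => ((fun w => (h w x)%:E)^\+ w)%E)).
    by move=> w x; exact: funepos_ge0.
  move=> w; have mhw : measurable_fun setT (fun x => (h w x)%:E).
    exact/measurable_EFinP.
  rewrite (_ : (fun x => _) = ((fun x => (h w x)%:E)^\+)%E).
    exact: measurable_funepos.
  by apply/funext => x; rewrite !funeposE.
apply: measurableT_comp => //.
apply: (@measurable_esum R {fset nat} _ NT (fun w x => ((fun w => (h w x)%:E)^\- w)%E)).
  by move=> w x; exact: funeneg_ge0.
move=> w; have mhw : measurable_fun setT (fun x => (h w x)%:E).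
  exact/measurable_EFinP.
rewrite (_ : (fun x => _) = ((fun x => (h w x)%:E)^\-)%E).
  exact: measurable_funeneg.
by apply/funext => x; rewrite !funenegE.
Qed.

Lemma ext0_measurable f : rk_space HK f -> measurable_fun setT (ext0 f).
Proof.
apply: rk_measurable => y.
have -> : (fun z => oapp (fun x : XX => Kker x y) 0 (insub z)) =
    fun z => asum (g z (val y)) * \1_(XX : set NT) z.
  apply/funext => z; rewrite indicE; case: (boolP (z \in (XX : set NT))) => Xz.
    by rewrite mulr1 -(ext0_kerE _ (set_mem Xz)).
  rewrite mulr0 -/(ext0 (fun x => Kker x y) z) ext0N// => /mem_set Xz'.
  by rewrite Xz' in Xz.
apply: measurable_funM; last first.
  by apply: measurable_indic; exact: Xdom_measurable.
apply: asum_measurable => w; apply: measurable_funM => //; exact: kpl_measurable.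
Qed.

Lemma ext0_sq_le f x : rk_space HK f ->
  (((ext0 f x) ^+ 2)%:E <= (rk_dot HK f f)%:E * diagE x)%E.
Proof.
move=> Hf; have d0 := rk_dot_ge0 Hf.
have [Xx|Xx] := pselect (XX x); last first.
  by rewrite ext0N// expr0n/= mule_ge0 ?lee_fin ?diagE_ge0.
pose y : XX := SigSub (mem_set Xx).
have -> : ext0 f x = f y by rewrite -(ext0E f y).
have -> : diagE x = (Kker y y)%:E.
  rewrite KkerE EFin_asum//; first by move=> w; exact: gkp_ge0.
  exact: (XdomE k_diag gamma_ge0 x).1 Xx.
by rewrite -EFinM lee_fin; exact: rk_diag.
Qed.

(** Since sqrt r <= 1 + r, the square root of K(x, x) is traded for a quantity whose integral is
    known. *)
Lemma ext0_abs_le f x : rk_space HK f ->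
  (`|ext0 f x|%:E <= (rk_norm HK f)%:E * (1 + diagE x))%E.
Proof.
move=> Hf; have := ext0_sq_le x Hf; rewrite -(rk_norm_sqr Hf).
have n0 : 0 <= rk_norm HK f by exact: sqrtr_ge0.
have := diagE_ge0 x; case: (diagE x) => [r r0| _ h|//].
  rewrite lee_fin in r0; rewrite -EFinD -!EFinM !lee_fin => h.
  rewrite -(@ler_pXn2r _ 2) ?nnegrE ?mulr_ge0//; last by lra.
  rewrite real_normK ?num_real// exprMn; apply: (le_trans h).
  by rewrite ler_wpM2l ?sqr_ge0//; nra.
(* Here K(x, x) = +oo. If |f| = 0, the right-hand side is 0 * +oo = 0, and f vanishes at x by the
   bound on its square. *)
have [nn0|nn] := eqVneq (rk_norm HK f) 0.
  move: h; rewrite nn0 expr0n/= !mul0e !lee_fin => h.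
  by rewrite normr_le0 -sqrf_eq0 eq_le h sqr_ge0.
by rewrite addey// gt0_muley ?leey// lte_fin lt_def nn.
Qed.

(** By [integral_kp_mix] the sum of these terms is the mean of K(z, z) over the points z =
    [mixp a V x]. *)
Definition mixSum (V : pred nat) := rsummable (fun w => gamma w * \prod_(j <- w) mixc k M V j).

Definition mixE (V : pred nat) f : R := Rintegral mu setT (fun x => ext0 f (mixp a V x)).

Let prodmix_ge0 V w : 0 <= gamma w * \prod_(j <- w) mixc k M V j.
Proof. by rewrite mulr_ge0// prodr_ge0// => j _; apply: mixc_ge0 M_def V j. Qed.

Let mkd V w : measurable_fun setT (fun x : NT => kp k w (mixp a V x) (mixp a V x)).
Proof.
exact: (measurableT_comp (kpd_measurable k_meas w) (@mixp_measurable R D a V)).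
Qed.

Lemma integral_diagE V : mixSum V -> (\int[mu]_x diagE (mixp a V x) =
  (asum (fun w => gamma w * \prod_(j <- w) mixc k M V j))%:E)%E.
Proof.
move=> sV; rewrite (EFin_asum (prodmix_ge0 V) sV).
rewrite /diagE (@integral_esum R {fset nat} _ NT (fun w x => (g (mixp a V x) (mixp a V x) w)%:E)).
- apply: eq_esum => w _; rewrite EFinM -(integral_kp_mix k_meas k_diag mu_prod M_def V w).
  rewrite -ge0_integralZl_EFin//; last 2 first.
  + by move=> x _; rewrite lee_fin kp_diag_ge0.
  + apply/measurable_EFinP; exact: mkd.
- by move=> w x; rewrite lee_fin gkp_ge0.
- move=> w; apply/measurable_EFinP; apply: measurable_funM => //.
Qed.

Let mdiag V : measurable_fun setT (fun x : NT => diagE (mixp a V x)).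
Proof. exact: (measurableT_comp diagE_measurable (@mixp_measurable R D a V)). Qed.

Lemma integrable_diagE V : mixSum V ->
  mu.-integrable setT (fun x => diagE (mixp a V x)).
Proof.
move=> sV; apply/integrableP; split; first exact: mdiag.
under eq_integral => x _ do rewrite gee0_abs ?diagE_ge0//.
by rewrite integral_diagE// ltry.
Qed.

Lemma ae_Xdom V : mixSum V -> {ae mu, forall x, XX (mixp a V x)}.
Proof.
move=> /integrable_diagE /(integrable_ae measurableT); apply: filterS => x.
by move=> /(_ Logic.I); rewrite fin_numElt => /andP[_]; exact: (XdomP _).2.
Qed.

Let mfx V f : rk_space HK f -> measurable_fun setT (fun x : NT => ext0 f (mixp a V x)).
Proof. by move=> Hf; exact: (measurableT_comp (ext0_measurable Hf) (@mixp_measurable R D a V)). Qed.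

Lemma mixE_sq V f : mixSum V -> rk_space HK f ->
  (\int[mu]_x ((ext0 f (mixp a V x)) ^+ 2)%:E < +oo)%E.
Proof.
move=> sV Hf; apply: (@le_lt_trans _ _ (\int[mu]_x ((rk_dot HK f f)%:E * diagE (mixp a V x)))%E).
  apply: ge0_le_integral => //.
  - by move=> x _; rewrite lee_fin sqr_ge0.
  - by apply/measurable_EFinP; apply: measurable_funX; exact: mfx.
  - by apply: measurable_funeM; exact: mdiag.
  - by move=> x _; exact: ext0_sq_le.
rewrite ge0_integralZl_EFin//; [|by move=> x _; exact: diagE_ge0|exact: rk_dot_ge0].
by rewrite integral_diagE// -EFinM ltry.
Qed.

Lemma mixE_bound V : mixSum V -> exists2 C : R, 0 <= C & forall f, rk_space HK f ->
  mu.-integrable setT (fun x => (ext0 f (mixp a V x))%:E) /\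
  `|mixE V f| <= C * rk_norm HK f.
Proof.
move=> sV; pose S := asum (fun w => gamma w * \prod_(j <- w) mixc k M V j).
have S0 : 0 <= S by exact: asum_ge0.
exists (1 + S) => [|f Hf]; first by lra.
have n0 : 0 <= rk_norm HK f by exact: sqrtr_ge0.
have i1 : mu.-integrable setT (fun x => 1 + diagE (mixp a V x))%E.
  apply: integrableD => //; last exact: integrable_diagE.
  exact: finite_measure_integrable_cst.
have i2 := integrableZl measurableT (rk_norm HK f) i1.
have int1 : mu.-integrable setT (fun x => (ext0 f (mixp a V x))%:E).
  apply: le_integrable i2 => //; first by apply/measurable_EFinP; exact: mfx.
  move=> x _; rewrite [leLHS]/= [leRHS]gee0_abs; first exact: ext0_abs_le.
  by rewrite mule_ge0 ?lee_fin// adde_ge0// diagE_ge0.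
split => //; apply: le_trans (le_normr_Rintegral measurableT int1) _.
rewrite mulrC -lee_fin /Rintegral fineK; last first.
  by apply: integrable_fin_num => //; exact: (integrable_abse int1).
have -> : ((rk_norm HK f * (1 + S))%:E =
    \int[mu]_x ((rk_norm HK f)%:E * (1 + diagE (mixp a V x))))%E.
  rewrite (integralZl measurableT i1) integralD//; last 2 first.
  - exact: finite_measure_integrable_cst.
  - exact: integrable_diagE.
  by rewrite (integral_prob_cst mu 1) integral_diagE// EFinM EFinD.
apply: ge0_le_integral => //.
- by apply/measurable_EFinP; apply: measurableT_comp => //; exact: mfx.
- by case/integrableP : i2.
- by move=> x _; exact: ext0_abs_le.
Qed.

Lemma mixE_lin V b f h : mixSum V -> rk_space HK f -> rk_space HK h ->
  mixE V (fun x => b * f x + h x) = b * mixE V f + mixE V h.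
Proof.
move=> /mixE_bound[C _ CP] Hf Hh.
have [intf _] := CP _ Hf; have [inth _] := CP _ Hh.
rewrite /mixE -RintegralZl// -RintegralD//; last exact: (integrableZl measurableT b intf).
congr Rintegral; apply/funext => x; rewrite /ext0.
by case: insub => //=; rewrite mulr0 addr0.
Qed.

(** Termwise integration of the kernel series: the w disjoint from V survive, each with the value of
    its term at the anchor. The majorant c comes from 2 |k_w(x, y)| <= k_w(x, x) + k_w(y, y). *)
Lemma mixE_ker V (y : XX) : mixSum V ->
  mixE V (fun x => Kker x y) =
  asum (fun w => gamma w * ((all (predC V) w)%:R * kp k w (anchor a) (val y))).
Proof.
move=> sV.
pose h w (x : NT) := g (mixp a V x) (val y) w.
pose c w := 2^-1 * (gamma w * \prod_(j <- w) mixc k M V j) + 2^-1 * g (val y) (val y) w.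
have mkp w : measurable_fun setT (fun x : NT => kp k w (mixp a V x) (val y)).
  exact: (measurableT_comp (kpl_measurable k_meas w (val y)) (@mixp_measurable R D a V)).
have mh w : measurable_fun setT (h w) by apply: measurable_funM.
have mG := mfx V (rk_ker HK y).
have hc w : (\int[mu]_x `|h w x|%:E <= (c w)%:E)%E.
  pose b w := 2^-1 * gamma w.
  have b0 : 0 <= b w by rewrite /b mulr_ge0.
  have g0 : 0 <= 2^-1 * g (val y) (val y) w by rewrite mulr_ge0 ?gkp_ge0.
  have -> : ((c w)%:E = \int[mu]_x ((b w)%:E * (kp k w (mixp a V x) (mixp a V x))%:E +
      (2^-1 * g (val y) (val y) w)%:E))%E.
    rewrite ge0_integralD//; last 2 first.
    - by move=> x _; rewrite lee_fin mulr_ge0// kp_diag_ge0.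
    - by apply: measurable_funeM; apply/measurable_EFinP; exact: mkd.
    rewrite (integral_prob_cst mu) ge0_integralZl_EFin//; last 2 first.
    - by move=> x _; rewrite lee_fin kp_diag_ge0.
    - by apply/measurable_EFinP; exact: mkd.
    by rewrite (integral_kp_mix k_meas k_diag mu_prod M_def V w) -EFinM -EFinD /c /b mulrA.
  apply: ge0_le_integral => //.
  - by apply/measurable_EFinP; apply: measurableT_comp => //; exact: mh.
  - apply: emeasurable_funD => //; apply: measurable_funeM.
    by apply/measurable_EFinP; exact: mkd.
  - move=> x _; rewrite -EFinM -EFinD lee_fin /h /gkp normrM ger0_norm// /b.
    have := ler_wpM2l (gamma_ge0 w) (kp_le_diag kprod_rk w (mixp a V x) (val y)).
    by move/le_trans; apply; lra.
have sc : rsummable c.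
  by apply: rsummableD; apply: rsummableZ => //;
    exact: (XdomE k_diag gamma_ge0 (val y)).1 (set_mem (valP y)).
have ae : {ae mu, forall x, ext0 (fun x => Kker x y) (mixp a V x) = asum (h ^~ x)}.
  by apply: (ae_imp _ (ae_Xdom sV)) => x Xx; rewrite ext0_kerE.
have [_ intE] := integral_asum mh hc sc mG ae.
rewrite /mixE intE; congr asum; apply/funext => w; rewrite /h /gkp RintegralZl//; last first.
  exact: (integrable_kp_mix k_meas k_diag mu_prod M_def kprod_rk V w (val y)).
rewrite /Rintegral (integral_kp_mix_l k_meas k_diag mu_prod M_def k_int0 k_rk kprod_rk)//.
Qed.

End mixed_integrals.

(** * Bias *)

Section bias.
Variables (R : realType) (D : set R) (a : D).
Local Notation T := (dom a).
Variable k : T -> T -> R.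
Hypothesis k_meas : measurable_fun setT (fun z : T * T => k z.1 z.2).
Hypothesis k_diag : forall x : T, 0 < k x x.
Local Notation NT := (prodspace nat T).
Variables (rho : probability T R) (mu : probability NT R).
Hypothesis mu_prod : is_prod_measure rho mu.
Variable M : R.
Hypothesis M_def : (\int[rho]_x (k x x)%:E = M%:E)%E.
Hypothesis k_int0 : forall y, (\int[rho]_x (k x y)%:E = 0)%E.
Hypothesis k_rk : rkhs k.
Hypothesis kprod_rk : forall u, rkhs (@kprod R D a k u).
Variable gamma : {fset nat} -> R.
Hypothesis gamma_ge0 : forall u, 0 <= gamma u.
Variable HK : rkhs (@Kker R D a k gamma).
Local Notation XX := (Xdom k gamma).
Local Notation mixE := (mixE (k := k) (gamma := gamma) mu).
Local Notation mixSum := (mixSum k M gamma).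
Local Notation dot := (rk_dot HK).
Local Notation V := (rk_space HK).

Variables (J : Type) (s : seq J) (c : J -> R) (W : J -> pred nat).
Hypothesis WS : forall j, mixSum (W j).

(* On kernel sections ell is diagonal in the expansion of K, with multipliers
   ellw: ell (K(., y)) = sum_w gamma_w ellw(w) k_w(a, y); this bounds its norm
   by sum_w ellw(w)^2 gamma_w k(a, a)^|w|. *)
Definition ell f : R := \sum_(j <- s) c j * mixE (W j) f.
Definition ellw (w : {fset nat}) : R := \sum_(j <- s) c j * (all (predC (W j)) w)%:R.

Lemma ell_lin b f h : V f -> V h ->
  ell (fun x => b * f x + h x) = b * ell f + ell h.
Proof.
move=> Vf Vh; rewrite /ell mulr_sumr -big_split/=; apply: eq_bigr => j _.
rewrite (mixE_lin k_meas k_diag mu_prod M_def gamma_ge0 _ (WS j) Vf Vh); ring.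
Qed.

(** A qualitative bound, used to pass from the span of the kernel sections to all of H(K). The
    constant that matters is the one in [ell_span_le]. *)
Lemma ell_cont : exists2 C : R, 0 <= C & forall f, V f -> `|ell f| <= C * rk_norm HK f.
Proof.
rewrite /ell; elim: s => [|j t [C C0 CP]].
  by exists 0 => // f _; rewrite big_nil normr0 mul0r.
have [C' C'0 C'P] := mixE_bound k_meas k_diag mu_prod M_def gamma_ge0 HK (WS j).
exists (`|c j| * C' + C) => [|f Vf]; first by rewrite addr_ge0// mulr_ge0.
rewrite big_cons; apply: le_trans (ler_normD _ _) _; rewrite mulrDl lerD ?CP//.
by rewrite normrM -mulrA ler_wpM2l// (C'P f Vf).2.
Qed.

Lemma kp_anchor_summable (y : XX) : XX (anchor a) ->
  rsummable (fun w => gamma w * kp k w (anchor a) (val y)).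
Proof.
move=> aX; exact: (gkp_summable k_diag kprod_rk gamma_ge0 aX (set_mem (valP y))).
Qed.

Hypothesis anchor_X : XX (anchor a).

Lemma ell_ker_summable (y : XX) :
  rsummable (fun w => gamma w * (ellw w * kp k w (anchor a) (val y))).
Proof.
have sy := kp_anchor_summable y anchor_X.
pose S := \sum_(j <- s) `|c j|.
apply: (@rsummable_le _ _ _ (fun w => S * `|gamma w * kp k w (anchor a) (val y)|)).
  move=> w; rewrite mulrCA normrM ler_wpM2r//.
  apply: le_trans (ler_norm_sum _ _ _) _; apply: ler_sum => j _.
  by rewrite normrM ler_piMr// normr_nat; case: all.
by apply: rsummableZ; exact: rsummable_norm.
Qed.

Lemma ell_ker (y : XX) : ell (fun x => Kker x y) =
  asum (fun w => gamma w * (ellw w * kp k w (anchor a) (val y))).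
Proof.
have sy := kp_anchor_summable y anchor_X.
have sj j : rsummable (fun w => gamma w *
    ((all (predC (W j)) w)%:R * kp k w (anchor a) (val y))).
  apply: (@rsummable_le _ _ _ (fun w => `|gamma w * kp k w (anchor a) (val y)|)).
    by move=> w; rewrite mulrCA normrM ler_piMl// normr_nat; case: all.
  exact: rsummable_norm.
transitivity (asum (fun w => \sum_(j <- s) c j * (gamma w *
    ((all (predC (W j)) w)%:R * kp k w (anchor a) (val y))))).
  rewrite asum_sum => [|j]; last exact: rsummableZ.
  apply: eq_bigr => j _; rewrite asumZ//; congr (_ * _).
  exact: (mixE_ker k_meas k_diag mu_prod M_def k_int0 k_rk kprod_rk gamma_ge0 HK).
congr asum; apply/funext => w; rewrite /ellw mulr_suml mulr_sumr.
by apply: eq_bigr => j _; ring.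
Qed.

Let bw w := ellw w ^+ 2 * (gamma w * k a a ^+ #|` w|%fset).
Hypothesis bS : rsummable bw.

Let bw0 w : 0 <= bw w.
Proof. by rewrite mulr_ge0 ?sqr_ge0// mulr_ge0// exprn_ge0// ltW. Qed.

(** Both ell h and |h|^2 are series over w, with terms gamma_w ellw(w) cw(w) and gamma_w q(w).
    Cauchy-Schwarz in H_w gives cw(w)^2 <= k(a, a)^|w| q(w), and its linear form is summed over
    w. *)
Lemma ell_span_le (t : seq (R * XX)) :
  ell (lincomb (fun y x => Kker x y) t) ^+ 2 <=
  asum bw * dot (lincomb (fun y x => Kker x y) t) (lincomb (fun y x => Kker x y) t).
Proof.
set h := lincomb _ t; have Vh : V h by apply: lincomb_rk; exact: rk_ker.
apply: young_sqr_le => [||r r0]; [exact: asum_ge0|exact: rk_dot_ge0|].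
pose q w := \sum_(p <- t) \sum_(p' <- t) p.1 * p'.1 * kp k w (val p.2) (val p'.2).
have sg (x y : XX) : rsummable (gkp k gamma (val x) (val y)).
  exact: (gkp_summable k_diag kprod_rk gamma_ge0 (set_mem (valP x)) (set_mem (valP y))).
have qE w : gamma w * q w =
    \sum_(p <- t) \sum_(p' <- t) p.1 * p'.1 * gkp k gamma (val p.2) (val p'.2) w.
  rewrite /q mulr_sumr; apply: eq_bigr => p _; rewrite mulr_sumr.
  by apply: eq_bigr => p' _; rewrite /gkp; ring.
have qS : rsummable (fun w => gamma w * q w).
  under eq_fun do rewrite qE.
  apply: rsummable_sum => p; apply: rsummable_sum => p'; exact: rsummableZ.
have -> : dot h h = asum (fun w => gamma w * q w).
  rewrite dot_lincomb2; last exact: rk_ker.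
  under [in RHS]eq_fun do rewrite qE.
  rewrite asum_sum => [|p]; last by apply: rsummable_sum => p'; exact: rsummableZ.
  apply: eq_bigr => p _; rewrite asum_sum => [|p']; last exact: rsummableZ.
  by apply: eq_bigr => p' _; rewrite asumZ// rk_dot_ker KkerE.
pose cw w := \sum_(p <- t) p.1 * kp k w (anchor a) (val p.2).
have cE w : gamma w * (ellw w * cw w) =
    \sum_(p <- t) p.1 * (gamma w * (ellw w * kp k w (anchor a) (val p.2))).
  rewrite /cw !mulr_sumr; apply: eq_bigr => p _; ring.
have cS : rsummable (fun w => gamma w * (ellw w * cw w)).
  under eq_fun do rewrite cE.
  by apply: rsummable_sum => p; apply: rsummableZ; exact: ell_ker_summable.
have ellE : ell h = asum (fun w => gamma w * (ellw w * cw w)).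
  under [in RHS]eq_fun do rewrite cE.
  rewrite asum_sum => [|p]; last by apply: rsummableZ; exact: ell_ker_summable.
  rewrite /h; elim: (t) => [|p t' IH].
    have -> : lincomb (fun y x : XX => Kker x y) [::] = fun=> 0.
      by apply/funext => x; rewrite /lincomb big_nil.
    have := ell_lin (-1) (rk_0 HK) (rk_0 HK).
    have -> : (fun _ : XX => -1 * (0 : R) + 0) = (fun=> 0).
      by apply/funext => x; rewrite addr0 mulr0.
    by rewrite big_nil; move: (ell _) => z; lra.
  rewrite lincomb_cons ell_lin; last 2 first.
  - exact: rk_ker.
  - by apply: lincomb_rk; exact: rk_ker.
  by rewrite IH big_cons ell_ker asumZ//; exact: ell_ker_summable.
have cq w : cw w ^+ 2 <= k a a ^+ #|` w|%fset * q w.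
  have := gram_CS (kprod_rk w) [seq (p.1, restr w (val p.2)) | p <- t] (restr w (anchor a)).
  rewrite !big_map/= kprod_restr kp_anchor /cw /q.
  under eq_bigr do rewrite kprod_restr.
  congr (_ <= _ * _); apply: eq_bigr => p _; rewrite big_map.
  by apply: eq_bigr => p' _ /=; rewrite kprod_restr.
have q0 w : 0 <= q w.
  have := gram_ge0 (kprod_rk w) [seq (p.1, restr w (val p.2)) | p <- t].
  rewrite !big_map /q; congr (_ <= _); apply: eq_bigr => p _; rewrite big_map.
  by apply: eq_bigr => p' _ /=; rewrite kprod_restr.
have nS : rsummable (fun w => `|gamma w * (ellw w * cw w)|).
  exact: rsummable_norm.
rewrite ellE; apply: (@le_trans _ _ (asum (fun w => 2 * `|gamma w * (ellw w * cw w)|))).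
  by rewrite asumZ// ler_wpM2l// ler_norm_asum.
rewrite -!asumZ// -asumD; try exact: rsummableZ.
apply: le_asum; first exact: rsummableZ.
  by apply: rsummableD; exact: rsummableZ.
move=> w; rewrite normrM ger0_norm// /bw.
have -> : 2 * (gamma w * `|ellw w * cw w|) = gamma w * (2 * `|ellw w * cw w|) by ring.
have -> : r * (ellw w ^+ 2 * (gamma w * k a a ^+ #|` w|%fset)) + r^-1 * (gamma w * q w) =
   gamma w * (r * (ellw w ^+ 2 * k a a ^+ #|` w|%fset) + r^-1 * q w) by ring.
apply: ler_wpM2l => //; apply: young_of_sqr => //.
  by rewrite mulr_ge0 ?sqr_ge0// exprn_ge0// ltW.
by rewrite exprMn -mulrA ler_wpM2l ?sqr_ge0.
Qed.

Lemma ell_le f : V f -> ell f ^+ 2 <= asum bw * dot f f.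
Proof.
move=> Vf; have [C C0 CP] := ell_cont.
pose B := Num.sqrt (asum bw).
have B0 : 0 <= B by exact: sqrtr_ge0.
have BE : B ^+ 2 = asum bw by rewrite sqr_sqrtr// asum_ge0.
have n0 h : 0 <= rk_norm HK h by exact: sqrtr_ge0.
suff : `|ell f| <= B * rk_norm HK f.
  move=> h; rewrite -BE -(rk_norm_sqr Vf) -exprMn -[ell f ^+ 2]real_normK ?num_real//.
  by rewrite ler_pXn2r ?nnegrE ?mulr_ge0.
apply/ler_addgt0Pr => e e0.
(* An h with |h - f| <= e1 costs at most C e1 for the difference and B e1 for the larger norm,
   together less than e. *)
pose e1 := e / (2 * B + C + 1).
have c0 : 0 < 2 * B + C + 1 by lra.
have e10 : 0 < e1 by rewrite divr_gt0.
have [t tP] := rk_dense Vf (exprn_gt0 2 e10).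
move: tP; set h := lincomb _ t => tP.
have Vh : V h by apply: lincomb_rk; exact: rk_ker.
have Vhf : V (fun x => h x - f x) by exact: rk_sub.
have d1 : rk_norm HK (fun x => h x - f x) <= e1.
  by rewrite -(@ler_pXn2r _ 2) ?nnegrE ?(ltW e10)// rk_norm_sqr// ltW.
have hB : `|ell h| <= B * rk_norm HK h.
  rewrite -(@ler_pXn2r _ 2) ?nnegrE ?mulr_ge0// real_normK ?num_real// exprMn BE.
  by rewrite rk_norm_sqr//; exact: ell_span_le.
have fE : f = (fun x => (-1) * (h x - f x) + h x) by apply/funext => x; ring.
have nh : rk_norm HK h <= rk_norm HK f + e1.
  by apply: le_trans (rk_norm_le_add Vf Vh) _; rewrite lerD2l.
have -> : ell f = - ell (fun x => h x - f x) + ell h.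
  by rewrite {1}fE ell_lin// mulN1r.
apply: le_trans (ler_normD _ _) _; rewrite normrN.
have h1 := CP _ Vhf.
have h2 : C * rk_norm HK (fun x => h x - f x) <= C * e1 by rewrite ler_wpM2l.
have h3 : B * rk_norm HK h <= B * (rk_norm HK f + e1) by rewrite ler_wpM2l.
have h4 : e1 * (2 * B + C + 1) = e by rewrite /e1 divfK// gt_eqF.
nra.
Qed.

End bias.

Section anova_bias.
Variables (R : realType) (D : set R) (a : D).
Local Notation T := (dom a).
Variable k : T -> T -> R.
Hypothesis k_meas : measurable_fun setT (fun z : T * T => k z.1 z.2).
Hypothesis k_diag : forall x : T, 0 < k x x.
Local Notation NT := (prodspace nat T).
Variables (rho : probability T R) (mu : probability NT R).
Hypothesis mu_prod : is_prod_measure rho mu.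
Variable M : R.
Hypothesis M_def : (\int[rho]_x (k x x)%:E = M%:E)%E.
Hypothesis k_int0 : forall y, (\int[rho]_x (k x y)%:E = 0)%E.
Hypothesis k_rk : rkhs k.
Hypothesis kprod_rk : forall u, rkhs (@kprod R D a k u).
Variable gamma : {fset nat} -> R.
Hypothesis gamma_ge0 : forall u, 0 <= gamma u.
Hypothesis gamma_sum :
  (\esum_(u in [set: {fset nat}]) (gamma u * M ^+ #|` u|%fset)%:E < +oo)%E.
Hypothesis a_anchor :
  (\esum_(u in [set: {fset nat}]) (gamma u * k a a ^+ #|` u|%fset)%:E < +oo)%E.
Variable HK : rkhs (@Kker R D a k gamma).
Local Notation XX := (Xdom k gamma).
Local Notation mixE := (mixE (k := k) (gamma := gamma) mu).

Lemma mixSumT : mixSum k M gamma predT.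
Proof.
rewrite /mixSum; under eq_fun do rewrite /mixc big_const_seq count_predT iter_mulr_1.
apply/ge0_rsummable => // w.
by rewrite mulr_ge0// exprn_ge0//; exact: (M_ge0 k_diag M_def).
Qed.

Lemma mixSum_fset (v : {fset nat}) : mixSum k M gamma (mem v).
Proof.
apply: (rsummable_prod k_diag gamma_ge0 a_anchor (v := v)) => j.
  exact: (mixc_ge0 k_diag M_def).
by move=> jv; rewrite /mixc/= (negbTE jv).
Qed.

Lemma anchor_X : XX (anchor a).
Proof.
have := Xdom_mix k_diag gamma_ge0 a_anchor fset0 (anchor a).
congr (XX _); apply/funext => j; by rewrite /mixp /anchor; case: ifP.
Qed.

Lemma mixE_Int f : mixE predT f = Int mu f.
Proof.
rewrite /Int /Rintegral integral_mkcond; congr fine; apply: eq_integral => x _.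
rewrite patchE; case: ifPn => [Xx|Xx]; first by [].
rewrite (_ : mixp a predT x = x)// ext0N// => /mem_set Xx'.
by rewrite Xx' in Xx.
Qed.

Variable Q : {fset {fset nat}}.
Hypothesis Q0 : fset0 \in Q.
Hypothesis Qdown : forall u v, u \in Q -> (v `<=` u)%fset -> v \in Q.

Definition cda_mean f : R :=
  \sum_(u <- Q) \sum_(v <- fpowerset u) sgn R u v * mixE (mem v) f.

(** I - [cda_mean] as an instance of [ell]: [None] stands for I, with all coordinates integrated,
    and [Some (u, v)] for the summand of [cda_mean] at u and v, with the opposite sign. *)
Let J := option ({fset nat} * {fset nat}).
Let s : seq J := None :: [seq Some (u, v) | u <- Q, v <- fpowerset u].
Let c (j : J) : R := if j is Some p then - sgn R p.1 p.2 else 1.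
Let W (j : J) : pred nat := if j is Some p then mem p.2 else predT.

Let WS j : mixSum k M gamma (W j).
Proof. by case: j => [p|]; [exact: mixSum_fset|exact: mixSumT]. Qed.

Let ellE f : ell mu s c W f = Int mu f - cda_mean f.
Proof.
rewrite /ell /s big_cons/= mul1r mixE_Int big_allpairs_dep/=; congr (_ + _).
rewrite /cda_mean -sumrN; apply: eq_bigr => u _; rewrite -sumrN.
by apply: eq_bigr => v _; rewrite mulNr.
Qed.

(** By [sum_sgn_disjoint] each u in Q contributes a sign if it is contained in w and nothing
    otherwise. The integral I contributes at w = fset0 alone. *)
Let ellwE w : ellw s c W w = (w == fset0)%:R -
  \sum_(u <- Q | (u `<=` w)%fset) (-1) ^+ #|` u|%fset.
Proof.
rewrite /ellw /s big_cons/= mul1r big_allpairs_dep/=; congr (_%:R + _).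
  congr nat_of_bool; case: (fset_0Vmem w) => [->|[j jw]]; first by rewrite eqxx.
  have -> : (w == fset0) = false.
    by apply/negbTE/fset0Pn; exists j.
  by apply/negbTE/allPn; exists j.
rewrite [in RHS]big_mkcond/= -sumrN; apply: eq_bigr => u _.
under eq_bigr do rewrite mulNr; rewrite sumrN; congr (- _).
transitivity (\sum_(v <- fpowerset u) sgn R u v * [disjoint w & v]%fset%:R).
  apply: eq_bigr => v _; congr (_ * _%:R); congr nat_of_bool.
  apply/allP/fdisjointP => h j jw; first exact: h.
  exact: (h j jw).
by rewrite sum_sgn_disjoint; case: (u `<=` w)%fset; rewrite ?mulr1 ?mulr0.
Qed.

Let ellw_in w : w \in Q -> ellw s c W w = 0.
Proof.
move=> wQ; rewrite ellwE big_fset_condE.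
have -> : [fset u in Q | (u `<=` w)%fset]%fset = fpowerset w.
  apply/fsetP => u; rewrite !inE fpowersetE andb_idl// => uw.
  exact: Qdown uw.
by rewrite sum_sgn_card subrr.
Qed.

(** At most 2^|w| signs are added, one for each subset of w in Q; the term for w = fset0 is absent
    because fset0 lies in Q. *)
Let ellw_out w : w \notin Q -> ellw s c W w ^+ 2 <= 4 ^+ #|` w|%fset.
Proof.
move=> wQ; rewrite ellwE.
have -> : (w == fset0) = false by apply: contraNF wQ => /eqP ->.
rewrite sub0r sqrrN -real_normK ?num_real//.
have -> : (4 : R) ^+ #|` w|%fset = (2 ^+ #|` w|%fset) ^+ 2.
  by rewrite -exprM mulnC exprM; congr (_ ^+ _); rewrite -natrX.
rewrite ler_pXn2r ?nnegrE ?exprn_ge0//.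
apply: le_trans (ler_norm_sum _ _ _) _.
rewrite big_fset_condE; under eq_bigr do rewrite normrX normrN1 expr1n.
rewrite big_const_seq count_predT iter_addr_0 -natrX ler_nat -card_fpowerset.
apply: fsubset_leq_card; apply/fsubsetP => u.
by rewrite !inE fpowersetE => /andP[].
Qed.

Lemma bias_le (b : {fset nat} -> R) : rsummable b -> (forall w, 0 <= b w) ->
  (forall w, w \notin Q -> 4 ^+ #|` w|%fset * (gamma w * k a a ^+ #|` w|%fset) <= b w) ->
  forall f, rk_space HK f ->
  (Int mu f - cda_mean f) ^+ 2 <= asum b * rk_dot HK f f.
Proof.
move=> sb b0 bP f Vf; rewrite -ellE.
have gk0 w : 0 <= gamma w * k a a ^+ #|` w|%fset by rewrite mulr_ge0// exprn_ge0// ltW.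
have le w : ellw s c W w ^+ 2 * (gamma w * k a a ^+ #|` w|%fset) <= b w.
  have [/ellw_in ->|wQ] := boolP (w \in Q); first by rewrite expr0n mul0r.
  by apply: le_trans (bP _ wQ); rewrite ler_wpM2r// ellw_out.
have S : rsummable (fun w => ellw s c W w ^+ 2 * (gamma w * k a a ^+ #|` w|%fset)).
  by apply: rsummable_le sb => w; rewrite ger0_norm// mulr_ge0// sqr_ge0.
apply: (le_trans (ell_le k_meas k_diag mu_prod M_def k_int0 k_rk kprod_rk gamma_ge0
  WS anchor_X S Vf)).
by rewrite ler_wpM2r ?rk_dot_ge0//; exact: le_asum.
Qed.

End anova_bias.

(** * Anchored components *)

Section anchored_components.
Variables (R : realType) (D : set R) (a : D).
Local Notation T := (dom a).
Variable k : T -> T -> R.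
Hypothesis k_diag : forall x : T, 0 < k x x.
Hypothesis kprod_rk : forall u, rkhs (@kprod R D a k u).
Variable gamma : {fset nat} -> R.
Hypothesis gamma_ge0 : forall u, 0 <= gamma u.
Hypothesis a_anchor :
  (\esum_(u in [set: {fset nat}]) (gamma u * k a a ^+ #|` u|%fset)%:E < +oo)%E.
Variable HK : rkhs (@Kker R D a k gamma).
Local Notation XX := (Xdom k gamma).

Definition mixX (v : {fset nat}) (x : nat -> T) : XX :=
  SigSub (mem_set (Xdom_mix k_diag gamma_ge0 a_anchor v x)).

Lemma ext0_mix (f : XX -> R) v x : ext0 f (mixp a (mem v) x) = f (mixX v x).
Proof. exact: (ext0E f (mixX v x)). Qed.

(* f_{u,a}; when v is contained in u, the point (y_v, a) is [mixp a (mem v) (ext a y)]. *)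
Definition component (f : XX -> R) (u : {fset nat}) (y : u -> T) : R :=
  \sum_(v <- fpowerset u) sgn R u v * ext0 f (mixp a (mem v) (ext a y)).
Arguments component f u y : clear implicits.

(** The terms of [rsq u] indexed by the union w of u and u', and extended by 0 to all w; [rsqE] is
    this change of index. *)
Definition rsum (u w : {fset nat}) : R :=
  (u `<=` w)%fset%:R * (gamma w * k a a ^+ #|` w `\` u|%fset).

Lemma rsum_ge0 u w : 0 <= rsum u w.
Proof. by rewrite !mulr_ge0// exprn_ge0// ltW. Qed.

Lemma rsqE u : rsq k gamma u = (\esum_(w in setT) (rsum u w)%:E)%E.
Proof.
transitivity (\esum_(w in [set w | (u `<=` w)%fset])
    (gamma w * k a a ^+ #|` w `\` u|%fset)%:E)%E; last first.
  rewrite esum_mkcond; apply: eq_esum => w _; rewrite /rsum.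
  have -> : (w \in [set w0 : {fset nat} | (u `<=` w0)%fset]) = (u `<=` w)%fset.
    by apply/idP/idP => [/set_mem//|uw]; exact/mem_set.
  by case: (u `<=` w)%fset; rewrite ?mul1r ?mul0r.
rewrite (@reindex_esum _ _ _ [set u' : {fset nat} | [disjoint u & u']%fset] _
   (fun u' => u `|` u')%fset); last first.
  split.
  - by move=> u' _ /=; exact: fsubsetUl.
  - move=> v w; rewrite !inE /= => uv uw /(congr1 (fun z => z `\` u)%fset).
    by rewrite !fsetDUl !fsetDv !fset0U !(fsetDidPl _ _ _)// fdisjoint_sym.
  - move=> w /= uw; exists (w `\` u)%fset; last by rewrite fsetUDl fsetDv fsetD0; exact/fsetUidPr.
    by apply/fdisjointP => j ju; rewrite inE ju.
apply: eq_esum => u' /= uu'; congr (_ * _ ^+ _)%:E.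
by rewrite fsetDUl fsetDv fset0U (fsetDidPl _ _ _)// fdisjoint_sym.
Qed.

Variable f : XX -> R.
Hypothesis Vf : rk_space HK f.
Variable u : {fset nat}.
Hypothesis rsum_summable : rsummable (rsum u).
Local Notation r := (asum (rsum u)).
Local Notation Hu := (kprod_rk u).

Let kerK := fun (y : XX) (x : XX) => Kker x y.
Let kerU := fun (y x : u -> T) => kprod k x y.

(** [Psi y] represents the functional sending f to f_{u,a}(y) on H(K); [Phi y] is the corresponding
    alternating sum of kernel sections in H_u. *)
Let lPsi (y : u -> T) : seq (R * XX) :=
  [seq (sgn R u v, mixX v (ext a y)) | v <- fpowerset u].
Let lPhi (y : u -> T) : seq (R * (u -> T)) :=
  [seq (sgn R u v, restr u (mixp a (mem v) (ext a y))) | v <- fpowerset u].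
Let Psi y := lincomb kerK (lPsi y).
Let Phi y := lincomb kerU (lPhi y).
Let VPsi y : rk_space HK (Psi y). Proof. by apply: lincomb_rk; exact: rk_ker. Qed.
Let VPhi y : rk_space Hu (Phi y). Proof. by apply: lincomb_rk; exact: rk_ker. Qed.

Let dot_lincomb (X : Type) (L : X -> X -> R) (H : rkhs L) (s t : seq (R * X)) :
  rk_dot H (lincomb (fun y x => L x y) s) (lincomb (fun y x => L x y) t) =
  \sum_(p <- s) \sum_(q <- t) p.1 * q.1 * L p.2 q.2.
Proof.
rewrite dot_lincombl; last 2 first.
- exact: rk_ker.
- by apply: lincomb_rk; exact: rk_ker.
apply: eq_bigr => p _; rewrite dot_lincombr; last 2 first.
- exact: rk_ker.
- exact: rk_ker.
by rewrite mulr_sumr; apply: eq_bigr => q _; rewrite rk_dot_ker mulrA.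
Qed.

Let dotPhi y y' : rk_dot Hu (Phi y) (Phi y') = altkp k u u (ext a y) (ext a y').
Proof.
rewrite dot_lincomb /lPhi big_map; apply: eq_bigr => v _.
by rewrite big_map; apply: eq_bigr => v' _; rewrite kprod_restr.
Qed.

(** Alternating in both arguments of k_w leaves, by [altkpE], the expression for k_u times k(a,
    a)^|w \ u| if u is contained in w, and 0 otherwise. Weighted by gamma_w these factors add up to
    r. *)
Let dotPsi y y' : rk_dot HK (Psi y) (Psi y') = r * rk_dot Hu (Phi y) (Phi y').
Proof.
have sg (p q : XX) : rsummable (gkp k gamma (val p) (val q)).
  exact: (gkp_summable k_diag kprod_rk gamma_ge0 (set_mem (valP p)) (set_mem (valP q))).
rewrite dotPhi dot_lincomb [RHS]mulrC -asumZ//.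
transitivity (asum (fun w => \sum_(p <- lPsi y) \sum_(q <- lPsi y')
    p.1 * q.1 * gkp k gamma (val p.2) (val q.2) w)).
  rewrite asum_sum => [|p]; last by apply: rsummable_sum => q; exact: rsummableZ.
  apply: eq_bigr => p _; rewrite asum_sum => [|q]; last exact: rsummableZ.
  by apply: eq_bigr => q _; rewrite asumZ// KkerE.
congr asum; apply/funext => w.
transitivity (gamma w * altkp k u w (ext a y) (ext a y')); last first.
  by rewrite altkpE /rsum; ring.
rewrite /altkp /lPsi big_map mulr_sumr; apply: eq_bigr => v _.
rewrite big_map mulr_sumr; apply: eq_bigr => v' _.
by rewrite /gkp/=; ring.
Qed.

(** Because the two Gram matrices are proportional, sending Phi y to f_{u,a}(y) defines a functional
    on the span of the Phi y with squared norm at most r |f|^2. Its representer in H_u is F, and the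
    last clause is the reproducing property applied to Phi y. *)
Lemma component_riesz : exists F, [/\ rk_space Hu F,
  rk_dot Hu F F <= r * rk_dot HK f f &
  forall y : u -> T, component f u y = \sum_(v <- fpowerset u) sgn R u v *
     F (restr u (mixp a (mem v) (ext a y)))].
Proof.
have compE y : component f u y = rk_dot HK f (Psi y).
  rewrite /Psi dot_lincombr//; last exact: rk_ker.
  rewrite big_map; apply: eq_bigr => v _; rewrite ext0_mix/=.
  by rewrite {1}(rk_repr (mixX v (ext a y)) Vf).
have r0 : 0 <= r by apply: asum_ge0 => // w; exact: rsum_ge0.
have d0 := rk_dot_ge0 Vf.
have [||F [VF FA FE _]] := @riesz_span _ _ _ (kprod_rk u) _ Phi VPhi
  (component f u) (r * rk_dot HK f f).
- by rewrite mulr_ge0.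
- move=> s; under eq_bigr do rewrite compE.
  rewrite -dot_lincombr//; apply: (le_trans (rk_CS Vf (lincomb_rk VPsi s))).
  rewrite !dot_lincomb2// [leRHS]mulrAC mulrC ler_wpM2r//.
  rewrite mulr_sumr; apply: ler_sum => p _; rewrite mulr_sumr.
  by apply: ler_sum => q _; rewrite dotPsi mulrCA.
exists F; split => // y; rewrite -FE /Phi dot_lincombr//; last exact: rk_ker.
rewrite big_map; apply: eq_bigr => v _ /=.
by rewrite -(rk_repr _ VF).
Qed.

(** Freezing the coordinates outside of v at a multiplies the Gram matrix of k_v by k(a, a)^|u \ v|;
    [rk_mem_of_bound] reads this as membership together with a norm bound. *)
Lemma restr_rk F v : (v `<=` u)%fset -> rk_space Hu F ->
  let G := fun z : v -> T => F (restr u (ext a z)) in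
  rk_space (kprod_rk v) G /\
  rk_dot (kprod_rk v) G G <= k a a ^+ #|` u `\` v|%fset * rk_dot Hu F F.
Proof.
move=> vu VF G; apply: rk_mem_of_bound.
  by rewrite mulr_ge0 ?rk_dot_ge0// exprn_ge0// ltW.
move=> s.
have -> : \sum_(p <- s) p.1 * G p.2 =
    rk_dot Hu F (lincomb kerU [seq (p.1, restr u (ext a p.2)) | p <- s]).
  rewrite dot_lincombr//; last exact: rk_ker.
  by rewrite big_map; apply: eq_bigr => p _ /=; rewrite -rk_repr.
apply: le_trans (rk_CS VF _) _; first by apply: lincomb_rk; exact: rk_ker.
rewrite [k a a ^+ _ * _]mulrC -mulrA; apply: ler_wpM2l; first exact: rk_dot_ge0.
rewrite dot_lincomb big_map.
rewrite mulr_sumr; apply: ler_sum => p _; rewrite big_map mulr_sumr.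
apply: ler_sum => q _ /=; rewrite kprod_restr (kp_sub _ _ _ vu).
have -> : kprod k q.2 p.2 = kp k v (ext a p.2) (ext a q.2).
  by rewrite -(rk_sym (kprod_rk v)) -kprod_restr !restr_ext.
have -> : kp k (u `\` v)%fset (ext a p.2) (ext a q.2) = k a a ^+ #|` u `\` v|%fset.
  rewrite -kp_anchor; apply: eq_kp => i; rewrite inE => /andP[iv _];
    by rewrite /ext insubN.
by rewrite le_eqVlt; apply/orP; left; apply/eqP; ring.
Qed.

End anchored_components.

Arguments component {R D a k gamma} f u y.

(** * Variance *)

Section second_moments.
Context d (Z : measurableType d) (R : realType) (P : probability Z R).

(** Since |X| <= (X - m)^2 + 1 + |m|. A bound on [variance], whose center is [fine] of an integral
    not yet known to exist, thereby gives integrability. *)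
Lemma integrable_of_sqr (X : Z -> R) (m : R) : measurable_fun setT X ->
  (\int[P]_x ((X x - m) ^+ 2)%:E < +oo)%E -> P.-integrable setT (EFin \o X).
Proof.
move=> mX fin.
have mXm : measurable_fun setT (fun x => (X x - m) ^+ 2).
  by apply: measurable_funX; apply: measurable_funB.
have i1 : P.-integrable setT (fun x => ((X x - m) ^+ 2)%:E).
  apply/integrableP; split; first exact/measurable_EFinP.
  by under eq_integral => x _ do rewrite gee0_abs ?lee_fin ?sqr_ge0//.
have i2 : P.-integrable setT (fun=> (1 + `|m|)%:E).
  exact: finite_measure_integrable_cst.
have i3 := integrableD measurableT i1 i2.
apply: le_integrable i3 => //; first exact/measurable_EFinP.
move=> x _ /=; rewrite lee_fin; apply: le_trans (ler_norm _).
have -> : X x = (X x - m) + m by rewrite subrK.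
apply: le_trans (ler_normD _ _) _; rewrite addrK addrA lerD2r.
rewrite -[(X x - m) ^+ 2]real_normK ?num_real//.
by have := sqr_ge0 (`|X x - m| - 1); have := normr_ge0 (X x - m); nra.
Qed.

Lemma varianceE (X : Z -> R) :
  variance P X = (\int[P]_x ((X x - fine (\int[P]_x (X x)%:E)%E) ^+ 2)%:E)%E.
Proof.
rewrite /variance !unlock; apply: eq_integral => x _.
by rewrite expr2.
Qed.

Lemma sqr_sum_le (J : Type) (s : seq J) (x : J -> R) :
  (\sum_(j <- s) x j) ^+ 2 <= (size s)%:R * \sum_(j <- s) x j ^+ 2.
Proof.
elim: s => [|j s IH]; first by rewrite !big_nil expr0n mulr0.
rewrite !big_cons /=; set y := \sum_(_ <- s) x _; set q := \sum_(_ <- s) x _ ^+ 2.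
have q0 : 0 <= q by apply: sumr_ge0 => i _; rewrite sqr_ge0.
move: IH; rewrite -/y -/q -natr1; set n : R := (size s)%:R => IH.
have n0 : 0 <= n by exact: ler0n.
have [n1|n1] := eqVneq n 0.
  move: IH; rewrite n1 mul0r => y0.
  have -> : y = 0 by apply/eqP; rewrite -sqrf_eq0 eq_le y0 sqr_ge0.
  by rewrite addr0 add0r mul1r lerDl.
have np : 0 < n by rewrite lt_def n1.
have : 2 * (x j * y) <= n * x j ^+ 2 + n^-1 * y ^+ 2.
  have : 0 <= n^-1 * (n * x j - y) ^+ 2 by rewrite mulr_ge0 ?invr_ge0 ?sqr_ge0.
  have -> : n^-1 * (n * x j - y) ^+ 2 = n * x j ^+ 2 - 2 * (x j * y) + n^-1 * y ^+ 2.
    by field.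
  lra.
have : n^-1 * y ^+ 2 <= q by rewrite ler_pdivrMl.
move: (n^-1 * y ^+ 2) => z; nra.
Qed.

Lemma integral_lincomb (J : Type) (s : seq J) (c : J -> R) (h : J -> Z -> R) :
  (forall j, P.-integrable setT (EFin \o h j)) ->
  P.-integrable setT (EFin \o (fun x => \sum_(j <- s) c j * h j x)) /\
  fine (\int[P]_x (\sum_(j <- s) c j * h j x)%:E)%E =
  \sum_(j <- s) c j * fine (\int[P]_x (h j x)%:E)%E.
Proof.
move=> hi; elim: s => [|j t [IH1 IH2]].
  rewrite big_nil; split; last by under eq_integral do rewrite big_nil; rewrite integral0.
  by under eq_fun do rewrite big_nil; exact: finite_measure_integrable_cst.
have i1 := integrableZl measurableT (c j) (hi j).
split.
  rewrite (_ : _ \o _ = (fun x => (c j)%:E * (EFin \o h j) x) \+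
      (EFin \o (fun x => \sum_(j <- t) c j * h j x)%R))%E.
    exact: integrableD.
  by apply/funext => x; rewrite /= big_cons EFinD EFinM.
rewrite big_cons -IH2; under eq_integral do rewrite big_cons EFinD EFinM.
rewrite integralD// fineD; [|exact: integrable_fin_num|exact: integrable_fin_num].
by rewrite (integralZl measurableT (hi j)) fineM//; exact: integrable_fin_num.
Qed.

Lemma integral_sqr_lincomb_lty (J : Type) (s : seq J) (c : J -> R) (h : J -> Z -> R) :
  (forall j, measurable_fun setT (h j)) ->
  (forall j, \int[P]_x ((h j x) ^+ 2)%:E < +oo)%E ->
  (\int[P]_x ((\sum_(j <- s) c j * h j x) ^+ 2)%:E < +oo)%E.
Proof.
move=> mh hi.
have mq j : measurable_fun setT (fun x => (h j x) ^+ 2) by apply: measurable_funX.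
apply: (@le_lt_trans _ _ (\int[P]_x ((size s)%:R%:E *
    (\sum_(j <- s) ((c j ^+ 2)%:E * ((h j x) ^+ 2)%:E))))%E).
  apply: ge0_le_integral => //.
  - by move=> x _; rewrite lee_fin sqr_ge0.
  - apply/measurable_EFinP; apply: measurable_funX; apply: measurable_sum => j.
    exact: measurable_funM.
  - apply: measurable_funeM; apply: emeasurable_sum => j.
    by apply: measurable_funeM; exact/measurable_EFinP.
  - move=> x _.
    have -> : (\sum_(j <- s) ((c j ^+ 2)%:E * ((h j x) ^+ 2)%:E) =
        (\sum_(j <- s) c j ^+ 2 * (h j x) ^+ 2)%R%:E)%E by rewrite -sumEFin.
    rewrite -EFinM lee_fin; apply: (le_trans (sqr_sum_le _ _)).
    by rewrite ler_wpM2l// ler_sum// => j _; rewrite exprMn.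
have mcq j : measurable_fun setT (fun x => (c j ^+ 2)%:E * ((h j x) ^+ 2)%:E)%E.
  by apply: measurable_funeM; exact/measurable_EFinP.
have cq0 j x : (0 <= (c j ^+ 2)%:E * ((h j x) ^+ 2)%:E)%E.
  by rewrite mule_ge0 ?lee_fin ?sqr_ge0.
rewrite ge0_integralZl_EFin//; last 2 first.
- by move=> x _; apply: sume_ge0 => j _.
- by apply: emeasurable_sum => j.
apply: lte_mul_pinfty => //.
rewrite ge0_integral_sum//.
apply: lte_sum_pinfty => j _; rewrite ge0_integralZl_EFin ?sqr_ge0//; last 2 first.
- by move=> x _; rewrite lee_fin sqr_ge0.
- exact/measurable_EFinP.
by apply: lte_mul_pinfty; rewrite ?lee_fin ?sqr_ge0.
Qed.

Section signed_sum.
Variables (J : Type) (s : seq J) (X : J -> Z -> R) (sg b : J -> R).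
Hypothesis mX : forall j, measurable_fun setT (X j).
Hypothesis sg1 : forall j, `|sg j| = 1.
Hypothesis Xb : forall j, (variance P (X j) <= (b j)%:E)%E.
Let Y x := \sum_(j <- s) sg j * X j x.
Let m j := fine (\int[P]_x (X j x)%:E)%E.

Let Xint j : P.-integrable setT (EFin \o X j).
Proof.
apply: (@integrable_of_sqr _ (m j)) => //.
by rewrite -varianceE (le_lt_trans (Xb j))// ltry.
Qed.

Lemma integrable_signed_sum : P.-integrable setT (EFin \o Y) /\
  fine (\int[P]_x (Y x)%:E)%E = \sum_(j <- s) sg j * m j.
Proof. exact: integral_lincomb. Qed.

(** The X j may be correlated, as they will share their sample points, so Cauchy-Schwarz is used and
    costs the number of terms. *)
Lemma signed_sum_sqr : (\int[P]_x ((Y x - \sum_(j <- s) sg j * m j) ^+ 2)%:E <=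
  ((size s)%:R * \sum_(j <- s) b j)%:E)%E.
Proof.
have mXm j : measurable_fun setT (fun x => (X j x - m j) ^+ 2).
  by apply: measurable_funX; apply: measurable_funB.
have mY : measurable_fun setT Y.
  by apply: measurable_sum => j; apply: measurable_funM.
apply: (@le_trans _ _ (\int[P]_x ((size s)%:R%:E *
    (\sum_(j <- s) ((X j x - m j) ^+ 2)%:E)))%E).
  apply: ge0_le_integral => //.
  - by move=> x _; rewrite lee_fin sqr_ge0.
  - by apply/measurable_EFinP; apply: measurable_funX; apply: measurable_funB.
  - by apply: measurable_funeM; apply: emeasurable_sum => j; exact/measurable_EFinP.
  - move=> x _; rewrite sumEFin -EFinM lee_fin.
    have -> : Y x - \sum_(j <- s) sg j * m j = \sum_(j <- s) sg j * (X j x - m j).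
      by rewrite -sumrB; apply: eq_bigr => j _; rewrite mulrBr.
    apply: (le_trans (sqr_sum_le _ _)); rewrite ler_wpM2l//.
    rewrite le_eqVlt; apply/orP; left; apply/eqP; apply: eq_bigr => j _.
    by rewrite exprMn -[sg j ^+ 2]real_normK ?num_real// sg1 expr1n mul1r.
rewrite ge0_integralZl_EFin//; last 2 first.
- by move=> x _; apply: sume_ge0 => j _; rewrite lee_fin sqr_ge0.
- by apply: emeasurable_sum => j; exact/measurable_EFinP.
rewrite EFinM lee_wpmul2l ?lee_fin//.
rewrite ge0_integral_sum//; last 2 first.
- by move=> j; exact/measurable_EFinP.
- by move=> j x _; rewrite lee_fin sqr_ge0.
by rewrite -sumEFin; apply: lee_sum => j _; rewrite -varianceE.
Qed.

End signed_sum.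

(** The cross term 2 c (Y - m) integrates to 0, m being the mean of Y. *)
Lemma sqr_shift_le (Y : Z -> R) (m b c : R) : measurable_fun setT Y ->
  P.-integrable setT (EFin \o Y) -> fine (\int[P]_x (Y x)%:E)%E = m ->
  (\int[P]_x ((Y x - m) ^+ 2)%:E <= b%:E)%E ->
  (\int[P]_x ((Y x - m + c) ^+ 2)%:E <= (b + c ^+ 2)%:E)%E.
Proof.
move=> mY iY Em h.
have mq : measurable_fun setT (fun x => (Y x - m) ^+ 2).
  by apply: measurable_funX; apply: measurable_funB.
have i0 : P.-integrable setT (fun x => ((Y x - m) ^+ 2)%:E).
  apply/integrableP; split; first exact/measurable_EFinP.
  under eq_integral => x _ do rewrite gee0_abs ?lee_fin ?sqr_ge0//.
  by rewrite (le_lt_trans h)// ltry.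
have ic (r : R) : P.-integrable setT (fun=> r%:E).
  exact: finite_measure_integrable_cst.
have i1 := integrableZl measurableT (2 * c) iY.
have -> : (\int[P]_x ((Y x - m + c) ^+ 2)%:E =
  \int[P]_x (((Y x - m) ^+ 2)%:E + ((2 * c)%:E * (Y x)%:E + (c ^+ 2 - 2 * c * m)%:E)))%E.
  by apply: eq_integral => x _; rewrite -EFinM -!EFinD; congr _%:E; ring.
rewrite integralD//; last exact: integrableD.
rewrite integralD// (integralZl measurableT iY) (integral_prob_cst P).
have -> : (\int[P]_x (Y x)%:E = m%:E)%E.
  by rewrite -Em fineK//; exact: integrable_fin_num.
rewrite -EFinM -EFinD [leRHS]EFinD; apply: leeD => //.
by rewrite lee_fin; lra.
Qed.

End second_moments.

Section quadrature_piece.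
Variables (R : realType) (D : set R) (a : D).
Local Notation T := (dom a).
Variable k : T -> T -> R.
Hypothesis k_meas : measurable_fun setT (fun z : T * T => k z.1 z.2).
Hypothesis k_diag : forall x : T, 0 < k x x.
Local Notation NT := (prodspace nat T).
Variables (rho : probability T R) (mu : probability NT R).
Hypothesis mu_prod : is_prod_measure rho mu.
Variable M : R.
Hypothesis M_def : (\int[rho]_x (k x x)%:E = M%:E)%E.
Hypothesis kprod_rk : forall u, rkhs (@kprod R D a k u).
Variable gamma : {fset nat} -> R.
Hypothesis gamma_ge0 : forall u, 0 <= gamma u.
Hypothesis a_anchor :
  (\esum_(u in [set: {fset nat}]) (gamma u * k a a ^+ #|` u|%fset)%:E < +oo)%E.
Variable HK : rkhs (@Kker R D a k gamma).
Local Notation XX := (Xdom k gamma).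
Local Notation mixE := (mixE (k := k) (gamma := gamma) mu).

Variable u : {fset nat}.
Hypothesis rsum_summable : rsummable (rsum k gamma u).
Local Notation r := (asum (rsum k gamma u)).

Variables (d : measure_display) (Om : measurableType d).
Variable (Pu : probability (prodspace u Om) R) (n : nat).
Variables (t : 'I_n -> R) (xi : 'I_n -> u -> Om -> T).
Hypothesis mxi : forall i j, measurable_fun setT (xi i j).
Hypothesis unbiased : forall f : prodspace u T -> R, measurable_fun setT f ->
  (\int[mu]_x ((f (restr u x)) ^+ 2)%:E < +oo)%E ->
  ('E_Pu[(fun om => \sum_i t i * f (fun j => xi i j (om j)))%R] =
    \int[mu]_x (f (restr u x))%:E)%E.
Variable kappa : R.
Hypothesis kappa_ge0 : 0 <= kappa.
Hypothesis var_le : forall (w : {fset nat}) (wu : (w `<=` u)%fset) f,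
  rk_space (kprod_rk w) f ->
  (variance Pu (fun om => \sum_i t i *
      f (fun j => xi i (fincl wu j) (om (fincl wu j))))%R
   <= (kappa * rk_norm (kprod_rk w) f ^+ 2)%:E)%E.

Let y (i : 'I_n) (om : prodspace u Om) : prodspace u T := fun j => xi i j (om j).

Let my i : measurable_fun setT (y i).
Proof.
apply: prodspace_measurable => j.
exact: (measurableT_comp (mxi i j) (coord_measurable j)).
Qed.

Definition quad_value (f : XX -> R) (om : prodspace u Om) : R :=
  \sum_i t i * component f u (y i om).

Lemma mixp_restr v x : (v `<=` u)%fset ->
  mixp a (mem v) (ext a (restr u x)) = mixp a (mem v) x.
Proof.
move=> vu; apply/funext => j; rewrite /mixp/=; case: ifP => // jv.
rewrite /ext; case: insubP => [j' _ <-//|].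
by rewrite (fsubsetP vu).
Qed.

Lemma component_measurable f : rk_space HK f ->
  measurable_fun setT (component f u : prodspace u T -> R).
Proof.
move=> Vf; apply: measurable_sum => v; apply: measurable_funM => //.
have h1 := measurableT_comp (@mixp_measurable R D a (mem v)) (@ext_measurable R D a u).
have h2 := ext0_measurable k_meas k_diag gamma_ge0 Vf.
have h3 := measurableT_comp h2 h1.
exact: h3.
Qed.

Let X (F : (u -> T) -> R) (v : {fset nat}) (om : prodspace u Om) : R :=
  \sum_i t i * F (restr u (mixp a (mem v) (ext a (y i om)))).

Let mF F : rk_space (kprod_rk u) F -> measurable_fun setT (F : prodspace u T -> R).
Proof.
move=> VF.
have := @rk_measurable R _ _ (kprod_rk u) _ (prodspace u T) (@Some _) _ F VF.
apply => z /=; apply: measurable_prod => j _.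
exact: (measurableT_comp (kl_measurable k_meas (z j)) (coord_measurable j)).
Qed.

Let restr_measurable : measurable_fun setT (restr u : NT -> prodspace u T).
Proof. by apply: prodspace_measurable => j; exact: coord_measurable. Qed.

Let mX F v : rk_space (kprod_rk u) F -> measurable_fun setT (X F v).
Proof.
move=> VF; apply: measurable_sum => i; apply: measurable_funM => //.
exact: (measurableT_comp (mF VF) (measurableT_comp restr_measurable
  (measurableT_comp (@mixp_measurable R D a (mem v))
    (measurableT_comp (@ext_measurable R D a u) (my i))))).
Qed.

Let mkk := Num.max 1 (k a a).

(** With the coordinates outside of v set to a, F becomes a function in H_v evaluated at the
    v-coordinates of the sample, so the variance bound for w = v applies; [restr_rk] controls the
    norm. *)
Let X_var F v : (v `<=` u)%fset -> rk_space (kprod_rk u) F ->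
  (variance Pu (X F v) <=
   (kappa * (mkk ^+ #|` u|%fset * rk_dot (kprod_rk u) F F))%:E)%E.
Proof.
move=> vu VF; have [VG GG] := restr_rk k_diag vu VF.
have := var_le vu VG.
have -> : (fun om : prodspace u Om => \sum_i t i * (fun z : v -> T => F (restr u (ext a z)))
    (fun j => xi i (fincl vu j) (om (fincl vu j)))) = X F v.
  apply/funext => om; apply: eq_bigr => i _; congr (_ * F _).
  apply/funext => j; rewrite /restr /mixp /=; rewrite /ext.
  case: insubP => [j' jv jj'|/negbTE ->//].
  rewrite jv; case: insubP => [j'' _ jj''|]; last by rewrite (valP j).
  have -> : j'' = fincl vu j'; last by [].
  by apply: val_inj; rewrite /= jj'' jj'.
move/le_trans; apply; rewrite lee_fin ler_wpM2l// rk_norm_sqr//.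
apply: (le_trans GG); rewrite ler_wpM2r ?rk_dot_ge0//.
have m1 : 1 <= mkk by rewrite le_max lexx.
apply: (@le_trans _ _ (mkk ^+ #|` u `\` v|%fset)).
  by rewrite lerXn2r ?nnegrE ?(ltW (k_diag a)) ?le_max ?lexx ?orbT// (le_trans ler01).
rewrite ler_weXn2l//; apply: fsubset_leq_card; exact: fsubsetDl.
Qed.

Definition component_mean (f : XX -> R) : R := \sum_(v <- fpowerset u) sgn R u v * mixE (mem v) f.

Let quad_value_X f : rk_space HK f -> exists F, [/\ rk_space (kprod_rk u) F,
  rk_dot (kprod_rk u) F F <= r * rk_dot HK f f &
  forall om, quad_value f om = \sum_(v <- fpowerset u) sgn R u v * X F v om].
Proof.
move=> Vf.
have [F [VF FA FE]] := component_riesz k_diag kprod_rk gamma_ge0 a_anchor Vf rsum_summable.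
exists F; split => // om; rewrite /quad_value.
under eq_bigr do rewrite FE mulr_sumr.
rewrite exchange_big/=; apply: eq_bigr => v _; rewrite /X mulr_sumr.
by apply: eq_bigr => i _; ring.
Qed.

Lemma quad_value_measurable f : rk_space HK f -> measurable_fun setT (quad_value f).
Proof.
move=> Vf; apply: measurable_sum => i; apply: measurable_funM => //.
exact: (measurableT_comp (component_measurable Vf) (my i)).
Qed.

(** Unbiasedness is invoked for f_{u,a} as a square integrable function of x_u; this integrability
    comes from that of K(z, z) over anchored points z. *)
Let mean_quad f : rk_space HK f ->
  fine (\int[Pu]_om (quad_value f om)%:E)%E = component_mean f.
Proof.
move=> Vf; have mS (v : {fset nat}) := mixSum_fset k_diag M_def gamma_ge0 a_anchor v.
have compE x : component f u (restr u x) =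
    \sum_(v <- fpowerset u) sgn R u v * ext0 f (mixp a (mem v) x).
  rewrite /component big_seq [RHS]big_seq; apply: eq_bigr => v.
  by rewrite fpowersetE => vu; rewrite mixp_restr.
have bd (v : {fset nat}) := mixE_bound k_meas k_diag mu_prod M_def gamma_ge0 HK (mS v).
have iv (v : {fset nat}) : mu.-integrable setT (fun x => (ext0 f (mixp a (mem v) x))%:E).
  by have [C _ CP] := bd v; exact: (CP f Vf).1.
have sq (v : {fset nat}) : (\int[mu]_x ((ext0 f (mixp a (mem v) x)) ^+ 2)%:E < +oo)%E.
  exact: (mixE_sq k_meas k_diag mu_prod M_def gamma_ge0 (mS v) Vf).
have E := unbiased (component_measurable Vf).
transitivity (fine (\int[mu]_x (component f u (restr u x))%:E)%E).
  congr fine; rewrite -E; first by rewrite unlock.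
  under eq_integral do rewrite compE.
  apply: integral_sqr_lincomb_lty => // v.
  exact: (measurableT_comp (ext0_measurable k_meas k_diag gamma_ge0 Vf)
    (@mixp_measurable R D a (mem v))).
under eq_integral do rewrite compE.
by rewrite (integral_lincomb _ _ iv).2.
Qed.

(** The factor 4^|u| consists of 2^|u| restrictions and another 2^|u| from [signed_sum_sqr]; max(1,
    k(a, a))^|u| bounds the loss of norm under restriction. *)
Lemma quad_value_sqr f c : rk_space HK f ->
  (\int[Pu]_om ((quad_value f om - component_mean f + c) ^+ 2)%:E <=
   ((4 * mkk) ^+ #|` u|%fset * kappa * r * rk_dot HK f f + c ^+ 2)%:E)%E.
Proof.
move=> Vf; have [F [VF FA FE]] := quad_value_X Vf.
have m1 : 1 <= mkk by rewrite le_max lexx.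
pose b := kappa * (mkk ^+ #|` u|%fset * rk_dot (kprod_rk u) F F).
(* The sum is moved to the subtype of subsets of u: [signed_sum_sqr] wants a variance bound at every
   index, and [X_var] provides it only for subsets of u. *)
pose sv : seq {v : {fset nat} | (v `<=` u)%fset} := pmap insub (fpowerset u).
have big_sv (H : {fset nat} -> R) :
    \sum_(v <- sv) H (val v) = \sum_(v <- fpowerset u) H v.
  rewrite -(big_map val predT H) /sv pmap_filter; last exact: insubK.
  rewrite big_filter big_seq_cond [RHS]big_seq; apply: eq_bigl => v.
  by rewrite fpowersetE; case: insubP => [? -> _|/negbTE ->]; rewrite ?andbT ?andbF.
have szsv : size sv = (2 ^ #|` u|%fset)%N.
  rewrite -card_fpowerset size_pmap_sub; apply/eqP; rewrite -all_count; apply/allP => v.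
  by rewrite fpowersetE.
have s1 (v : {v : {fset nat} | (v `<=` u)%fset}) : `|sgn R u (val v)| = 1.
  exact: sgn_norm.
have mXv (v : {v : {fset nat} | (v `<=` u)%fset}) : measurable_fun setT (X F (val v)).
  exact: mX.
have Xv (v : {v : {fset nat} | (v `<=` u)%fset}) :
    (variance Pu (X F (val v)) <= b%:E)%E.
  by apply: X_var => //; exact: (valP v).
have [iY mY] := integrable_signed_sum sv (fun v => sgn R u (val v)) mXv Xv.
have sq := signed_sum_sqr sv mXv s1 Xv.
have YE : (fun om => \sum_(v <- sv) sgn R u (val v) * X F (val v) om) = quad_value f.
  by apply/funext => om; rewrite FE (big_sv (fun v => sgn R u v * X F v om)).
rewrite -mY in sq.
move: iY sq; rewrite YE => iY sq.
have mE : fine (\int[Pu]_x (\sum_(j <- sv) sgn R u (val j) * X F (val j) x)%:E)%E =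
    component_mean f.
  rewrite -(mean_quad Vf); congr fine; apply: eq_integral => om _.
  by rewrite -YE.
have := sqr_shift_le c (quad_value_measurable Vf) iY (mean_quad Vf).
rewrite mE in sq.
have sqE : (\int[Pu]_x ((quad_value f x - component_mean f) ^+ 2)%:E <=
    ((size sv)%:R * \sum_(j <- sv) b)%:E)%E.
  apply: le_trans sq; rewrite le_eqVlt; apply/orP; left; apply/eqP.
  by apply: eq_integral => om _; rewrite -YE.
move=> /(_ _ sqE) /le_trans; apply; rewrite lee_fin lerD2r.
rewrite szsv big_const_seq count_predT iter_addr_0 szsv /b natrX -[X in _ * X <= _]mulr_natr natrX.
have -> : 2 ^+ #|` u|%fset * (kappa * (mkk ^+ #|` u|%fset * rk_dot (kprod_rk u) F F) *
    2 ^+ #|` u|%fset) = (4 * mkk) ^+ #|` u|%fset * kappa * rk_dot (kprod_rk u) F F.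
  have -> : (4 : R) = 2 * 2 by rewrite -natrM.
  by rewrite !exprMn; ring.
rewrite -[leRHS]mulrA; apply: ler_wpM2l => //.
by rewrite mulr_ge0// exprn_ge0// mulr_ge0// (le_trans ler01).
Qed.

End quadrature_piece.

(** * Linear randomized algorithms *)

Section linear_algorithms.
Variables (R : realType) (D : set R) (a : D).
Local Notation T := (dom a).
Variable k : T -> T -> R.
Variable gamma : {fset nat} -> R.
Variable HK : rkhs (@Kker R D a k gamma).
Local Notation XX := (Xdom k gamma).
Variable dollar : nat -> \bar R.

(* The clause on all shifts c encodes at once that e f is the expected output
   on f and that its variance is at most V |f|^2; in this form it passes to
   independent sums by Tonelli alone. *)
Definition lin_alg (cst V : R) (e : (XX -> R) -> R) : Prop :=
  exists d (Om : measurableType d) (P : probability Om R) (J : Type) (s : seq J)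
    (node : Om -> J -> XX) (wt : Om -> J -> R) (act : J -> {fset nat}),
  [/\ forall om j, anchored (act j) (val (node om j)),
      forall om j, c_a dollar (node om j) = dollar #|` act j|%fset,
      (\sum_(j <- s) dollar #|` act j|%fset <= cst%:E)%E
    & forall f, rk_space HK f ->
      measurable_fun setT (fun om => \sum_(j <- s) wt om j * f (node om j)) /\
      forall c : R,
      (\int[P]_om ((\sum_(j <- s) wt om j * f (node om j) - e f + c) ^+ 2)%:E
        <= (V * rk_dot HK f f + c ^+ 2)%:E)%E].

Lemma lin_alg_le cst cst' V V' e : cst <= cst' -> V <= V' ->
  lin_alg cst V e -> lin_alg cst' V' e.
Proof.
move=> cc VV [d [Om [P [J [s [node [wt [act [h1 h2 h3 h4]]]]]]]]].
exists d, Om, P, J, s, node, wt, act; split => //.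
  by apply: le_trans h3 _; rewrite lee_fin.
move=> f Vf; have [m h] := h4 f Vf; split => // c.
apply: le_trans (h c) _; rewrite lee_fin lerD2r ler_wpM2r//; exact: rk_dot_ge0.
Qed.

Lemma eq_lin_alg cst V e e' : (forall f, rk_space HK f -> e f = e' f) ->
  lin_alg cst V e -> lin_alg cst V e'.
Proof.
move=> ee [d [Om [P [J [s [node [wt [act [h1 h2 h3 h4]]]]]]]]].
exists d, Om, P, J, s, node, wt, act; split => // f Vf.
by rewrite -ee//; exact: h4.
Qed.

(** With the first outcome held fixed, the error of the first algorithm plus c is a constant shift
    for the second one. What remains is the clause of the first algorithm with shift c. *)
Lemma lin_alg_add c1 V1 e1 c2 V2 e2 : lin_alg c1 V1 e1 -> lin_alg c2 V2 e2 ->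
  lin_alg (c1 + c2) (V1 + V2) (fun f => e1 f + e2 f).
Proof.
move=> [d1 [Om1 [P1 [J1 [s1 [node1 [wt1 [act1 [a1 ca1 cs1 h1]]]]]]]]].
move=> [d2 [Om2 [P2 [J2 [s2 [node2 [wt2 [act2 [a2 ca2 cs2 h2]]]]]]]]].
exists _, (Om1 * Om2)%type, (P1 \x P2)%E, (J1 + J2)%type,
  ([seq inl j | j <- s1] ++ [seq inr j | j <- s2]),
  (fun om j => match j with inl j => node1 om.1 j | inr j => node2 om.2 j end),
  (fun om j => match j with inl j => wt1 om.1 j | inr j => wt2 om.2 j end),
  (fun j => match j with inl j => act1 j | inr j => act2 j end); split.
- by move=> om [j|j].
- by move=> om [j|j].
- by rewrite big_cat !big_map/= EFinD leeD.
move=> f Vf; have [m1 q1] := h1 f Vf; have [m2 q2] := h2 f Vf.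
pose S1 om := \sum_(j <- s1) wt1 om j * f (node1 om j).
pose S2 om := \sum_(j <- s2) wt2 om j * f (node2 om j).
have SE : (fun om : Om1 * Om2 => \sum_(j <- [seq inl j | j <- s1] ++ [seq inr j | j <- s2])
    match j with inl j => wt1 om.1 j | inr j => wt2 om.2 j end *
    f match j with inl j => node1 om.1 j | inr j => node2 om.2 j end) =
    fun om => S1 om.1 + S2 om.2.
  by apply/funext => om; rewrite big_cat !big_map.
have mS : measurable_fun setT (fun om : Om1 * Om2 => S1 om.1 + S2 om.2).
  by apply: measurable_funD; [exact: (measurableT_comp m1 measurable_fst)|
    exact: (measurableT_comp m2 measurable_snd)].
rewrite SE; split => // c.
pose g (om : Om1 * Om2) := ((S1 om.1 + S2 om.2 - (e1 f + e2 f) + c) ^+ 2)%:E.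
have mg : measurable_fun setT g.
  apply/measurable_EFinP; apply: measurable_funX; apply: measurable_funD => //.
  exact: measurable_funB.
have g0 om : (0 <= g om)%E by rewrite lee_fin sqr_ge0.
have -> : (\int[(P1 \x P2)%E]_om ((\sum_(j <- [seq inl j | j <- s1] ++ [seq inr j | j <- s2])
    match j with inl j => wt1 om.1 j | inr j => wt2 om.2 j end *
    f match j with inl j => node1 om.1 j | inr j => node2 om.2 j end
    - (e1 f + e2 f) + c) ^+ 2)%:E = \int[(P1 \x P2)%E]_om g om)%E.
  by apply: eq_integral => om _; rewrite (congr1 (fun h => h om) SE).
rewrite fubini_tonelli1//.
have m1c : measurable_fun setT (fun x => (S1 x - e1 f + c) ^+ 2).
  by apply: measurable_funX; apply: measurable_funD => //; exact: measurable_funB.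
apply: (@le_trans _ _ (\int[P1]_x ((V2 * rk_dot HK f f)%:E + ((S1 x - e1 f + c) ^+ 2)%:E))%E).
  apply: ge0_le_integral => //.
  - by move=> x _; apply: integral_ge0.
  - exact: measurable_fun_fubini_tonelli_F.
  - by apply: emeasurable_funD => //; exact/measurable_EFinP.
  move=> x _; have := q2 (S1 x - e1 f + c); rewrite EFinD; apply: le_trans.
  rewrite le_eqVlt; apply/orP; left; apply/eqP; apply: eq_integral => y _.
  by rewrite /g/= -/(S2 y); congr ((_ ^+ 2)%:E); ring.
have V20 : 0 <= V2 * rk_dot HK f f.
  have := q2 0; rewrite expr0n addr0 => /(le_trans _); rewrite -lee_fin; apply.
  by apply: integral_ge0 => x _; rewrite lee_fin sqr_ge0.
rewrite ge0_integralD//; last 2 first.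
- by move=> x _; rewrite lee_fin sqr_ge0.
- exact/measurable_EFinP.
rewrite integral_prob_cst; apply: (le_trans (leeD2l _ (q1 c))).
by rewrite -EFinD lee_fin mulrDl addrCA addrA.
Qed.

Lemma lin_alg_sum (I : eqType) (s : seq I) (c V : I -> R) (e : I -> (XX -> R) -> R)
    (c0 V0 : R) (e0 : (XX -> R) -> R) : lin_alg c0 V0 e0 ->
  (forall i, i \in s -> lin_alg (c i) (V i) (e i)) ->
  lin_alg (c0 + \sum_(i <- s) c i) (V0 + \sum_(i <- s) V i)
    (fun f => e0 f + \sum_(i <- s) e i f).
Proof.
move=> h0; elim: s => [|i s IH] h.
  rewrite !big_nil !addr0; apply: eq_lin_alg h0 => f _; by rewrite big_nil addr0.
have IHs := IH (fun j js => h j (mem_behead (s := i :: s) js)).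
have := lin_alg_add (h i (mem_head _ _)) IHs.
rewrite !big_cons addrCA [V i + _]addrCA; apply: eq_lin_alg => f _.
by rewrite big_cons addrCA.
Qed.

End linear_algorithms.

Section to_rand_alg.
Variables (R : realType) (D : set R) (a : D).
Local Notation T := (dom a).
Variable k : T -> T -> R.
Variable gamma : {fset nat} -> R.
Variable HK : rkhs (@Kker R D a k gamma).
Local Notation XX := (Xdom k gamma).
Variable mu : probability (prodspace nat T) R.
Variable dollar : nat -> \bar R.
Hypothesis dollar_ge0 : forall n, (0 <= dollar n)%E.
Variable x0 : XX.

Lemma big_nth_map (J : Type) (s : seq J) (w v : J -> R) :
  \sum_(i < size s) nth 0 [seq w j | j <- s] i * nth 0 [seq v j | j <- s] i =
  \sum_(j <- s) w j * v j.
Proof.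
elim: s => [|j s IH]; first by rewrite big_ord0 big_nil.
by rewrite big_ord_recl big_cons /= IH.
Qed.

Section conversion.
Context d (Om : measurableType d) (P : probability Om R) (J : Type) (s : seq J).
Variables (node : Om -> J -> XX) (wt : Om -> J -> R) (act : J -> {fset nat}).

(** Non-adaptive: the observed values enter the choice of a node only through their number, which is
    the index of the next node. *)
Definition to_rand_alg : rand_alg R XX :=
  @RandAlg R XX d Om P (size s)
    (fun om vals => nth x0 [seq node om j | j <- s] (size vals))
    (fun om vals => \sum_(i < size s) nth 0 [seq wt om j | j <- s] i * nth 0 vals i).

Lemma ra_values_to_rand_alg f om i : (i <= size s)%N ->
  @ra_values R XX to_rand_alg f om i = take i [seq f (node om j) | j <- s].
Proof.
elim: i => [|i IH] ij; first by rewrite take0.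
rewrite /= IH ?(ltnW ij)// size_take size_map ij (take_nth (f x0)) ?size_map//.
congr rcons; rewrite (map_comp f (node om)) (nth_map x0)//.
by rewrite size_map.
Qed.

Lemma ra_value_to_rand_alg f om :
  ra_value to_rand_alg f om = \sum_(j <- s) wt om j * f (node om j).
Proof.
rewrite /ra_value ra_values_to_rand_alg//= take_oversize ?size_map//.
exact: big_nth_map.
Qed.

Lemma ra_point_to_rand_alg f om i : (i < size s)%N ->
  ra_point to_rand_alg f om i = nth x0 [seq node om j | j <- s] i.
Proof.
move=> ij; rewrite /ra_point ra_values_to_rand_alg ?(ltnW ij)//=.
by rewrite size_take size_map ij.
Qed.

End conversion.

(** The shift c = e f - I(f) turns the clause of [lin_alg] into variance plus squared bias; the
    shift c = e f gives the finite second moment of the output. *)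
Lemma rand_alg_of_lin_alg tot V B (e : (XX -> R) -> R) : 0 <= V -> 0 <= B ->
  lin_alg HK dollar tot V e ->
  (forall f, rk_space HK f -> (Int mu f - e f) ^+ 2 <= B * rk_dot HK f f) ->
  exists Q : rand_alg R XX, [/\ A_res dollar HK Q,
    (cost dollar Q (rk_ball HK) <= tot%:E)%E &
    (error mu Q (rk_ball HK) <= (Num.sqrt (B + V))%:E)%E].
Proof.
move=> V0 B0 [d [Om [P [J [s [node [wt [act [h1 h2 h3 h4]]]]]]]]] eB.
pose Q := to_rand_alg P s node wt.
have sumE : (\sum_(j <- s) dollar #|` act j|%fset =
    \sum_(i < size s) dollar #|` nth fset0 [seq act j | j <- s] i|%fset)%E.
  rewrite -(big_map act predT (fun v : {fset nat} => dollar #|` v|%fset)).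
  by rewrite (big_nth fset0) size_map big_mkord.
have nth_node om (i : 'I_(size s)) : exists2 j, nth x0 [seq node om j | j <- s] i = node om j &
    nth fset0 [seq act j | j <- s] i = act j.
  case: {+}s i => [|j s'] i; first by case: i.
  by exists (nth j (j :: s') i); rewrite (nth_map j).
have costE f om : ra_cost Q f om (c_a dollar) = (\sum_(j <- s) dollar #|` act j|%fset)%E.
  rewrite sumE /ra_cost; apply: eq_bigr => i _.
  by rewrite ra_point_to_rand_alg//; have [j -> ->] := nth_node om i; rewrite h2.
have sum_fin : (\sum_(j <- s) dollar #|` act j|%fset)%E \is a fin_num.
  rewrite ge0_fin_numE; first by rewrite (le_lt_trans h3)// ltry.
  by apply: sume_ge0 => j _.
have icostE f : (\int[P]_w ra_cost Q f w (c_a dollar) = \sum_(j <- s) dollar #|` act j|%fset)%E.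
  under eq_integral do rewrite costE.
  by rewrite -(fineK sum_fin) integral_prob_cst.
have valE f : ra_value Q f = fun om => \sum_(j <- s) wt om j * f (node om j).
  by apply/funext => om; exact: ra_value_to_rand_alg.
have errs : (ereal_sup [set (\int[ra_P Q]_w ((Int mu f - ra_value Q f w) ^+ 2)%:E)%E
    | f in rk_ball HK] <= (B + V)%:E)%E.
  apply: ge_ereal_sup => _ [f [Vf nf] <-].
  have d1 : rk_dot HK f f <= 1.
    by rewrite -rk_norm_sqr// expr_le1// sqrtr_ge0.
  have d0 := rk_dot_ge0 Vf.
  have [_ h] := h4 f Vf; have := h (e f - Int mu f).
  have -> : (\int[ra_P Q]_w ((Int mu f - ra_value Q f w) ^+ 2)%:E =
    \int[P]_om ((\sum_(j <- s) wt om j * f (node om j) - e f + (e f - Int mu f)) ^+ 2)%:E)%E.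
    by apply: eq_integral => om _; rewrite valE; congr (_%:E); ring.
  move/le_trans; apply; rewrite lee_fin addrC lerD//.
    by rewrite -sqrrN opprB (le_trans (eB f Vf))// ler_piMr.
  by rewrite ler_piMr.
have sup0 : (0 <= ereal_sup [set (\int[ra_P Q]_w ((Int mu f - ra_value Q f w) ^+ 2)%:E)%E
    | f in rk_ball HK])%E.
  apply: le_trans (ereal_sup_ubound _); last first.
    exists (fun=> 0) => //; split; first exact: rk_0.
    by rewrite /rk_norm rk_dot0l ?sqrtr0//; exact: rk_0.
  by apply: integral_ge0 => w _; rewrite lee_fin sqr_ge0.
exists Q; split.
- exists (fun i => nth fset0 [seq act j | j <- s] i) => f Vf; split.
  + by rewrite valE; have [] := h4 f Vf.
  + have [_ h] := h4 f Vf.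
    apply: (@le_lt_trans _ _ (V * rk_dot HK f f + e f ^+ 2)%:E); last exact: ltry.
    apply: le_trans (h (e f)).
    rewrite le_eqVlt; apply/orP; left; apply/eqP; apply: eq_integral => om _.
    by rewrite valE subrK.
  + move=> om i; rewrite ra_point_to_rand_alg//.
    by have [j -> ->] := nth_node om i; exact: h1.
  + rewrite (_ : (fun w => _) = cst (\sum_(j <- s) dollar #|` act j|%fset)%E).
      exact: measurable_cst.
    by apply/funext => om; exact: costE.
  + by rewrite icostE sumE.
- by apply: ge_ereal_sup => _ [f _ <-]; rewrite icostE.
- by rewrite /error -[leRHS]/(sqrte (B + V)%:E) lee_sqrt// lee_fin addr_ge0.
Qed.

End to_rand_alg.

(** * Estimators of the anchored components with exact cost *)

Section pieces.
Variables (R : realType) (D : set R) (a : D).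
Local Notation T := (dom a).
Variable k : T -> T -> R.
Hypothesis k_meas : measurable_fun setT (fun z : T * T => k z.1 z.2).
Hypothesis k_diag : forall x : T, 0 < k x x.
Local Notation NT := (prodspace nat T).
Variables (rho : probability T R) (mu : probability NT R).
Hypothesis mu_prod : is_prod_measure rho mu.
Variable M : R.
Hypothesis M_def : (\int[rho]_x (k x x)%:E = M%:E)%E.
Hypothesis k_int0 : forall y, (\int[rho]_x (k x y)%:E = 0)%E.
Hypothesis kprod_rk : forall u, rkhs (@kprod R D a k u).
Variable gamma : {fset nat} -> R.
Hypothesis gamma_ge0 : forall u, 0 <= gamma u.
Hypothesis a_anchor :
  (\esum_(u in [set: {fset nat}]) (gamma u * k a a ^+ #|` u|%fset)%:E < +oo)%E.
Variable HK : rkhs (@Kker R D a k gamma).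
Local Notation XX := (Xdom k gamma).
Variable dollar : nat -> \bar R.
Hypothesis dollar_mono : forall m n, (m <= n)%N -> (dollar m <= dollar n)%E.
Local Notation mixX := (mixX k_diag gamma_ge0 a_anchor).
Local Notation component_mean := (component_mean (k := k) mu (gamma := gamma)).

(** If a were the only point of D, the integral of k(., a) would be k(a, a) > 0 and not 0. *)
Lemma exists_ne_anchor : exists b : T, b <> a.
Proof.
apply/not_existsP => h; have xa x : x = a :> T by apply: contrapT => /h.
have E : (\int[rho]_x (k x a)%:E = \int[rho]_x (k a a)%:E)%E.
  by apply: eq_integral => x _; rewrite (xa x).
have := k_int0 a; rewrite E integral_prob_cst => -[] /eqP.
by rewrite gt_eqF//; exact: k_diag.
Qed.

Lemma anchored_mix (v : {fset nat}) (x : nat -> T) : anchored v (mixp a (mem v) x).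
Proof. by move=> j jv; rewrite /mixp/= ifN. Qed.

(** Every w outside of which the point is anchored has to contain v, so monotonicity of $ makes v
    the cheapest choice. *)
Lemma c_a_mixX (v : {fset nat}) (x : nat -> T) : (forall j, j \in v -> x j <> a) ->
  c_a dollar (mixX v x) = dollar #|` v|%fset.
Proof.
move=> xa; apply/eqP; rewrite eq_le; apply/andP; split.
  by apply: ereal_inf_lbound; exists v => //; exact: anchored_mix.
apply: le_ereal_inf_tmp => _ [w wv <-]; apply: dollar_mono; apply: fsubset_leq_card.
apply/fsubsetP => j jv; apply: contrapT => /negP jw; apply: (xa j jv).
by have := wv j jw; rewrite /= /mixp/= jv.
Qed.

(** If y_j = a, toggling j in v does not move the evaluation point, so the terms cancel in pairs. *)
Lemma component_zero (f : XX -> R) (u : {fset nat}) (y : u -> T) j : j \in u ->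
  ext a y j = a -> component f u y = 0.
Proof.
move=> ju ya; rewrite /component (alt_sum0 ju)// => v; congr (ext0 f _).
apply/funext => i; have [->|ij] := eqVneq i j; last exact: mixp_toggle.
by rewrite /mixp ya; do 2 case: ifP.
Qed.

Lemma component_mean0 f : component_mean fset0 f = f (mixX fset0 (anchor a)).
Proof.
rewrite /component_mean fpowerset0 big_seq_fset1 /sgn fset0D cardfs0 expr0 mul1r.
rewrite /mixE /Rintegral.
have E : (\int[mu]_x (ext0 f (mixp a (mem fset0) x))%:E =
    \int[mu]_x (f (mixX fset0 (anchor a)))%:E)%E.
  apply: eq_integral => x _; rewrite -(ext0_mix k_diag gamma_ge0 a_anchor).
  by congr ((ext0 f _)%:E); apply/funext => j; rewrite /mixp/= inE.
by rewrite E integral_prob_cst.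
Qed.

(** (Q) concerns nonempty u. For u = fset0 the component is the constant f(a, a, ...), read off from
    one evaluation with variance 0. *)
Lemma lin_alg_anchor tot : (dollar 0 <= tot%:E)%E ->
  lin_alg HK dollar tot 0 (component_mean fset0).
Proof.
move=> d0; exists _, NT, mu, unit, [:: tt], (fun _ _ => mixX fset0 (anchor a)),
  (fun _ _ => 1), (fun _ => fset0); split.
- by move=> om j; exact: anchored_mix.
- by move=> om j; apply: c_a_mixX => i; rewrite inE.
- by rewrite big_seq1 cardfs0.
move=> f Vf.
split => [|c]; first exact: measurable_cst.
have E : (\int[mu]_om ((\sum_(j <- [:: tt]) 1 * f (mixX fset0 (anchor a)) -
    component_mean fset0 f + c) ^+ 2)%:E = \int[mu]_om (c ^+ 2)%:E)%E.
  apply: eq_integral => om _; rewrite big_seq1 mul1r component_mean0 subrr add0r//.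
by rewrite E integral_prob_cst mul0r add0r.
Qed.

Lemma lin_alg_zero : lin_alg HK dollar 0 0 (fun=> 0).
Proof.
exists _, NT, mu, unit, [::], (fun _ _ => mixX fset0 (anchor a)),
  (fun _ _ => 1), (fun _ => fset0); split.
- by move=> om j; exact: anchored_mix.
- by move=> om j; apply: c_a_mixX => i; rewrite inE.
- by rewrite big_nil.
move=> f Vf.
split => [|c]; first exact: measurable_cst.
have E : (\int[mu]_om ((\sum_(j <- Nil unit) 1 * f (mixX fset0 (anchor a)) - 0 + c) ^+ 2)%:E =
    \int[mu]_om (c ^+ 2)%:E)%E.
  by apply: eq_integral => om _; rewrite big_nil subr0 add0r.
by rewrite E integral_prob_cst mul0r add0r.
Qed.

Section quad.
Variable u : {fset nat}.
Hypothesis rsum_summable : rsummable (rsum k gamma u).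
Local Notation r := (asum (rsum k gamma u)).
Variables (d : measure_display) (Om : measurableType d).
Variable (Pu : probability (prodspace u Om) R) (n : nat).
Variables (t : 'I_n -> R) (xi : 'I_n -> u -> Om -> T).
Hypothesis mxi : forall i j, measurable_fun setT (xi i j).
Hypothesis unbiased : forall f : prodspace u T -> R, measurable_fun setT f ->
  (\int[mu]_x ((f (restr u x)) ^+ 2)%:E < +oo)%E ->
  ('E_Pu[(fun om => \sum_i t i * f (fun j => xi i j (om j)))%R] =
    \int[mu]_x (f (restr u x))%:E)%E.
Variable kappa : R.
Hypothesis kappa_ge0 : 0 <= kappa.
Hypothesis var_le : forall (w : {fset nat}) (wu : (w `<=` u)%fset) f,
  rk_space (kprod_rk w) f ->
  (variance Pu (fun om => \sum_i t i *
      f (fun j => xi i (fincl wu j) (om (fincl wu j))))%R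
   <= (kappa * rk_norm (kprod_rk w) f ^+ 2)%:E)%E.

(* If some coordinate of a sample is a, then c_a may be smaller than $(|v|), but
   the component of f vanishes there; such samples get weight 0 and are replaced
   by the constant point b, so that every evaluation costs exactly $(|v|). *)
Lemma lin_alg_quad (ds : R) : (dollar #|` u|%fset <= ds%:E)%E ->
  lin_alg HK dollar (n%:R * 2 ^+ #|` u|%fset * ds)
   ((4 * Num.max 1 (k a a)) ^+ #|` u|%fset * kappa * r)
   (component_mean u).
Proof.
move=> uds; have [b ba] := exists_ne_anchor.
pose y (i : 'I_n) (om : prodspace u Om) : nat -> T := ext a (fun j => xi i j (om j)).
pose good i om := `[< forall j, j \in u -> y i om j <> a >].
pose z i om : nat -> T := fun j => if good i om && (j \in u) then y i om j else b.
have za i om j : z i om j <> a.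
  rewrite /z; case: ifP => // /andP[/asboolP h ju]; exact: h.
exists _, (prodspace u Om), Pu, ('I_n * {fset nat})%type,
  [seq (i, v) | i <- enum 'I_n, v <- fpowerset u],
  (fun om p => mixX p.2 (z p.1 om)),
  (fun om p => if good p.1 om then t p.1 * sgn R u p.2 else 0),
  snd; split.
- by move=> om [i v]; exact: anchored_mix.
- by move=> om [i v]; apply: c_a_mixX => j _; exact: za.
- rewrite big_allpairs_dep/=.
  apply: (@le_trans _ _ (\sum_(i <- enum 'I_n) \sum_(v <- fpowerset u) ds%:E)%E).
    apply: lee_sum => i _; rewrite big_seq [leRHS]big_seq; apply: lee_sum => v.
    rewrite fpowersetE => vu; apply: le_trans uds; apply: dollar_mono.
    exact: fsubset_leq_card.
  under eq_bigr do rewrite sumEFin.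
  rewrite sumEFin lee_fin big_const_seq count_predT iter_addr_0.
  rewrite big_const_seq count_predT iter_addr_0 card_fpowerset -cardE card_ord.
  suff -> : ds *+ 2 ^ #|` u|%fset *+ n = n%:R * 2 ^+ #|` u|%fset * ds by [].
  by rewrite -[LHS]mulr_natr -(mulr_natr ds) natrX; ring.
move=> f Vf.
have E om : \sum_(p <- [seq (i, v) | i <- enum 'I_n, v <- fpowerset u])
    (if good p.1 om then t p.1 * sgn R u p.2 else 0) * f (mixX p.2 (z p.1 om)) =
    quad_value t xi f om.
  rewrite big_allpairs_dep/= big_enum/=; apply: eq_bigr => i _.
  case: (boolP (good i om)) => [gi|/asboolPn]; last first.
    move=> /existsNP[j /not_implyP[ju /contrapT ya]].
    rewrite (component_zero _ ju ya) mulr0 big1// => v _; exact: mul0r.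
  rewrite /component mulr_sumr big_seq [RHS]big_seq; apply: eq_bigr => v.
  rewrite fpowersetE => vu; rewrite -ext0_mix mulrA; congr (_ * ext0 f _).
  apply/funext => j; rewrite /mixp/=; case: ifP => // jv.
  by rewrite /z gi (fsubsetP vu).
split=> [|c].
  rewrite (_ : (fun om => _) = quad_value t xi f); last exact/funext.
  exact: (quad_value_measurable k_meas k_diag gamma_ge0 t mxi Vf).
apply: le_trans (quad_value_sqr k_meas k_diag mu_prod M_def gamma_ge0 a_anchor
  rsum_summable mxi unbiased kappa_ge0 var_le c Vf).
rewrite le_eqVlt; apply/orP; left; apply/eqP; apply: eq_integral => om _.
by rewrite E.
Qed.

End quad.
End pieces.

(** * The changing dimension algorithm *)

Section changing_dimension.
Variables (R : realType) (D : set R) (a : D).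
Local Notation T := (dom a).
Variable k : T -> T -> R.
Hypothesis k_meas : measurable_fun setT (fun z : T * T => k z.1 z.2).
Hypothesis k_diag : forall x : T, 0 < k x x.
Local Notation NT := (prodspace nat T).
Variables (rho : probability T R) (mu : probability NT R).
Hypothesis mu_prod : is_prod_measure rho mu.
Variable M : R.
Hypothesis M_def : (\int[rho]_x (k x x)%:E = M%:E)%E.
Hypothesis k_int0 : forall y, (\int[rho]_x (k x y)%:E = 0)%E.
Hypothesis k_rk : rkhs k.
Variable Hu : forall u, rkhs (@kprod R D a k u).
Variable gamma : {fset nat} -> R.
Hypothesis gamma_ge0 : forall u, 0 <= gamma u.
Hypothesis gamma_sum :
  (\esum_(u in [set: {fset nat}]) (gamma u * M ^+ #|` u|%fset)%:E < +oo)%E.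
Hypothesis gamma_down : forall u v : {fset nat}, (u `<=` v)%fset ->
  0 < gamma v -> 0 < gamma u.
Hypothesis a_anchor :
  (\esum_(u in [set: {fset nat}]) (gamma u * k a a ^+ #|` u|%fset)%:E < +oo)%E.
Variable HK : rkhs (@Kker R D a k gamma).
Variable dollar : nat -> \bar R.
Hypothesis dollar_ge0 : forall n, (0 <= dollar n)%E.
Hypothesis dollar_mono : forall m n, (m <= n)%N -> (dollar m <= dollar n)%E.
Variable S : nat -> R.
Hypothesis dollarS : forall n, (dollar n <= (S n)%:E)%E.
Variables (c C tau alpha1 alpha2 A : R).
Hypothesis c_ge0 : 0 <= c.
Hypothesis C_ge0 : 0 <= C.
Hypothesis quad : quad_assumption gamma mu rho Hu c C tau alpha1 alpha2.
Hypothesis rsqA : forall u, (rsq k gamma u <= (A * gamma u)%:E)%E.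
Local Notation m := (Num.max 1 (k a a)).

Lemma rsum_bound u : rsummable (rsum k gamma u) /\ asum (rsum k gamma u) <= A * gamma u.
Proof.
have r0 w : 0 <= rsum k gamma u w by exact: rsum_ge0.
have h := rsqA u; rewrite (rsqE k gamma u) in h.
have s : rsummable (rsum k gamma u).
  by apply/ge0_rsummable => //; apply: le_lt_trans h _; exact: ltry.
by split => //; rewrite -lee_fin EFin_asum.
Qed.

(** As gamma_u > 0 implies gamma_w > 0 for all w contained in u, the variance clause of (Q) covers
    every restriction that occurs in f_{u,a}. The number B takes the place of all the F_w(n). *)
Lemma lin_alg_component u n B : u != fset0 -> 0 < gamma u -> (0 < n)%N -> 0 <= B ->
  (forall w : {fset nat}, (w `<=` u)%fset -> Fw alpha1 alpha2 #|` w|%fset n <= B) ->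
  lin_alg HK dollar (n%:R * 2 ^+ #|` u|%fset * S #|` u|%fset)
   ((4 * m) ^+ #|` u|%fset * (c * C ^+ #|` u|%fset * n.+1%:R `^ (- tau) * B) *
     (A * gamma u))
   (component_mean mu (gamma := gamma) (k := k) u).
Proof.
move=> u0 gu n0 B0 FB.
have [d [Om [P [Pu [t [xi [[_ _] mxi _ unb var]]]]]]] := quad u0 gu n0.
have [rS rA] := rsum_bound u.
have kap0 : 0 <= c * C ^+ #|` u|%fset * n.+1%:R `^ (- tau) * B.
  by rewrite !mulr_ge0 ?exprn_ge0 ?powR_ge0.
have vle (w : {fset nat}) (wu : (w `<=` u)%fset) f : rk_space (Hu w) f ->
  (variance Pu (fun om => \sum_i t i *
      f (fun j => xi i (fincl wu j) (om (fincl wu j))))%R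
   <= (c * C ^+ #|` u|%fset * n.+1%:R `^ (- tau) * B * rk_norm (Hu w) f ^+ 2)%:E)%E.
  move=> Vf; apply: le_trans (var w wu (gamma_down wu gu) f Vf) _.
  rewrite lee_fin ler_wpM2r ?sqr_ge0// ler_wpM2l ?FB//.
  by rewrite !mulr_ge0 ?exprn_ge0 ?powR_ge0.
have := lin_alg_quad k_meas k_diag mu_prod M_def k_int0 gamma_ge0 a_anchor HK
  dollar_mono rS mxi unb kap0 vle (dollarS _).
apply: lin_alg_le => //; apply: ler_wpM2l => //.
rewrite mulr_ge0// exprn_ge0// mulr_ge0// (le_trans ler01)// le_max lexx//.
Qed.

Lemma lin_alg_cda (Q : {fset {fset nat}}) (nn : {fset nat} -> nat) (B : R) :
  0 <= B -> fset0 \in Q ->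
  (forall u, u \in Q -> u != fset0 -> 0 < gamma u) ->
  (forall u, u \in Q -> u != fset0 -> (0 < nn u)%N) ->
  (forall u w, u \in Q -> u != fset0 -> (w `<=` u)%fset ->
     Fw alpha1 alpha2 #|` w|%fset (nn u) <= B) ->
  lin_alg HK dollar
    (S 0 + \sum_(u <- (Q `\ fset0)%fset) (nn u)%:R * 2 ^+ #|` u|%fset * S #|` u|%fset)
    (\sum_(u <- (Q `\ fset0)%fset) (4 * m) ^+ #|` u|%fset *
      (c * C ^+ #|` u|%fset * (nn u).+1%:R `^ (- tau) * B) * (A * gamma u))
    (cda_mean mu (gamma := gamma) (k := k) Q).
Proof.
move=> B0 Q0 gQ nQ FQ.
have h0 := lin_alg_anchor k_diag mu gamma_ge0 a_anchor HK dollar_mono (dollarS 0).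
have := @lin_alg_sum _ _ _ _ _ HK dollar _ (Q `\ fset0)%fset
  (fun u => (nn u)%:R * 2 ^+ #|` u|%fset * S #|` u|%fset)
  (fun u => (4 * m) ^+ #|` u|%fset *
      (c * C ^+ #|` u|%fset * (nn u).+1%:R `^ (- tau) * B) * (A * gamma u))
  (fun u => component_mean mu (gamma := gamma) (k := k) u) _ _ _ h0.
rewrite add0r => H; apply: eq_lin_alg (H _).
  by move=> f _; rewrite /cda_mean (big_fsetD1 fset0 Q0)/=.
move=> u; rewrite !inE => /andP[u0 uQ]; apply: lin_alg_component => //.
- exact: gQ.
- exact: nQ.
- by move=> w wu; exact: FQ.
Qed.

Lemma exists_cda_alg (Q : {fset {fset nat}}) (nn : {fset nat} -> nat) (B : R)
    (b : {fset nat} -> R) :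
  0 <= B -> 0 <= A -> fset0 \in Q ->
  (forall u v, u \in Q -> (v `<=` u)%fset -> v \in Q) ->
  (forall u, u \in Q -> u != fset0 -> 0 < gamma u) ->
  (forall u, u \in Q -> u != fset0 -> (0 < nn u)%N) ->
  (forall u w, u \in Q -> u != fset0 -> (w `<=` u)%fset ->
     Fw alpha1 alpha2 #|` w|%fset (nn u) <= B) ->
  rsummable b -> (forall w, 0 <= b w) ->
  (forall w, w \notin Q -> 4 ^+ #|` w|%fset * (gamma w * k a a ^+ #|` w|%fset) <= b w) ->
  let tot := S 0 + \sum_(u <- (Q `\ fset0)%fset) (nn u)%:R * 2 ^+ #|` u|%fset * S #|` u|%fset in
  let V := \sum_(u <- (Q `\ fset0)%fset) (4 * m) ^+ #|` u|%fset *
      (c * C ^+ #|` u|%fset * (nn u).+1%:R `^ (- tau) * B) * (A * gamma u) in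
  exists Q' : rand_alg R (Xdom k gamma), [/\ A_res dollar HK Q',
    (cost dollar Q' (rk_ball HK) <= tot%:E)%E &
    (error mu Q' (rk_ball HK) <= (Num.sqrt (asum b + V))%:E)%E].
Proof.
move=> B0 A0 Q0 Qd gQ nQ FQ sb b0 bP tot V.
apply: (rand_alg_of_lin_alg dollar_ge0 (mixX k_diag gamma_ge0 a_anchor fset0 (anchor a))
  _ _ (lin_alg_cda B0 Q0 gQ nQ FQ)).
- apply: sumr_ge0 => u _; rewrite !mulr_ge0 ?exprn_ge0 ?powR_ge0// mulr_ge0//.
  by rewrite (le_trans ler01)// le_max lexx.
- exact: asum_ge0.
- exact: (bias_le k_meas k_diag mu_prod M_def k_int0 k_rk Hu gamma_ge0 gamma_sum
    a_anchor Q0 Qd sb b0 bP).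
Qed.

(** I is bounded on the unit ball, so the output 0 without evaluations has a finite error. This
    handles large eps in the definition of [p_res]. The 1 in B + 1 makes e0 positive. *)
Lemma exists_zero_alg : exists2 e0 : R, 0 < e0 &
  exists Q' : rand_alg R (Xdom k gamma),
  [/\ A_res dollar HK Q', (cost dollar Q' (rk_ball HK) <= 0)%E &
    (error mu Q' (rk_ball HK) <= e0%:E)%E].
Proof.
have [B B0 BP] := mixE_bound k_meas k_diag mu_prod M_def gamma_ge0 HK
  (mixSumT k_diag M_def gamma_ge0 gamma_sum).
have h0 := lin_alg_zero k_diag mu gamma_ge0 a_anchor HK dollar_mono.
have IB f : rk_space HK f -> (Int mu f - 0) ^+ 2 <= B ^+ 2 * rk_dot HK f f.
  move=> Vf; rewrite subr0 -(rk_norm_sqr Vf) -exprMn -[leLHS]real_normK ?num_real//.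
  rewrite ler_pXn2r ?nnegrE ?mulr_ge0 ?sqrtr_ge0//.
  by rewrite -mixE_Int; have [_ h] := BP f Vf.
have [Q' [h1 h2 h3]] := rand_alg_of_lin_alg dollar_ge0
  (mixX k_diag gamma_ge0 a_anchor fset0 (anchor a)) (lexx 0) (sqr_ge0 B) h0 IB.
exists (B + 1); first by rewrite ltr_pwDr.
exists Q'; split => //; apply: le_trans h3 _.
by rewrite lee_fin addr0 sqrtr_sqr ger0_norm// lerDl.
Qed.

End changing_dimension.

(** * The sample numbers n_u: finiteness, bias, variance and cost sums *)

Lemma powR_ge1 (R : realType) (x r : R) : 1 <= x -> 0 <= r -> 1 <= x `^ r.
Proof. by move=> x1 r0; have := ler_powR x1 r0; rewrite powRr0. Qed.

Lemma powR_le1 (R : realType) (x r : R) : 1 <= x -> r <= 0 -> x `^ r <= 1.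
Proof. by move=> x1 r0; have := ler_powR x1 r0; rewrite powRr0. Qed.

Lemma sum_le_asum (R : realType) (I : countType) (g : I -> R) (s : seq I) :
  (forall i, 0 <= g i) -> rsummable g -> uniq s -> \sum_(i <- s) g i <= asum g.
Proof.
move=> g0 sg us; rewrite -lee_fin EFin_asum// -sumEFin.
by apply: fsum_le_esum => // i; rewrite lee_fin.
Qed.

Lemma le_asum1 (R : realType) (I : countType) (g : I -> R) i :
  (forall i, 0 <= g i) -> rsummable g -> g i <= asum g.
Proof. by move=> g0 sg; have := sum_le_asum (s := [:: i]) g0 sg; rewrite big_seq1; apply. Qed.

Lemma finite_ge1_rsummable (R : realType) (I : countType) (g : I -> R) :
  (forall i, 0 <= g i) -> rsummable g -> finite_set [set i | 1 <= g i].
Proof.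
move=> g0 sg; apply: contrapT => /(infinite_set_fset (Num.truncn (asum g)).+1)[B BS nB].
have := sum_le_asum g0 sg (fset_uniq B); apply/negP; rewrite -ltNge.
apply: (lt_le_trans (truncnS_gt _)).
apply: (@le_trans _ _ (\sum_(i <- B) 1)).
  by rewrite big_const_seq count_predT iter_addr_0 ler_nat.
by rewrite big_seq [leRHS]big_seq; apply: ler_sum => i iB; exact: BS.
Qed.

(** For bounded g, g^s = g^(s - r) g^r <= B^(s - r) g^r. *)
Lemma rsummable_powR (R : realType) (I : countType) (g : I -> R) (r s B : R) :
  (forall i, 0 <= g i <= B) -> 0 < r -> r <= s ->
  rsummable (fun i => g i `^ r) -> rsummable (fun i => g i `^ s).
Proof.
move=> gB r0 rs sg; apply: (rsummable_le (g := fun i => B `^ (s - r) * g i `^ r)).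
  move=> i; have /andP[g0 gb] := gB i.
  have [->|gi0] := eqVneq (g i) 0.
    by rewrite !powR0 ?gt_eqF//; [rewrite normr0 mulr0|lra].
  have -> : g i `^ s = g i `^ (s - r) * g i `^ r.
    by rewrite -powRD ?subrK// gi0 implybT.
  rewrite ger0_norm ?mulr_ge0 ?powR_ge0//.
  by rewrite ler_wpM2r ?powR_ge0// ge0_ler_powR ?nnegrE ?subr_ge0// (le_trans g0).
exact: rsummableZ.
Qed.

Section parameters.
Variables (R : realType) (D : set R) (a : D).
Local Notation T := (dom a).
Variable k : T -> T -> R.
Hypothesis kaa0 : 0 < k a a.
Variable gamma : {fset nat} -> R.
Hypothesis gamma_ge0 : forall u, 0 <= gamma u.
Hypothesis gamma_down : forall u v : {fset nat}, (u `<=` v)%fset ->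
  0 < gamma v -> 0 < gamma u.
Variables (c C tau' alpha0 : R).
Hypothesis c_gt0 : 0 < c.
Hypothesis C_gt0 : 0 < C.
Hypothesis tau'_gt0 : 0 < tau'.
Hypothesis alpha0_gt0 : 0 < alpha0.
Hypothesis Lfin : (Lsum gamma alpha0 < +oo)%E.
Local Notation L := (fine (Lsum gamma alpha0)).
Local Notation Chat := (C_hat k C).
Local Notation np := (n_prime k gamma c C tau' alpha0).
Local Notation nof := (n_of k gamma c C tau' alpha0).
Local Notation QQ := (Qset k gamma c C tau' alpha0).

Definition gamma_pow (w : {fset nat}) : R := if w == fset0 then 0 else gamma w `^ (1 - alpha0).

Lemma gamma_pow_ge0 w : 0 <= gamma_pow w.
Proof. by rewrite /gamma_pow; case: ifP => // _; exact: powR_ge0. Qed.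

Lemma Lsum_gamma_pow : Lsum gamma alpha0 = (\esum_(u in setT) (gamma_pow u)%:E)%E.
Proof.
rewrite /Lsum esum_mkcond; apply: eq_esum => u _; rewrite /gamma_pow.
have [->|u0] := eqVneq u fset0; first by rewrite memNset//= eqxx.
by rewrite mem_set.
Qed.

Lemma gamma_pow_summable : rsummable gamma_pow.
Proof. by apply/(ge0_rsummable gamma_pow_ge0); rewrite -Lsum_gamma_pow. Qed.

Lemma asum_gamma_pow : asum gamma_pow = L.
Proof. by rewrite (ge0_asum gamma_pow_ge0 gamma_pow_summable) -Lsum_gamma_pow. Qed.

Lemma L_ge0 : 0 <= L.
Proof. by rewrite -asum_gamma_pow asum_ge0 ?gamma_pow_summable//; exact: gamma_pow_ge0. Qed.

Lemma L_gt0 u : u != fset0 -> 0 < gamma u -> 0 < L.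
Proof.
move=> u0 gu; apply: lt_le_trans (_ : gamma_pow u <= L).
  by rewrite /gamma_pow (negbTE u0) powR_gt0.
by rewrite -asum_gamma_pow le_asum1 ?gamma_pow_summable//; exact: gamma_pow_ge0.
Qed.

Lemma Chat_gt0 : 0 < Chat.
Proof. by rewrite /C_hat lt_max [X in _ || X]mulr_gt0// orbT. Qed.

Definition nbound (u : {fset nat}) : R :=
  c * L * Chat ^+ #|` u|%fset * gamma u `^ alpha0.

Lemma nboundE u : nbound u = c * L * (Chat ^+ #|` u|%fset * gamma u `^ alpha0).
Proof. by rewrite /nbound mulrA. Qed.

Lemma nbound_ge0 u : 0 <= nbound u.
Proof. by rewrite !mulr_ge0 ?powR_ge0 ?exprn_ge0 ?L_ge0// ltW// Chat_gt0. Qed.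

Variable eps : R.
Hypothesis eps_gt0 : 0 < eps.
Let e2_gt0 : 0 < eps ^+ 2. Proof. exact: exprn_gt0. Qed.

Let ratio_ge0 u : 0 <= nbound u / eps ^+ 2.
Proof. by rewrite divr_ge0 ?nbound_ge0 ?ltW. Qed.

Lemma n_prime_gt0 u : (0 < np eps u)%N = (eps ^+ 2 <= nbound u).
Proof.
rewrite /n_prime -/(nbound u); case: ltP => // h.
rewrite truncn_gt0 -(congr1 (fun h => h tau'^-1) (powR1 R)).
rewrite ge0_ler_powR ?nnegrE ?invr_ge0 ?(ltW tau'_gt0)//.
by rewrite ler_pdivlMr// mul1r.
Qed.

Lemma n_prime_le u : (np eps u)%:R <= (nbound u / eps ^+ 2) `^ tau'^-1.
Proof.
rewrite /n_prime -/(nbound u); case: ifP => _; first exact: powR_ge0.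
by rewrite -truncn_ge_nat// powR_ge0.
Qed.

(** Because n_u' is rounded down, n + 1 is at least the exact value (nbound u / eps^2)^(1 / tau').
    Below the threshold the ratio is at most 1 anyway. *)
Lemma nbound_le u n : (np eps u <= n)%N -> nbound u / eps ^+ 2 <= n.+1%:R `^ tau'.
Proof.
move=> un; have n1 : 1 <= n.+1%:R :> R by rewrite ler1n.
have [h|h] := ltP (nbound u) (eps ^+ 2).
  apply: (@le_trans _ _ 1); first by rewrite ler_pdivrMr// mul1r ltW.
  by rewrite powR_ge1// ltW.
have : (nbound u / eps ^+ 2) `^ tau'^-1 <= n.+1%:R.
  apply: (le_trans (ltW (truncnS_gt _))); rewrite ler_nat ltnS; apply: leq_trans un.
  by rewrite /n_prime -/(nbound u) ltNge h.
move=> h1; have -> : nbound u / eps ^+ 2 = ((nbound u / eps ^+ 2) `^ tau'^-1) `^ tau'.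
  by rewrite -powRrM mulVf ?gt_eqF// powRr1.
by rewrite ge0_ler_powR ?nnegrE ?powR_ge0// ltW.
Qed.

Lemma n_of_ge u : QQ eps u -> (0 < nof eps u)%N /\ (np eps u <= nof eps u)%N.
Proof.
rewrite /Qset/= /n_of; case: asboolP => // h _.
by rewrite leq_maxl leq_maxr.
Qed.

Lemma QsetP u : QQ eps u <-> exists v : {fset nat}, (u `<=` v)%fset /\ (0 < np eps v)%N.
Proof.
rewrite /Qset/= /n_of; case: asboolP => h; first by split => // _; rewrite leq_max.
by split => // /h.
Qed.

Lemma Qset_down u v : QQ eps u -> (v `<=` u)%fset -> QQ eps v.
Proof.
move=> /QsetP[w [uw nw]] vu; apply/QsetP; exists w; split => //.
exact: fsubset_trans uw.
Qed.

Lemma Qset_gamma u : QQ eps u -> 0 < gamma u.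
Proof.
move=> /QsetP[v [uv]]; rewrite n_prime_gt0 => h; apply: (gamma_down uv).
have := lt_le_trans e2_gt0 h; rewrite /nbound [0 < gamma v]lt_neqAle gamma_ge0 andbT.
by apply: contraTneq => <-; rewrite powR0 ?gt_eqF// mulr0 ltxx.
Qed.

Lemma gamma_split u : 0 < gamma u -> gamma u `^ alpha0 * gamma u `^ (1 - alpha0) = gamma u.
Proof.
by move=> g0; rewrite -powRD ?(gt_eqF g0) ?implybT// addrC subrK powRr1// ltW.
Qed.

(** Where n_w' = 0, Chat^|w| gamma_w^alpha0 is less than eps^2 / (c L) for L > 0. The remaining
    factor gamma_w^(1 - alpha0) is a summand of L, so the weights add up to at most eps^2 / c. *)
Definition bias_weight (w : {fset nat}) : R := eps ^+ 2 / (c * L) * gamma_pow w.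

Lemma bias_weight_ge0 w : 0 <= bias_weight w.
Proof.
by rewrite /bias_weight mulr_ge0 ?gamma_pow_ge0// divr_ge0 ?(ltW e2_gt0)// mulr_ge0 ?L_ge0// ltW.
Qed.

Lemma bias_weight_summable : rsummable bias_weight.
Proof. by apply: rsummableZ; exact: gamma_pow_summable. Qed.

Lemma asum_bias_weight : asum bias_weight <= eps ^+ 2 / c.
Proof.
rewrite asumZ ?asum_gamma_pow; last exact: gamma_pow_summable.
have [L0|L0] := eqVneq L 0; first by rewrite L0 mulr0 divr_ge0 ?ltW.
by rewrite invfM mulrA mulfVK.
Qed.

Lemma bias_weight_le w : w != fset0 -> ~ QQ eps w ->
  4 ^+ #|` w|%fset * (gamma w * k a a ^+ #|` w|%fset) <= bias_weight w.
Proof.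
move=> w0 wQ; have [g0|g0] := ltP 0 (gamma w); last first.
  have -> : gamma w = 0 by apply/eqP; rewrite eq_le g0 gamma_ge0.
  by rewrite mul0r mulr0 bias_weight_ge0.
have L0 := L_gt0 w0 g0.
have cL0 : 0 < c * L by rewrite mulr_gt0.
have nw : nbound w <= eps ^+ 2.
  apply: ltW; rewrite ltNge -n_prime_gt0; apply/negP => h.
  by apply: wQ; apply/QsetP; exists w; rewrite fsubset_refl.
have -> : 4 ^+ #|` w|%fset * (gamma w * k a a ^+ #|` w|%fset) =
    (4 * k a a) ^+ #|` w|%fset * gamma w by rewrite exprMn; ring.
(* This is where the second argument 4 k(a, a) of the maximum in [C_hat] is needed. *)
apply: (@le_trans _ _ (Chat ^+ #|` w|%fset * gamma w)).
  rewrite ler_wpM2r// lerXn2r ?nnegrE ?mulr_ge0 ?(ltW kaa0) ?(ltW Chat_gt0)//.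
  by rewrite /C_hat le_max lexx orbT.
rewrite -{1}(gamma_split g0) mulrA.
have -> : Chat ^+ #|` w|%fset * gamma w `^ alpha0 = nbound w / (c * L).
  by rewrite nboundE mulrAC divff ?mul1r// gt_eqF.
rewrite /bias_weight /gamma_pow (negbTE w0) ler_wpM2r ?powR_ge0//.
by rewrite ler_wpM2r// invr_ge0 ltW.
Qed.

(** By [nbound_le], (n_u + 1)^(-tau) cancels nbound u / eps^2, which uses up gamma_u^alpha0. The
    rest gamma_u^(1 - alpha0) sums to L over u, against the factor 1 / L. *)
Lemma var_term_le tau B A E m u : tau' <= tau -> 0 <= A -> 0 <= B -> 0 <= m ->
  u != fset0 -> QQ eps u -> m ^+ #|` u|%fset <= E ->
  m ^+ #|` u|%fset * (c * C ^+ #|` u|%fset * (nof eps u).+1%:R `^ (- tau) * B) *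
    (A * gamma u) <= E * B * A * (eps ^+ 2 / L) * gamma_pow u.
Proof.
move=> tt A0 B0 m0 u0 uQ mE; have g0 := Qset_gamma uQ; have L0 := L_gt0 u0 g0.
have [n0 npn] := n_of_ge uQ; set n := nof eps u in n0 npn *.
have h1 : n.+1%:R `^ (- tau) * (nbound u / eps ^+ 2) <= 1.
  apply: (@le_trans _ _ (n.+1%:R `^ (- tau) * n.+1%:R `^ tau')).
    by rewrite ler_wpM2l ?powR_ge0// nbound_le.
  rewrite -powRD ?pnatr_eq0 ?implybT// powR_le1 ?ler1n//; lra.
have h2 : c * C ^+ #|` u|%fset * gamma u `^ alpha0 <= nbound u / L.
  have -> : nbound u / L = c * Chat ^+ #|` u|%fset * gamma u `^ alpha0.
    by rewrite nboundE (mulrC c) -[L * c * _]mulrA mulrAC divff ?mul1r ?mulrA// gt_eqF.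
  rewrite ler_wpM2r ?powR_ge0// ler_wpM2l ?(ltW c_gt0)//.
  rewrite lerXn2r ?nnegrE ?(ltW Chat_gt0) ?(ltW C_gt0)//.
  by rewrite /C_hat le_max ler_peMr ?(ltW C_gt0)// lerDl ltW.
have E0 : 0 <= E by apply: le_trans mE; exact: exprn_ge0.
rewrite /gamma_pow (negbTE u0) -{1}(gamma_split g0).
set t := n.+1%:R `^ _ in h1 *; have t0 : 0 <= t by exact: powR_ge0.
set p := gamma u `^ alpha0 in h2 *; set q := gamma u `^ (1 - alpha0).
have q0 : 0 <= q by exact: powR_ge0.
apply: (@le_trans _ _ (E * B * A * (t * (nbound u / L)) * q)).
  have -> : m ^+ #|` u|%fset * (c * C ^+ #|` u|%fset * t * B) * (A * (p * q)) =
    m ^+ #|` u|%fset * (B * A * t * q * (c * C ^+ #|` u|%fset * p)) by ring.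
  have -> : E * B * A * (t * (nbound u / L)) * q = E * (B * A * t * q * (nbound u / L)) by ring.
  apply: ler_pM => //; rewrite ?exprn_ge0//.
    by rewrite !mulr_ge0// ?exprn_ge0 ?powR_ge0// ltW.
  by rewrite ler_wpM2l// !mulr_ge0.
rewrite ler_wpM2r// ler_wpM2l ?mulr_ge0// mulrA ler_wpM2r ?invr_ge0 ?(ltW L0)//.
by move: h1; rewrite mulrA ler_pdivrMr// mul1r.
Qed.

(** The decay is defined through gamma_hat but n_u' through gamma; [growth] replaces Chat when
    gamma_u^alpha0 is rewritten with gamma_hat. *)
Definition growth : R := Chat * k a a `^ (- alpha0).

Lemma nbound_gamma_hat u :
  nbound u = c * L * (growth ^+ #|` u|%fset * gamma_hat k gamma u `^ alpha0).
Proof.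
rewrite nboundE; congr (_ * _).
rewrite /gamma_hat powRM ?exprn_ge0 ?(ltW kaa0)// /growth exprMn.
have -> : (k a a ^+ #|` u|%fset) `^ alpha0 = (k a a `^ alpha0) ^+ #|` u|%fset.
  by rewrite -powR_mulrn ?(ltW kaa0)// powRAC powR_mulrn// powR_ge0.
rewrite powRN exprVn; set p := k a a `^ alpha0.
have p0 : p ^+ #|` u|%fset != 0 by rewrite expf_neq0// gt_eqF// powR_gt0.
by move: (p ^+ _) p0 (Chat ^+ _) => q q0 x; field.
Qed.

Hypothesis gamma_hat_summable :
  rsummable (fun u => gamma_hat k gamma u `^ (alpha0 / tau')).
Variable E : R.
Hypothesis E0 : 0 <= E.
Hypothesis growthE : forall u, QQ eps u -> growth ^+ #|` u|%fset <= E.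
Hypothesis twoE : forall u, QQ eps u -> 2 ^+ #|` u|%fset <= E.

Definition nsum (u : {fset nat}) : R :=
  (c * L * E / eps ^+ 2) `^ tau'^-1 * gamma_hat k gamma u `^ (alpha0 / tau').

Lemma nsum_ge0 u : 0 <= nsum u.
Proof. by rewrite mulr_ge0 ?powR_ge0. Qed.

Lemma nsum_summable : rsummable nsum.
Proof. exact: rsummableZ. Qed.

Lemma n_prime_Qset u : (0 < np eps u)%N -> QQ eps u.
Proof. by move=> h; apply/QsetP; exists u; rewrite fsubset_refl. Qed.

Lemma n_prime_le_nsum u : (0 < np eps u)%N -> (np eps u)%:R <= nsum u.
Proof.
move=> h; apply: le_trans (n_prime_le u) _.
have gE := growthE (n_prime_Qset h).
have g0 : 0 <= growth ^+ #|` u|%fset.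
  by rewrite exprn_ge0// mulr_ge0 ?powR_ge0// ltW// Chat_gt0.
have cL0 : 0 <= c * L by rewrite mulr_ge0 ?L_ge0// ltW.
have cLE0 : 0 <= c * L * E / eps ^+ 2 by rewrite divr_ge0 ?(ltW e2_gt0)// mulr_ge0.
rewrite /nsum powRrM -powRM// ?powR_ge0//.
rewrite ge0_ler_powR ?nnegrE ?ratio_ge0 ?invr_ge0 ?(ltW tau'_gt0)//.
  by rewrite mulr_ge0 ?powR_ge0.
rewrite nbound_gamma_hat [leRHS]mulrAC ler_wpM2r ?invr_ge0 ?(ltW e2_gt0)//.
by rewrite -[leRHS]mulrA ler_wpM2l// ler_wpM2r ?powR_ge0.
Qed.

(** n_u' >= 1 forces the summable [nsum] to be at least 1, which happens only finitely often. The
    set Q(eps) is then finite as well. *)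
Lemma finite_n_prime : finite_set [set u | (0 < np eps u)%N].
Proof.
apply: sub_finite_set (finite_ge1_rsummable nsum_ge0 nsum_summable) => u /= h.
by apply: le_trans (n_prime_le_nsum h); rewrite ler1n.
Qed.

Lemma finite_Qset : finite_set (QQ eps).
Proof.
apply: (@sub_finite_set _ _ (\bigcup_(v in [set u | (0 < np eps u)%N]) [set` fpowerset v])).
  by move=> u /QsetP[v [uv nv]]; exists v => //=; rewrite fpowersetE.
by apply: bigcup_finite finite_n_prime _ => v _; exact: finite_seq.
Qed.

(** Each u in Q(eps) has n_u at most the sum of n_v' over v containing u: either n_u = n_u', or n_u
    = 1 and some such v has n_v' >= 1. After exchanging the sums, v is counted at most 2^|v| <= E
    times. *)
Lemma sum_n_of_le :
  \sum_(u <- fset_set (QQ eps)) (nof eps u)%:R <= E * asum nsum.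
Proof.
set Q := fset_set _; pose P := fset_set [set u | (0 < np eps u)%N].
have PE v : (v \in P) = (0 < np eps v)%N.
  rewrite in_fset_set; last exact: finite_n_prime.
  by apply/idP/idP => [/set_mem|h]; last exact/mem_set.
have QE v : v \in Q -> QQ eps v.
  by rewrite in_fset_set; [exact: set_mem|exact: finite_Qset].
have np0 v : 0 <= (np eps v)%:R :> R by exact: ler0n.
apply: (@le_trans _ _ (\sum_(u <- Q) \sum_(v <- P | (u `<=` v)%fset) (np eps v)%:R)).
  rewrite big_seq [leRHS]big_seq; apply: ler_sum => u /QE/QsetP[v [uv nv]].
  have le w : (u `<=` w)%fset -> (0 < np eps w)%N ->
      (np eps w)%:R <= \sum_(v <- P | (u `<=` v)%fset) (np eps v)%:R :> R.
    move=> uw nw; rewrite big_mkcond (bigD1_seq w) ?fset_uniq ?PE//= uw lerDl.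
    by apply: sumr_ge0 => z _; case: ifP.
  rewrite /n_of; case: ifP => _; last by apply: sumr_ge0.
  have [nu|nu] := ltP 0%N (np eps u).
    by rewrite (maxn_idPr nu) le.
  rewrite (maxn_idPl (leq_trans nu _))//; apply: le_trans (le v uv nv).
  by rewrite ler_nat.
rewrite (exchange_big_dep predT)//=.
apply: (@le_trans _ _ (\sum_(v <- P) E * nsum v)).
  rewrite big_seq [leRHS]big_seq; apply: ler_sum => v vP.
  have nv : (0 < np eps v)%N by rewrite -PE.
  rewrite big_fset_condE/= big_const_seq count_predT iter_addr_0 -[leLHS]mulr_natl.
  apply: ler_pM => //; last exact: n_prime_le_nsum.
  apply: le_trans (twoE (n_prime_Qset nv)).
  rewrite -natrX ler_nat -card_fpowerset; apply: fsubset_leq_card.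
  by apply/fsubsetP => u; rewrite !inE fpowersetE => /andP[].
rewrite -mulr_sumr ler_wpM2l// sum_le_asum ?fset_uniq//.
- exact: nsum_ge0.
- exact: nsum_summable.
Qed.

Lemma asum_nsum : asum nsum = (c * L * E / eps ^+ 2) `^ tau'^-1 *
  asum (fun u => gamma_hat k gamma u `^ (alpha0 / tau')).
Proof. exact: asumZ. Qed.

End parameters.

Section estimates_to_algorithms.
Variables (R : realType) (D : set R) (a : D).
Local Notation T := (dom a).
Variable k : T -> T -> R.
Hypothesis k_meas : measurable_fun setT (fun z : T * T => k z.1 z.2).
Hypothesis k_diag : forall x : T, 0 < k x x.
Local Notation NT := (prodspace nat T).
Variables (rho : probability T R) (mu : probability NT R).
Hypothesis mu_prod : is_prod_measure rho mu.
Variable M : R.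
Hypothesis M_def : (\int[rho]_x (k x x)%:E = M%:E)%E.
Hypothesis k_int0 : forall y, (\int[rho]_x (k x y)%:E = 0)%E.
Hypothesis k_rk : rkhs k.
Variable Hu : forall u, rkhs (@kprod R D a k u).
Variable gamma : {fset nat} -> R.
Hypothesis gamma_ge0 : forall u, 0 <= gamma u.
Hypothesis gamma_sum :
  (\esum_(u in [set: {fset nat}]) (gamma u * M ^+ #|` u|%fset)%:E < +oo)%E.
Hypothesis gamma_down : forall u v : {fset nat}, (u `<=` v)%fset ->
  0 < gamma v -> 0 < gamma u.
Hypothesis a_anchor :
  (\esum_(u in [set: {fset nat}]) (gamma u * k a a ^+ #|` u|%fset)%:E < +oo)%E.
Variable HK : rkhs (@Kker R D a k gamma).
Variable dollar : nat -> \bar R.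
Hypothesis dollar_ge0 : forall n, (0 <= dollar n)%E.
Hypothesis dollar_mono : forall m n, (m <= n)%N -> (dollar m <= dollar n)%E.
Variables (sigma S0 : R).
Hypothesis sigma_ge0 : 0 <= sigma.
Hypothesis dollar_le : forall n, (dollar n <= (S0 * expR (sigma * n%:R))%:E)%E.
Variables (c C tau alpha1 alpha2 A : R).
Hypothesis c_gt0 : 0 < c.
Hypothesis C_gt0 : 0 < C.
Hypothesis quad : quad_assumption gamma mu rho Hu c C tau alpha1 alpha2.
Hypothesis A_ge0 : 0 <= A.
Hypothesis rsqA : forall u, (rsq k gamma u <= (A * gamma u)%:E)%E.
Local Notation m := (Num.max 1 (k a a)).

Definition has_alg (tot e2 : R) := exists Q' : rand_alg R (Xdom k gamma),
  [/\ A_res dollar HK Q',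
    (cost dollar Q' (rk_ball HK) <= tot%:E)%E &
    (error mu Q' (rk_ball HK) <= (Num.sqrt e2)%:E)%E].

Lemma has_alg_le tot tot' e e' : tot <= tot' -> e <= e' ->
  has_alg tot e -> has_alg tot' e'.
Proof.
move=> tt ee [Q [h1 h2 h3]]; exists Q; split => //.
- by apply: le_trans h2 _; rewrite lee_fin.
- by apply: le_trans h3 _; rewrite lee_fin ler_wsqrtr.
Qed.

Let S0_ge0 : 0 <= S0.
Proof.
have := le_trans (dollar_ge0 0) (dollar_le 0).
by rewrite lee_fin mulr0 expR0 mulr1.
Qed.

Variables (tau' alpha0 : R).
Hypothesis tau'_gt0 : 0 < tau'.
Hypothesis tau'_le : tau' <= tau.
Hypothesis alpha0_gt0 : 0 < alpha0.
Hypothesis Lfin : (Lsum gamma alpha0 < +oo)%E.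
Hypothesis gamma_hat_summable :
  rsummable (fun u => gamma_hat k gamma u `^ (alpha0 / tau')).
Local Notation L := (fine (Lsum gamma alpha0)).
Local Notation nof := (n_of k gamma c C tau' alpha0).
Local Notation QQ := (Qset k gamma c C tau' alpha0).
Local Notation kaa0 := (k_diag (a : T)).

(* As d(eps) = o(ln(1/eps)), base^|u| = eps^(-o(1)) uniformly in u in Q(eps); this
   absorbs all factors that are exponential in |u|. *)
Definition base : R :=
  Num.max (4 * m) (Num.max (2 * expR sigma) (growth k C alpha0)).

(** In the cost, one E stems from 2^|u| $(|u|), one from the count of supersets, and E^(1 / tau')
    from [growth]. In the squared error, one E stems from (4 m)^|u| and one from F_w(n_u). *)
Lemma has_alg_eps eps E : 0 < eps -> 1 <= E ->
  (forall u, QQ eps u -> base ^+ #|` u|%fset <= E) ->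
  (forall u w, QQ eps u -> (w `<=` u)%fset ->
    Fw alpha1 alpha2 #|` w|%fset (nof eps u) <= E) ->
  has_alg
    (S0 + S0 * E * (E * ((c * L * E / eps ^+ 2) `^ tau'^-1 *
       asum (fun u => gamma_hat k gamma u `^ (alpha0 / tau')))))
    (eps ^+ 2 / c + E * E * A * eps ^+ 2).
Proof.
move=> eps0 E1 baseE FE.
have E0 : 0 <= E by lra.
have m1 : 1 <= m by rewrite le_max lexx.
have es1 : 1 <= expR sigma by rewrite -expR0 ler_expR.
have powle x u : 0 <= x -> x <= base -> QQ eps u -> x ^+ #|` u|%fset <= E.
  move=> x0 xb uQ; apply: le_trans (baseE u uQ).
  by rewrite lerXn2r ?nnegrE// (le_trans x0).
have gr0 : 0 <= growth k C alpha0.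
  by rewrite mulr_ge0 ?powR_ge0// ltW// Chat_gt0.
have grE u : QQ eps u -> growth k C alpha0 ^+ #|` u|%fset <= E.
  by apply: powle => //; rewrite /base !le_max lexx !orbT.
have twoE u : QQ eps u -> 2 ^+ #|` u|%fset <= E.
  by apply: powle => //; rewrite /base !le_max ler_peMr// orbT.
have fourE u : QQ eps u -> (4 * m) ^+ #|` u|%fset <= E.
  by apply: powle; [rewrite mulr_ge0//; lra|rewrite /base !le_max lexx].
have expE u : QQ eps u -> (2 * expR sigma) ^+ #|` u|%fset <= E.
  by apply: powle; [lra|rewrite /base !le_max lexx orbT].
have fQ := finite_Qset kaa0 gamma_ge0 c_gt0 tau'_gt0 Lfin eps0 gamma_hat_summable E0 grE.
(* [Qset] is empty if no n_v' is positive, while the bias bound wants fset0 in Q; so it is added by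
   hand. *)
pose Q := (fset0 |` fset_set (QQ eps))%fset.
have QE u : u \in Q -> u != fset0 -> QQ eps u.
  by rewrite in_fset1U => /orP[/eqP ->|]; [rewrite eqxx|rewrite in_fset_set// => /set_mem].
have QE' u : QQ eps u -> u \in Q.
  by move=> h; rewrite in_fset1U in_fset_set// mem_set ?orbT.
have gQ u : QQ eps u -> 0 < gamma u.
  exact: (Qset_gamma kaa0 gamma_ge0 gamma_down c_gt0 tau'_gt0 alpha0_gt0 Lfin eps0).
have [] := @exists_cda_alg R D a k k_meas k_diag rho mu mu_prod M M_def k_int0 k_rk Hu
  gamma gamma_ge0 gamma_sum gamma_down a_anchor HK dollar dollar_ge0 dollar_mono
  (fun n => S0 * expR (sigma * n%:R)) dollar_le c C tau alpha1 alpha2 A (ltW c_gt0)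
  (ltW C_gt0) quad rsqA Q (nof eps) E (bias_weight gamma c alpha0 eps).
- exact: E0.
- exact: A_ge0.
- by rewrite in_fset1U eqxx.
- move=> u v uQ vu; have [u0|u0] := eqVneq u fset0.
    by move: vu; rewrite u0 fsubset0 => /eqP ->; rewrite in_fset1U eqxx.
  apply: QE'; exact: (Qset_down (QE u uQ u0) vu).
- by move=> u uQ u0; exact: gQ (QE u uQ u0).
- by move=> u uQ u0; have [] := n_of_ge (QE u uQ u0).
- by move=> u w uQ u0; exact: FE (QE u uQ u0).
- exact: bias_weight_summable.
- exact: bias_weight_ge0.
- move=> w; rewrite in_fset1U negb_or => /andP[w0 wQ].
  apply: (bias_weight_le (C := C) kaa0 gamma_ge0 c_gt0 tau'_gt0 Lfin eps0 w0).
  by move=> h; move: wQ; rewrite in_fset_set// mem_set.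
move=> Q' h; apply: (has_alg_le _ _ (ex_intro _ Q' h)); last first.
  rewrite lerD ?asum_bias_weight//.
  apply: (@le_trans _ _ (\sum_(u <- (Q `\ fset0)%fset)
     E * E * A * (eps ^+ 2 / L) * gamma_pow gamma alpha0 u)).
    rewrite big_seq [leRHS]big_seq; apply: ler_sum => u.
    rewrite in_fsetD1 => /andP[u0 uQ]; have uQ' := QE u uQ u0.
    apply: (var_term_le kaa0 gamma_ge0 gamma_down c_gt0 C_gt0 tau'_gt0 alpha0_gt0
      Lfin eps0 tau'_le A_ge0 E0 _ u0 uQ' (fourE u uQ')).
    by rewrite mulr_ge0//; lra.
  have L0 := L_ge0 Lfin.
  rewrite -mulr_sumr; apply: (@le_trans _ _ (E * E * A * (eps ^+ 2 / L) * L)).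
    rewrite ler_wpM2l ?mulr_ge0 ?invr_ge0 ?(ltW eps0)//.
    rewrite -(asum_gamma_pow Lfin) sum_le_asum ?fset_uniq//; first exact: gamma_pow_ge0.
    exact: gamma_pow_summable.
  rewrite -mulrA ler_wpM2l ?mulr_ge0//.
  have [->|Ln] := eqVneq L 0; first by rewrite mulr0 sqr_ge0.
  by rewrite mulfVK.
rewrite mulr0 expR0 mulr1 lerD2l.
apply: (@le_trans _ _ (S0 * E * \sum_(u <- fset_set (QQ eps)) (nof eps u)%:R)).
  rewrite mulr_sumr.
  apply: (@le_trans _ _ (\sum_(u <- (Q `\ fset0)%fset) S0 * E * (nof eps u)%:R)).
    rewrite big_seq [leRHS]big_seq; apply: ler_sum => u.
    rewrite in_fsetD1 => /andP[u0 uQ]; have uQ' := QE u uQ u0.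
    have := expE u uQ'; rewrite exprMn -expRM_natr => h1.
    have -> : (nof eps u)%:R * 2 ^+ #|` u|%fset * (S0 * expR (sigma * #|` u|%fset%:R)) =
      S0 * (2 ^+ #|` u|%fset * expR (sigma * #|` u|%fset%:R)) * (nof eps u)%:R by ring.
    by rewrite ler_wpM2r// ler_wpM2l.
  have t0 : 0 <= S0 * E * (nof eps fset0)%:R by rewrite !mulr_ge0.
  rewrite /Q; have [h0|h0] := boolP (fset0 \in fset_set (QQ eps)).
    by rewrite mem_fset1U// [leRHS](big_fsetD1 _ h0)/= lerDr.
  by rewrite fsetU1K.
rewrite ler_wpM2l ?mulr_ge0// -(asum_nsum _ _ gamma_hat_summable).
exact: (sum_n_of_le kaa0 gamma_ge0 c_gt0 tau'_gt0 Lfin eps0 gamma_hat_summable E0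
  grE twoE).
Qed.

Lemma base_ge4 : 4 <= base.
Proof.
rewrite /base le_max; apply/orP; left.
by rewrite ler_peMr// le_max lexx.
Qed.

Lemma has_alg_rate : estimates k gamma c C alpha1 alpha2 tau' alpha0 ->
  forall eta, 0 < eta -> exists K e0 : R, [/\ 0 < K, 0 < e0 &
    forall eps, 0 < eps < e0 ->
      has_alg (K * eps `^ (- (2 / tau') - eta)) (K * eps `^ (2 - eta))].
Proof.
move=> [dest Best] eta eta0.
have lb0 : 0 < ln base by rewrite ln_gt0//; have := base_ge4; lra.
have t0 : 0 < tau'^-1 by rewrite invr_gt0.
(* With E = eps^(-eta1) the cost carries E^(2 + 1 / tau') = eps^(-eta), and the squared error
   carries E^2, which is at most eps^(-eta). *)
pose eta1 := eta / (2 + tau'^-1).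
have eta10 : 0 < eta1 by rewrite divr_gt0// addr_gt0.
have etaE : eta1 * 2 + eta1 * tau'^-1 = eta.
  by rewrite -mulrDr divfK// gt_eqF// addr_gt0.
have et0 : 0 < eta1 * tau'^-1 by rewrite mulr_gt0.
pose s0 := asum (fun u => gamma_hat k gamma u `^ (alpha0 / tau')).
have s00 : 0 <= s0 by apply: asum_ge0 => // u; exact: powR_ge0.
pose Z := S0 * ((c * L) `^ tau'^-1 * s0).
have Z0 : 0 <= Z by rewrite mulr_ge0 ?mulr_ge0 ?powR_ge0.
pose K := S0 + Z + c^-1 + A + 1.
have ci0 : 0 < c^-1 by rewrite invr_gt0.
have [K1 K2 K0] : [/\ S0 + Z <= K, c^-1 + A <= K & 0 < K].
  have aux (x z i y : R) : 0 <= x -> 0 <= z -> 0 < i -> 0 <= y ->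
      [/\ x + z <= x + z + i + y + 1, i + y <= x + z + i + y + 1 &
        0 < x + z + i + y + 1] by move=> *; split; lra.
  exact: aux.
have near : \forall eps \near 0^'+,
    has_alg (K * eps `^ (- (2 / tau') - eta)) (K * eps `^ (2 - eta)).
  near=> eps.
  have e0 : 0 < eps by near: eps; exact: nbhs_right_gt.
  have e1 : eps < 1 by near: eps; exact: nbhs_right_lt.
  (* The division by ln base is what gives base^|u| <= eps^(-eta1) for u in Q(eps). *)
  have dE : (d_eps k gamma c C tau' alpha0 eps <= (eta1 / ln base * ln eps^-1)%:E)%E.
    by near: eps; apply: dest; rewrite divr_gt0.
  have BE : (B_eps k gamma c C alpha1 alpha2 tau' alpha0 eps <= (eps `^ (- eta1))%:E)%E.
    by near: eps; exact: Best.
  have mono x y : x <= y -> eps `^ y <= eps `^ x.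
    by move=> xy; rewrite ger_powR// e0 ltW.
  have mono1 x : x <= 0 -> 1 <= eps `^ x by move=> /mono; rewrite powRr0.
  have E1 : 1 <= eps `^ (- eta1) by apply: mono1; lra.
  have := has_alg_eps e0 E1 _ _; set E := eps `^ (- eta1).
  have -> : E * E * A * eps ^+ 2 = A * eps `^ (2 - 2 * eta1).
    rewrite -powR_mulrn ?(ltW e0)// /E -powRD ?(gt_eqF e0) ?implybT//.
    rewrite mulrAC mulrC -powRD ?(gt_eqF e0) ?implybT//; congr (_ * _ `^ _); lra.
  have -> : S0 + S0 * E * (E * ((c * L * E / eps ^+ 2) `^ tau'^-1 * s0)) =
      S0 + Z * eps `^ (- (2 / tau') - 2 * eta1 - eta1 / tau').
    have cL0 : 0 <= c * L by rewrite mulr_ge0 ?L_ge0// ltW.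
    have -> : c * L * E / eps ^+ 2 = c * L * eps `^ (- eta1 - 2).
      rewrite -[LHS]mulrA; congr (_ * _).
      by rewrite -powR_mulrn ?(ltW e0)// /E powRB ?(gt_eqF e0) ?implybT.
    rewrite powRM ?powR_ge0//.
    have -> : eps `^ (- (2 / tau') - 2 * eta1 - eta1 / tau') =
       E * E * (eps `^ (- eta1 - 2)) `^ tau'^-1.
      rewrite -powRrM /E -!powRD ?(gt_eqF e0) ?implybT//; congr (_ `^ _); ring.
    by rewrite /Z; ring.
  move=> h; apply: has_alg_le (h _ _).
  - have h1 : 1 <= eps `^ (- (2 / tau') - eta).
      have : 0 < 2 / tau' by rewrite divr_gt0.
      by move=> h2; apply: mono1; lra.
    have h2 : eps `^ (- (2 / tau') - 2 * eta1 - eta1 / tau') <= eps `^ (- (2 / tau') - eta).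
      by apply: mono; lra.
    have h3 := ler_wpM2l S0_ge0 h1; have h4 := ler_wpM2l Z0 h2.
    apply: (@le_trans _ _ ((S0 + Z) * eps `^ (- (2 / tau') - eta))); first by lra.
    by rewrite ler_wpM2r ?powR_ge0.
  - have h1 : eps ^+ 2 <= eps `^ (2 - eta).
      by rewrite -powR_mulrn ?(ltW e0)// mono//; lra.
    have h2 : eps `^ (2 - 2 * eta1) <= eps `^ (2 - eta) by apply: mono; lra.
    have h3 := ler_wpM2l A_ge0 h2; have h4 := ler_wpM2r (ltW ci0) h1.
    apply: (@le_trans _ _ ((c^-1 + A) * eps `^ (2 - eta))); first by lra.
    by rewrite ler_wpM2r ?powR_ge0.
  - move=> u uQ; have b1 : 1 <= base by have := base_ge4; lra.
    have b0 : 0 < base by lra.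
    have uE : #|` u|%fset%:R <= eta1 / ln base * ln eps^-1.
      rewrite -lee_fin; apply: le_trans dE; apply: ereal_sup_ubound.
      by exists u.
    rewrite -powR_mulrn ?(ltW b0)//; apply: (le_trans (ler_powR b1 uE)).
    rewrite /E /powR (gt_eqF b0) (gt_eqF e0) lnV ?posrE// ler_expR.
    by rewrite mulrAC divfK ?gt_eqF// mulrN mulNr.
  - move=> u w uQ wu; rewrite -lee_fin; apply: le_trans BE.
    by apply: ereal_sup_ubound; exists u, w.
have [e0 /= e00 eP] : exists2 e0 : R, 0 < e0 & forall eps, 0 < eps < e0 ->
    has_alg (K * eps `^ (- (2 / tau') - eta)) (K * eps `^ (2 - eta)).
  case: near => e0 /= e00 eP; exists e0 => // eps /andP[e1 e2]; apply: eP => //=.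
  by rewrite sub0r normrN gtr0_norm.
by exists K, e0.
Unshelve. all: by end_near.
Qed.

End estimates_to_algorithms.

(** * Convergence rates *)

Section complexity.
Variables (R : realType) (D : set R) (a : D).
Local Notation T := (dom a).
Variable k : T -> T -> R.
Variable mu : probability (prodspace nat T) R.
Variable gamma : {fset nat} -> R.
Variable HK : rkhs (@Kker R D a k gamma).
Variable dollar : nat -> \bar R.
Local Notation has_alg := (has_alg mu HK dollar).
Local Notation comp := (Defs.comp mu dollar HK).
Local Notation min_error N := (min_error mu dollar HK N (rk_ball HK)).

Definition has_rate (tau' : R) := forall eta, 0 < eta ->
  exists K e0 : R, [/\ 0 < K, 0 < e0 &
    forall eps, 0 < eps < e0 ->
      has_alg (K * eps `^ (- (2 / tau') - eta)) (K * eps `^ (2 - eta))].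

Lemma min_error_ge0 N : (0 <= min_error N)%E.
Proof. by apply: le_ereal_inf_tmp => _ [Q [_ _ ->]]; exact: sqrte_ge0. Qed.

Lemma min_error_le N e2 : 0 <= e2 -> has_alg N e2 -> (min_error N ^+ 2 <= e2%:E)%E.
Proof.
move=> e20 [Q [h1 h2 h4]].
have le : (min_error N <= (Num.sqrt e2)%:E)%E.
  by apply: le_trans h4; apply: ereal_inf_lbound; exists Q.
by rewrite -(sqr_sqrtr e20) EFinM; apply: lee_pmul => //; exact: min_error_ge0.
Qed.

Lemma min_error_rate tau' delta : 0 < tau' -> has_rate tau' -> 0 < delta ->
  exists A : R, \forall N \near +oo,
    (min_error N ^+ 2 <= (A * N `^ (- tau' + delta))%:E)%E.
Proof.
move=> t0 rate d0.
(* (2 - eta) / q >= tau' - delta follows from eta (1 + tau') <= 2 delta / tau'; this eta is half of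
   the largest one allowed. *)
pose eta := delta / (tau' * (1 + tau')).
have tt0 : 0 < 1 + tau' by rewrite addr_gt0.
have eta0 : 0 < eta by rewrite divr_gt0// mulr_gt0.
have [K [e0 [K0 e00 algP]]] := rate eta eta0.
pose q := 2 / tau' + eta.
have q0 : 0 < q by rewrite addr_gt0// divr_gt0.
have expo : - ((2 - eta) / q) <= - tau' + delta.
  have h : eta * (tau' * (1 + tau')) = delta by rewrite divfK// gt_eqF// mulr_gt0.
  suff : (tau' - delta) * q <= 2 - eta by rewrite -ler_pdivlMr//; lra.
  have h2 : tau' * q = 2 + tau' * eta.
    by rewrite /q mulrDr mulrCA divff ?mulr1// gt_eqF.
  have h3 : 0 <= delta * eta by rewrite mulr_ge0 ?(ltW d0) ?(ltW eta0).
  have h4 : delta * (2 / tau') = 2 * eta * (1 + tau').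
    by rewrite -h; field; rewrite gt_eqF.
  have h5 : 0 <= tau' * eta by rewrite mulr_ge0 ?ltW.
  rewrite mulrBl h2 (_ : delta * q = 2 * eta * (1 + tau') + delta * eta); last first.
    by rewrite /q mulrDr h4.
  by lra.
exists (K * K `^ (tau' - delta)); near=> N.
have N0 : 0 < N by near: N; apply: nbhs_pinfty_gt; exact: num_real.
have NK : K < N by near: N; apply: nbhs_pinfty_gt; exact: num_real.
have NKe : K * e0 `^ (- q) < N by near: N; apply: nbhs_pinfty_gt; exact: num_real.
pose x := N / K; have x1 : 1 < x by rewrite /x ltr_pdivlMr// mul1r.
have x0 : 0 < x by lra.
(* Solves K eps^(-q) = N, so the cost bound of the algorithm for eps is exactly the budget N. *)
pose eps := x `^ (- q^-1).
have epsq r : eps `^ r = x `^ (- (r / q)).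
  by rewrite /eps -powRrM mulNr mulrC.
have := algP eps; have -> : 0 < eps < e0.
  rewrite powR_gt0//=.
  have -> : e0 = (e0 `^ (- q)) `^ (- q^-1).
    by rewrite -powRrM mulrNN divff ?gt_eqF// powRr1// ltW.
  rewrite /eps !powRN ltf_pV2 ?posrE ?powR_gt0 ?invr_gt0 ?powR_gt0//.
  rewrite gt0_ltr_powR ?invr_gt0// ?nnegrE ?invr_ge0 ?powR_ge0 ?(ltW x0)//.
  by rewrite /x ltr_pdivlMr// mulrC -powRN.
move=> /(_ isT); rewrite !epsq.
have -> : - ((- (2 / tau') - eta) / q) = 1.
  by rewrite -opprD mulNr opprK divff// gt_eqF.
rewrite powRr1 ?(ltW x0)// /x mulrCA divff ?gt_eqF// mulr1 -/x => h.
apply: le_trans (min_error_le _ h) _; first by rewrite mulr_ge0 ?powR_ge0 ?ltW.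
rewrite lee_fin -mulrA ler_wpM2l ?(ltW K0)//.
apply: (le_trans (ler_powR (ltW x1) expo)).
rewrite /x powRM ?invr_ge0 ?(ltW N0) ?(ltW K0)// mulrC ler_wpM2r ?powR_ge0//.
by rewrite -[K^-1]powR_inv1 ?(ltW K0)// -powRrM mulN1r opprD opprK.
Unshelve. all: by end_near.
Qed.

Lemma comp_le_cost (Q : rand_alg R (Xdom k gamma)) eps : A_res dollar HK Q ->
  (error mu Q (rk_ball HK) <= eps%:E)%E ->
  (comp eps <= cost dollar Q (rk_ball HK))%E.
Proof. by move=> h1 h2; apply: ereal_inf_lbound; exists Q. Qed.

Lemma comp_le e2 tot eps : 0 < eps -> e2 <= eps ^+ 2 -> has_alg tot e2 ->
  (comp eps <= tot%:E)%E.
Proof.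
move=> e0 ee [Q [h1 h2 h4]]; apply: le_trans h2.
apply: comp_le_cost h1 _; apply: le_trans h4 _.
by rewrite lee_fin -(ger0_norm (ltW e0)) -sqrtr_sqr ler_wsqrtr.
Qed.

Lemma comp_anti e e' : e <= e' -> (comp e' <= comp e)%E.
Proof.
move=> ee; apply: ereal_inf_le_tmp => _ [Q [h1 h2 ->]]; exists Q; split => //.
by apply: le_trans h2 _; rewrite lee_fin.
Qed.

Lemma comp_rate tau' p : 0 < tau' -> has_rate tau' -> 2 / tau' < p ->
  exists B e1 : R, [/\ 0 < B, 0 < e1 & forall eps, 0 < eps < e1 ->
    (comp eps <= (B * eps `^ (- p))%:E)%E].
Proof.
move=> t0 rate pt.
have r0 : 0 < 2 / tau' by rewrite divr_gt0.
have p0 : 0 < p by lra.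
have pp0 : 0 < 2 + p by lra.
(* Small enough for (2 / tau' + eta) / (2 - eta) <= p / 2. *)
pose eta := (p - 2 / tau') / (2 + p).
have eta0 : 0 < eta by rewrite divr_gt0// subr_gt0.
have etaE : eta * (2 + p) = p - 2 / tau' by rewrite divfK// gt_eqF.
have eta1 : 0 < 2 - eta.
  have : eta < 1 by rewrite /eta ltr_pdivrMr// mul1r; lra.
  lra.
have [K [e0 [K0 e00 algP]]] := rate eta eta0.
pose q := 2 / tau' + eta.
(* The two bounds keep x = eps^2 / K below 1, where powers decrease in the exponent, and e1 below
   e0. *)
pose b := Num.min K (K * e0 `^ (2 - eta)).
have b0 : 0 < b by rewrite /b lt_min K0 mulr_gt0 ?powR_gt0.
exists (K * K `^ (p / 2)), (Num.sqrt b); split.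
- by rewrite mulr_gt0 ?powR_gt0.
- by rewrite sqrtr_gt0.
move=> eps /andP[eps0 epsb].
have eb : eps ^+ 2 < b by rewrite -(sqr_sqrtr (ltW b0)) ltrXn2r ?nnegrE ?sqrtr_ge0 ?ltW.
have e2 : 0 < eps ^+ 2 by exact: exprn_gt0.
pose x := eps ^+ 2 / K; have x0 : 0 < x by rewrite divr_gt0.
have xK : K * x = eps ^+ 2 by rewrite /x mulrCA divff ?mulr1// gt_eqF.
have x1 : x < 1 by rewrite /x ltr_pdivrMr// mul1r (lt_le_trans eb)// /b ge_min lexx.
have xe : x < e0 `^ (2 - eta).
  by rewrite /x ltr_pdivrMr// mulrC (lt_le_trans eb)// /b ge_min lexx orbT.
(* Solves K e1^(2 - eta) = eps^2, so the squared error is bounded by eps^2. *)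
pose e1 := x `^ (2 - eta)^-1.
have e1r r : e1 `^ r = x `^ ((2 - eta)^-1 * r) by rewrite /e1 -powRrM.
have := algP e1; have -> : 0 < e1 < e0.
  rewrite powR_gt0//=.
  have -> : e0 = (e0 `^ (2 - eta)) `^ (2 - eta)^-1.
    by rewrite -powRrM divff ?gt_eqF// powRr1// ltW.
  by rewrite gt0_ltr_powR ?invr_gt0// nnegrE ?powR_ge0// ltW.
move=> /(_ isT); rewrite !e1r mulVf ?gt_eqF// powRr1 ?(ltW x0)// xK => h.
apply: le_trans (comp_le eps0 (lexx _) h) _.
rewrite lee_fin -mulrA ler_wpM2l ?(ltW K0)//.
apply: (@le_trans _ _ (x `^ (- (p / 2)))).
  apply: ger_powR; first by rewrite x0 ltW.
  rewrite -opprD mulrN lerN2 -/q mulrC ler_pdivrMr//.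
  by rewrite /q; nra.
rewrite /x powRM ?invr_ge0 ?(ltW e2) ?(ltW K0)// mulrC.
have -> : K^-1 `^ (- (p / 2)) = K `^ (p / 2).
  by rewrite -[K^-1]powR_inv1 ?(ltW K0)// -powRrM mulN1r opprK.
rewrite -powR_mulrn ?(ltW eps0)// -powRrM ler_wpM2l ?powR_ge0//.
by rewrite mulrN mulrCA divff ?mulr1// pnatr_eq0.
Qed.

(** A bound is needed at every eps > 0. Small eps are covered by [comp_rate], and eps >= z0 costs
    nothing. In between [comp] is bounded by monotonicity, and z0^p eps^(-p) >= 1 supplies the power
    of eps. *)
Lemma p_res_le tau' z0 p : 0 < tau' -> has_rate tau' -> 2 / tau' < p ->
  0 < z0 -> (comp z0 <= 0)%E -> (p_res mu dollar HK <= p%:E)%E.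
Proof.
move=> t0 rate pt z00 cz.
have [B [e1 [B0 e10 BP]]] := comp_rate t0 rate pt.
have p0 : 0 < p by apply: lt_trans pt; rewrite divr_gt0.
pose e2 := e1 / 2; have e20 : 0 < e2 by rewrite divr_gt0.
have e21 : 0 < e2 < e1 by rewrite e20 /e2; lra.
apply: ereal_inf_lbound; exists p => //; split; first exact: ltW.
exists (B + B * e2 `^ (- p) * z0 `^ p).
  by rewrite addr_ge0 ?mulr_ge0 ?powR_ge0 ?ltW.
move=> eps eps0; rewrite mulrDl.
have h1 : 0 <= B * eps `^ (- p) by rewrite mulr_ge0 ?powR_ge0 ?ltW.
have h2 : 0 <= B * e2 `^ (- p) by rewrite mulr_ge0 ?powR_ge0 ?ltW.
have [ee|ee] := ltP eps e1.
  apply: le_trans (BP eps _) _; first by rewrite eps0.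
  by rewrite lee_fin lerDl -mulrA mulr_ge0// mulr_ge0 ?powR_ge0.
have [ez|ez] := leP z0 eps.
  apply: le_trans (comp_anti ez) _; apply: le_trans cz _.
  by rewrite lee_fin addr_ge0// -mulrA mulr_ge0// mulr_ge0 ?powR_ge0.
have : (comp eps <= comp e2)%E by apply: comp_anti; rewrite /e2; lra.
move/le_trans; apply; apply: (le_trans (BP e2 e21)); rewrite lee_fin.
apply: (@le_trans _ _ (B * e2 `^ (- p) * z0 `^ p * eps `^ (- p))); last by rewrite lerDr.
rewrite -[leRHS]mulrA ler_peMr// powRN ler_pdivlMr ?powR_gt0// mul1r.
by rewrite ge0_ler_powR ?nnegrE ?ltW.
Qed.

End complexity.

(** * Consequences of the decay, and conclusion *)

Section decay.
Variables (R : realType) (D : set R) (a : D).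
Local Notation T := (dom a).
Variable k : T -> T -> R.
Hypothesis kaa0 : 0 < k a a.
Variable gamma : {fset nat} -> R.
Hypothesis gamma_ge0 : forall u, 0 <= gamma u.
Hypothesis a_anchor :
  (\esum_(u in [set: {fset nat}]) (gamma u * k a a ^+ #|` u|%fset)%:E < +oo)%E.
Hypothesis decay_gt1 : (1 < decay k gamma)%E.

(** The hypothesis amounts to tau' / alpha0 < decay, so some p > tau' / alpha0 has gamma_hat^(1 / p)
    summable, and a bounded family admits the larger exponent alpha0 / tau'. For infinite decay,
    tau' / decay is 0 and the hypothesis reads 0 < alpha0. *)
Lemma gamma_hat_summable tau' alpha0 : 0 < tau' ->
  (tau'%:E / decay k gamma < alpha0%:E)%E ->
  0 < alpha0 /\ rsummable (fun u => gamma_hat k gamma u `^ (alpha0 / tau')).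
Proof.
move=> t0 ta.
have [a0 lt] : 0 < alpha0 /\ ((tau' / alpha0)%:E < decay k gamma)%E.
  move: ta decay_gt1; case: (decay k gamma) => [d||]//=.
    rewrite inver !lte_fin => h d1; move: h; rewrite gt_eqF; last by lra.
    rewrite -EFinM lte_fin => h.
    have d0 : 0 < d by lra.
    have a0 : 0 < alpha0 by apply: lt_trans h; rewrite divr_gt0.
    by split => //; move: h; rewrite ltr_pdivrMr// ltr_pdivrMr// mulrC.
  by rewrite invey mule0 lte_fin => a0 _; split => //; exact: ltry.
split => //; have [_ [p /= pS <-]] := ereal_sup_gt lt.
rewrite lte_fin => tp.
have p0 : 0 < p by apply: lt_trans tp; rewrite divr_gt0.
have g0 u : 0 <= gamma_hat k gamma u by rewrite mulr_ge0// exprn_ge0// ltW.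
have gS : rsummable (gamma_hat k gamma) by apply/ge0_rsummable.
apply: (rsummable_powR (r := p^-1) (B := asum (gamma_hat k gamma))).
- by move=> u; rewrite g0 le_asum1.
- by rewrite invr_gt0.
- by rewrite -[leRHS]invf_div lef_pV2 ?posrE ?divr_gt0// ltW.
- by apply/ge0_rsummable => // u; exact: powR_ge0.
Qed.

(** Either tau' = tau, or tau' = decay - 1 - x with x small enough for 0 < tau' and for the gap xi.
    In the second case decay <= 1 + tau is finite. *)
Lemma exists_rate_exponent c C tau alpha1 alpha2 xi : 0 < tau -> 0 < xi ->
  asymptotic_estimates k gamma c C tau alpha1 alpha2 ->
  exists tau', [/\ 0 < tau', tau' <= tau,
    fine (mine tau%:E (decay k gamma - 1))%E - xi < tau' &
    estimates_for k gamma c C alpha1 alpha2 tau'].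
Proof.
move=> tau0 xi0; rewrite /asymptotic_estimates; case: ifPn => [lt est|].
  exists tau; split => //; rewrite /mine lt/=; lra.
rewrite -leNgt => ge est.
have [d dE] : exists d, decay k gamma = d%:E.
  by move: ge decay_gt1; case: (decay k gamma) => [d||]//= _ _; exists d.
have d1 : 1 < d by move: decay_gt1; rewrite dE.
have dtau : d - 1 <= tau by move: ge; rewrite dE -EFinB lee_fin.
have -> : fine (mine tau%:E (decay k gamma - 1))%E = d - 1.
  by rewrite dE -EFinB -EFin_min /= min_r.
have : \forall x \near 0^'+, [/\ 0 < x, x < d - 1, x < xi &
    estimates_for k gamma c C alpha1 alpha2 (fine (decay k gamma) - 1 - x)].
  near=> x; split.
  - by near: x; exact: nbhs_right_gt.
  - by near: x; apply: nbhs_right_lt; lra.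
  - by near: x; exact: nbhs_right_lt.
  - by near: x.
move=> /filter_ex[x [x0 xd xxi]]; rewrite dE/= => estx.
by exists (d - 1 - x); split => //; lra.
Unshelve. all: by end_near.
Qed.

End decay.

(** Below n0 monotonicity bounds $(n) by $(n0), a constant; $(n0) >= 1 shows that A is
    non-negative. *)
Lemma expR_bound (R : realType) (dollar : nat -> \bar R) (sigma : R) : 0 < sigma ->
  (forall n, (1 <= dollar n)%E) ->
  (forall m n, (m <= n)%N -> (dollar m <= dollar n)%E) ->
  (exists A : R, \forall n \near \oo, (dollar n <= (A * expR (sigma * n%:R))%:E)%E) ->
  exists S0 : R, forall n, (dollar n <= (S0 * expR (sigma * n%:R))%:E)%E.
Proof.
move=> s0 d1 dm [A [n0 _ An]].
have e1 n : 1 <= expR (sigma * n%:R) :> R.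
  by rewrite -expR0 ler_expR mulr_ge0// ltW.
have A0 : 0 <= A.
  have := le_trans (d1 n0) (An n0 (leqnn n0)); rewrite lee_fin => h.
  have := e1 n0; nra.
exists (A * expR (sigma * n0%:R)) => n; have [nn|nn] := leqP n0 n.
  apply: (le_trans (An n nn)); rewrite lee_fin ler_wpM2r ?expR_ge0//.
  by rewrite ler_peMr.
apply: (le_trans (dm _ _ (ltnW nn))); apply: (le_trans (An n0 (leqnn n0))).
by rewrite lee_fin ler_peMr// mulr_ge0// expR_ge0.
Qed.

(** The map t to 2 / t exchanges minimum and maximum. For infinite decay the second rate is 2 / +oo
    = 0, and tau decides. *)
Lemma maxe_inv_mine (R : realType) (tau : R) (d : \bar R) : 0 < tau -> (1 < d)%E ->
  let mv := fine (mine tau%:E (d - 1))%E in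
  0 < mv /\ maxe (2 / tau)%:E (2%:E / (d - 1))%E = (2 / mv)%:E.
Proof.
move=> tau0; case: d => [d||]//= d1.
  have d0 : 0 < d - 1 by move: d1; rewrite lte_fin; lra.
  rewrite -EFinB -EFin_min inver gt_eqF// -EFinM -EFin_max/=.
  split; first by rewrite lt_min tau0.
  congr (_%:E); have [h|h] := leP tau (d - 1).
    by rewrite max_l// ler_pM2l// lef_pV2.
  by rewrite max_r// ler_pM2l// lef_pV2 ?posrE// ltW.
rewrite addye// invey mule0 miney/=; split => //.
by rewrite -EFin_max max_l// divr_ge0// ltW.
Qed.

Lemma exists_exponent_gap (R : realType) (m y : R) : 0 < m -> 2 / m < y ->
  exists2 xi, 0 < xi & forall t, 0 < t -> m - xi < t -> 2 / t < y.
Proof.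
move=> m0 my; have y0 : 0 < y by apply: lt_trans my; rewrite divr_gt0.
exists (m - 2 / y) => [|t t0].
  by rewrite subr_gt0 ltr_pdivrMr// mulrC -ltr_pdivrMr.
by rewrite opprB addrC subrK ltr_pdivrMr// mulrC -ltr_pdivrMr.
Qed.

Theorem theorem4p1 (R : realType) (D : set R) (a : D)
  (rho : probability (dom a) R)
  (mu : probability (prodspace nat (dom a)) R)
  (mu_prod : is_prod_measure rho mu)
  (k : dom a -> dom a -> R)
  (k_meas : measurable_fun setT (fun z : dom a * dom a => k z.1 z.2))
  (k_neq0 : exists x y, k x y != 0)
  (Hk : rkhs k)
  (Hk_const : forall b : R, rk_space Hk (fun=> b) -> b = 0)
  (M : R)
  (M_def : (\int[rho]_x (k x x)%:E = M%:E)%E)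
  (k_int0 : forall y, (\int[rho]_x (k x y)%:E = 0)%E)
  (k_diag : forall x, 0 < k x x)
  (gamma : {fset nat} -> R)
  (gamma_ge0 : forall u, 0 <= gamma u)
  (gamma0 : gamma fset0 = 1)
  (gamma_sum :
    (\esum_(u in [set: {fset nat}]) (gamma u * M ^+ #|` u|%fset)%:E < +oo)%E)
  (gamma_down : forall u v : {fset nat}, (u `<=` v)%fset ->
    0 < gamma v -> 0 < gamma u)
  (a_anchor :
    (\esum_(u in [set: {fset nat}]) (gamma u * k a a ^+ #|` u|%fset)%:E
      < +oo)%E)
  (Hu : forall u, rkhs (@kprod R D a k u))
  (HK : rkhs (@Kker R D a k gamma))
  (dollar : nat -> \bar R)
  (dollar_ge1 : forall n, (1 <= dollar n)%E)
  (dollar_mono : forall m n, (m <= n)%N -> (dollar m <= dollar n)%E)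
  (sigma : R) (sigma_gt0 : 0 < sigma)
  (dollar_O : exists A : R, \forall n \near \oo,
    (dollar n <= (A * expR (sigma * n%:R))%:E)%E)
  (decay_gt1 : (1 < decay k gamma)%E)
  (c C tau alpha1 alpha2 : R)
  (c_gt0 : 0 < c) (C_gt0 : 0 < C) (tau_gt0 : 0 < tau)
  (alpha1_ge0 : 0 <= alpha1) (alpha2_ge0 : 0 <= alpha2) (alpha2_le1 : alpha2 <= 1)
  (quad : quad_assumption gamma mu rho Hu c C tau alpha1 alpha2)
  (rsq_O : exists A : R, forall u, (rsq k gamma u <= (A * gamma u)%:E)%E)
  (est : asymptotic_estimates k gamma c C tau alpha1 alpha2) :
  (forall delta : R, 0 < delta ->
     exists A : R, \forall N \near +oo,
       (min_error mu dollar HK N (rk_ball HK) ^+ 2 <=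
        (A * N `^ (- fine (mine tau%:E (decay k gamma - 1))%E + delta))%:E)%E) /\
  (p_res mu dollar HK <=
     maxe (2 / tau)%:E (2%:E / (decay k gamma - 1)))%E.
Proof.
have kaa0 : 0 < k a a by exact: k_diag.
have dollar_ge0 n : (0 <= dollar n)%E by exact: le_trans (dollar_ge1 n).
have [S0 dollarS] := expR_bound sigma_gt0 dollar_ge1 dollar_mono dollar_O.
have [A A0 rsqA] : exists2 A : R, 0 <= A & forall u, (rsq k gamma u <= (A * gamma u)%:E)%E.
  have [A AP] := rsq_O; exists (Num.max A 0) => [|u]; first by rewrite le_max lexx orbT.
  by apply: (le_trans (AP u)); rewrite lee_fin ler_wpM2r// le_max lexx.
set mv := fine _.
have rate xi : 0 < xi -> exists tau', [/\ 0 < tau', mv - xi < tau' &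
    has_rate mu HK dollar tau'].
  move=> xi0.
  have [tau' [t0 tt mt [alpha0 [h1 h2 h3 h4]]]] :=
    exists_rate_exponent decay_gt1 tau_gt0 xi0 est.
  have [a0 gS] := gamma_hat_summable kaa0 gamma_ge0 a_anchor decay_gt1 t0 h1.
  exists tau'; split => // eta eta0.
  exact: (has_alg_rate k_meas k_diag mu_prod M_def k_int0 Hk gamma_ge0 gamma_sum
    gamma_down a_anchor HK dollar_ge0 dollar_mono (ltW sigma_gt0) dollarS c_gt0 C_gt0
    quad A0 rsqA t0 tt a0 h3 gS h4 eta0).
split=> [delta d0|].
  (* One half of delta pays for tau' > mv - delta / 2, the other for the loss in
     [min_error_rate]. *)
  have d20 : 0 < delta / 2 by rewrite divr_gt0.
  have [tau' [t0 mt rt]] := rate _ d20.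
  have [B BP] := min_error_rate t0 rt d20.
  (* The constant has to be non-negative before the exponent of N is enlarged. *)
  exists (Num.max B 0); near=> N.
  have N1 : 1 <= N by near: N; apply: nbhs_pinfty_ge; exact: num_real.
  have BN : (min_error mu dollar HK N (rk_ball HK) ^+ 2 <=
    (B * N `^ (- tau' + delta / 2))%:E)%E by near: N.
  apply: (le_trans BN); rewrite lee_fin.
  apply: (@le_trans _ _ (Num.max B 0 * N `^ (- tau' + delta / 2))).
    by rewrite ler_wpM2r ?powR_ge0// le_max lexx.
  rewrite ler_wpM2l ?le_max ?lexx ?orbT// ler_powR//; lra.
have [mv0 ->] := maxe_inv_mine tau_gt0 decay_gt1.
have [z0 z00 [Q [Q1 Q2 Q3]]] := exists_zero_alg k_meas k_diag mu_prod M_def gamma_ge0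
  gamma_sum a_anchor HK dollar_ge0 dollar_mono.
have cz := le_trans (comp_le_cost Q1 Q3) Q2.
(* It suffices to reach every 2 / mv + e, and 2 / tau' is below that once tau' is close enough to
   mv. *)
apply/lee_addgt0Pr => e e0; rewrite -EFinD.
have y1 : 2 / mv < 2 / mv + e by rewrite ltrDl.
have [xi xi0 xiP] := exists_exponent_gap mv0 y1.
have [tau' [t0 mt rt]] := rate _ xi0.
exact: (p_res_le t0 rt (xiP _ t0 mt) z00 cz).
Unshelve. all: by end_near.
Qed.
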